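(* Let $X$ be a complex Banach space with open unit ball $\mathbb{B}$. Let $\Phi:\mathbb{U}\to\mathbb{C}$ be a biholomorphic function onto its image with $\Phi(0)=1$, $\operatorname{Re}\Phi(z)>0$ on $\mathbb{U}$, $\Phi'(0)>0$, $\Phi''(0)\in\mathbb{R}$, and suppose that $$2\Phi'(0)-2(\Phi'(0))^2\le\Phi''(0)\le 6(\Phi'(0))^2-2\Phi'(0).$$ Let $g:\mathbb{B}\to\mathbb{C}$ be holomorphic with $g(0)=1$, let $G(z)=z\,g(z)$, and suppose that $(DG(z))^{-1}G(z)\in\mathcal{M}_\Phi$. For $z\in\mathbb{B}\setminus\{0\}$ and $l_z\in T_z$ put $$b_3=\frac{l_z(D^3G(0)(z^3))}{3!\,\|z\|^3},\qquad b_2=\frac{l_z(D^2G(0)(z^2))}{2!\,\|z\|^2}.$$ Then for all $z\in\mathbb{B}\setminus\{0\}$ and $l_z\in T_z$, $$|2b_2^2b_3-b_3^2-2b_2^2+1|\le 1+2(\Phi'(0))^2+\frac{(\Phi'(0))^2}{4}\left(3\Phi'(0)-\frac{\Phi''(0)}{2\Phi'(0)}\right)\left(\frac{\Phi''(0)}{2\Phi'(0)}+\Phi'(0)\right).$$ The bound is sharp, i.e. for each such $\Phi$ equality holds for some such $g$ and some $z\in\mathbb{B}\setminus\{0\}$, $l_z\in T_z$.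
   Context: $\mathbb{U}$ is the open unit disk in $\mathbb{C}$; $X$ is a (nonzero) complex Banach space with norm $\|\cdot\|$ and $\mathbb{B}=\{z\in X:\|z\|<1\}$. For $z\in X\setminus\{0\}$, $T_z=\{l_z\in L(X,\mathbb{C}): l_z(z)=\|z\|,\ \|l_z\|=1\}$, where $L(X,\mathbb{C})$ is the set of continuous linear functionals. $D^kG(0)$ is the $k$-th Fréchet derivative of $G$ at $0$ (a bounded symmetric $k$-linear map), and $D^kG(0)(z^k)=D^kG(0)(z,\dots,z)$ ($k$ times). $\mathcal{M}_\Phi$ is the class of holomorphic mappings $p:\mathbb{B}\to X$ with $p(0)=0$, $Dp(0)=I$ (the identity) and $\|z\|/l_z(p(z))\in\Phi(\mathbb{U})$ for all $z\in\mathbb{B}\setminus\{0\}$, $l_z\in T_z$. The condition $(DG(z))^{-1}G(z)\in\mathcal{M}_\Phi$ includes that $DG(z)$ has a bounded inverse for every $z\in\mathbb{B}$. *)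

(* Defs.v *)
From HB Require Import structures.
From mathcomp Require Import all_boot all_order all_algebra.
From mathcomp Require Import all_classical all_reals all_analysis.
From mathcomp Require Import complex.

Set Implicit Arguments.
Unset Strict Implicit.
Unset Printing Implicit Defensive.

Import Order.TTheory GRing.Theory Num.Theory.
Import numFieldNormedType.Exports.

Local Open Scope ring_scope.
Local Open Scope complex_scope.
Local Open Scope classical_set_scope.

Definition bounded_linear (R : realType) (X Y : normedModType R[i]) :
    {pred X -> Y} :=
  fun f => `[< linear f /\ continuous f >].

Record bounded_op (R : realType) (X Y : normedModType R[i]) := BoundedOp {
  bounded_op_fun :> X -> Y ;
  _ : bounded_op_fun \in @bounded_linear R X Y }.

Section bounded_op_lmodule.
Variables (R : realType) (X Y : normedModType R[i]).

HB.instance Definition _ := [isSub for @bounded_op_fun R X Y].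
HB.instance Definition _ := [Choice of bounded_op X Y by <:].

Lemma bounded_linear_submod_closed : submod_closed (@bounded_linear R X Y).
Proof.
split=> [|a f g /asboolP[lf cf] /asboolP[lg cg]]; apply/asboolP; split.
- by move=> a x y; rewrite -[0 x]/0 -[0 y]/0 scaler0 addr0.
- exact: cst_continuous.
- move=> b x y; rewrite -![(a *: f + g) _]/(a *: f _ + g _) lf lg.
  by rewrite !scalerDr !scalerA (mulrC a b) addrACA.
- by move=> x; apply: cvgD; [apply: cvgZl_tmp; exact: cf|exact: cg].
Qed.

HB.instance Definition _ :=
  GRing.isSubmodClosed.Build R[i] (X -> Y) (@bounded_linear R X Y)
    bounded_linear_submod_closed.
HB.instance Definition _ := [SubChoice_isSubLmodule of bounded_op X Y by <:].

Lemma bounded_op_linear (T : bounded_op X Y) : linear T.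
Proof. by case: T => f /= /asboolP[]. Qed.

HB.instance Definition _ (T : bounded_op X Y) :=
  GRing.isLinear.Build R[i] X Y _ (T : X -> Y) (bounded_op_linear T).

Lemma bounded_op_continuous (T : bounded_op X Y) : continuous T.
Proof. by case: T => f /= /asboolP[]. Qed.

End bounded_op_lmodule.

(* Norms over R[i] take their values in R[i], which has no suprema: the
   supremum is taken over the real parts of the (real) values of `|T x|. *)
Section bounded_op_norm.
Variables (R : realType) (X Y : normedModType R[i]).
Implicit Types T S : bounded_op X Y.

Definition op_norm T : R[i] :=
  (sup [set complex.Re `|T x| | x in [set x : X | `|x| <= 1]])%:C.

Let ReK (x : R[i]) : 0 <= x -> (complex.Re x)%:C = x.
Proof. by case: x => a b; rewrite lecE /= => /andP[/eqP -> _]. Qed.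

Let has_sup_op T :
  has_sup [set complex.Re `|T x| | x in [set x : X | `|x| <= 1]].
Proof.
split; first by exists (complex.Re `|T 0|), 0 => //=; rewrite normr0.
have /linear_boundedP/pinfty_ex_gt0[M M0 TM] :=
  continuous_linear_bounded (0 : X) (@bounded_op_continuous _ _ _ T 0).
exists (complex.Re M) => _ [x /= x1 <-].
rewrite -lecR !ReK// ?(ltW M0)//.
by rewrite (le_trans (TM x))// ler_piMr// ltW.
Qed.

Let op_norm_ub1 T x : `|x| <= 1 -> `|T x| <= op_norm T.
Proof.
move=> x1; rewrite -[leLHS]ReK// lecR.
by apply: ub_le_sup; [exact: (has_sup_op T).2|exists x].
Qed.

Let op_norm_le T (M : R[i]) : 0 <= M ->
  (forall x, `|x| <= 1 -> `|T x| <= M) -> op_norm T <= M.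
Proof.
move=> M0 TM; rewrite -[leRHS]ReK// lecR.
apply: ge_sup; first exact: (has_sup_op T).1.
by move=> _ [x /= x1 <-]; rewrite -lecR !ReK// TM.
Qed.

Let op_norm_ge0 T : 0 <= op_norm T.
Proof. by apply: le_trans (op_norm_ub1 T (x := 0) _) => //; rewrite normr0. Qed.

Lemma op_norm_ub T x : `|T x| <= op_norm T * `|x|.
Proof.
have [->|x0] := eqVneq x 0; first by rewrite linear0 !normr0 mulr0.
rewrite -ler_pdivrMr ?normr_gt0//.
have -> : `|T x| / `|x| = `|T (`|x|^-1 *: x)|.
  by rewrite linearZ /= normrZ normfV normr_id mulrC.
by apply: op_norm_ub1; rewrite normrZ normfV normr_id mulVf// normr_eq0.
Qed.

Let op_normD T S : op_norm (T + S) <= op_norm T + op_norm S.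
Proof.
apply: op_norm_le => [|x x1]; first by rewrite addr_ge0.
rewrite -[(T + S) x]/(T x + S x) (le_trans (ler_normD _ _))//.
by rewrite lerD// op_norm_ub1.
Qed.

Let op_normZ_le (a : R[i]) T : op_norm (a *: T) <= `|a| * op_norm T.
Proof.
apply: op_norm_le => [|x x1]; first by rewrite mulr_ge0.
by rewrite -[(a *: T) x]/(a *: T x) normrZ ler_wpM2l// op_norm_ub1.
Qed.

Let op_norm0_eq0 T : op_norm T = 0 -> T = 0.
Proof.
move=> T0; apply: val_inj; apply/funext => x /=.
by apply/normr0_eq0/le_anti; rewrite normr_ge0 (le_trans (op_norm_ub T x))//
  T0 mul0r.
Qed.

Let op_normZ (a : R[i]) T : op_norm (a *: T) = `|a| * op_norm T.
Proof.
have [->|a0] := eqVneq a 0.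
  apply/le_anti; rewrite op_normZ_le/= normr0 mul0r; exact: op_norm_ge0.
apply/le_anti; rewrite op_normZ_le/= -ler_pdivlMl ?normr_gt0//.
by rewrite -normfV (le_trans _ (op_normZ_le _ _))// scalerA mulVf// scale1r.
Qed.

HB.instance Definition _ := @Lmodule_isNormed.Build R[i] (bounded_op X Y)
  op_norm op_normD op_normZ op_norm0_eq0.

Lemma normr_bounded_op T : `|T| = op_norm T. Proof. by []. Qed.

End bounded_op_norm.

Section frechet_derivatives.
Variables (R : realType) (X Y : normedModType R[i]).

(* The default value 0 is only reached when 'd f x is not continuous, hence
   only when f is not differentiable at x. *)
Definition frechet (f : X -> Y) (x : X) : bounded_op X Y :=
  insubd 0 ('d f x : X -> Y).

Lemma frechetE (f : X -> Y) (x : X) :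
  differentiable f x -> frechet f x = 'd f x :> (X -> Y).
Proof.
move=> df; rewrite /frechet -[LHS]/(val _) val_insubd ifT//.
by apply/asboolP; split; [exact: linearP|exact: diff_continuous].
Qed.

End frechet_derivatives.

Section higher_frechet_derivatives.
Variables (R : realType) (X Y : normedModType R[i]).

(* k-linear maps in curried form: L(X, L(X, ... L(X, Y))) *)
Fixpoint multi_op (k : nat) : normedModType R[i] :=
  if k is k'.+1 then bounded_op X (multi_op k') else Y.

Fixpoint frechetn (k : nat) (f : X -> Y) : X -> multi_op k :=
  if k is k'.+1 then frechet (frechetn k' f) else f.

Fixpoint diag_op (k : nat) (z : X) : multi_op k -> Y :=
  if k is k'.+1 then fun T => diag_op z (T z) else id.

End higher_frechet_derivatives.

Definition unit_ball (R : realType) (X : normedModType R[i]) : set X :=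
  [set z | `|z| < 1].

(* Complex Fréchet differentiability: the scalars of X and Y are R[i]. *)
Definition holomorphic (R : realType) (X Y : normedModType R[i])
    (D : set X) (f : X -> Y) : Prop :=
  forall z, D z -> differentiable f z.

Definition biholomorphic_onto_image (R : realType) (D : set R[i]^o)
    (f : R[i]^o -> R[i]^o) : Prop :=
  [/\ holomorphic D f, open (f @` D) &
      exists h : R[i]^o -> R[i]^o,
        holomorphic (f @` D) h /\ (forall z, D z -> h (f z) = z)].

Definition support_functionals (R : realType) (X : normedModType R[i])
    (z : X) : set (bounded_op X R[i]^o) :=
  [set l : bounded_op X R[i]^o | l z = `|z| /\ `|l| = 1].

(* The condition l (p z) != 0 makes the quotient meaningful, as x / 0 = 0. *)
Definition class_M (R : realType) (X : normedModType R[i])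
    (Phi : R[i]^o -> R[i]^o) (p : X -> X) : Prop :=
  [/\ holomorphic (@unit_ball R X) p,
      p 0 = 0,
      (forall v, 'd p 0 v = v) &
      forall (z : X) (l : bounded_op X R[i]^o),
        unit_ball z -> z != 0 -> support_functionals z l ->
        l (p z) != 0 /\
        (Phi @` @unit_ball R R[i]^o) (`|z| / l (p z))].

(* "(DG)^{-1} G belongs to M_Phi"; A z is the bounded inverse of DG(z). *)
Definition inv_deriv_in_class_M (R : realType) (X : normedModType R[i])
    (Phi : R[i]^o -> R[i]^o) (G : X -> X) : Prop :=
  exists A : X -> bounded_op X X,
    (forall z, unit_ball z ->
      (forall v, A z ('d G z v) = v) /\ (forall v, 'd G z (A z v) = v)) /\
    class_M Phi (fun z => A z (G z)).

(* l_z(D^k G(0)(z^k)) / (k! ||z||^k) *)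
Definition coef (R : realType) (X : normedModType R[i]) (G : X -> X)
    (z : X) (l : bounded_op X R[i]^o) (k : nat) : R[i] :=
  l (diag_op z (frechetn k G 0)) / (k`!%:R * `|z| ^+ k).

(* Main.v *)
(* For |x| = 1 put f(t) = g(t x). Membership in M_Phi says that 1 + t f'(t) / f(t)
   takes its values in Phi(U), hence equals Phi(w(t)) for a Schwarz function w,
   while b2 = f'(0) and b3 = f''(0) / 2. The coefficients of w satisfy |c1| <= 1 and
   |c2| <= 1 - |c1|^2, and the hypotheses on Phi turn this into bounds on |b2|, |b3|
   and |2 b2^2 - b3|; the expression is 1 - 2 b2^2 + b3 (2 b2^2 - b3). Equality
   occurs for w(t) = i t, f(t) = exp of the primitive of (Phi(i t) - 1) / t, and
   g = f o l with l a norming functional of a vector z.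

   Holomorphic means complex differentiable at each point, so the existence of
   the higher derivatives has to come from Cauchy's theorem. It is used through the
   estimate |f(z) - f(0)| <= 12 M |z| / r for |f| <= M on the disc of radius r;
   iterated on differences, it shows that the Fréchet derivative of a holomorphic
   map into a Banach space is again holomorphic. *)
Require Import Defs.
From HB Require Import structures.
From mathcomp Require Import all_boot all_order all_algebra.
From mathcomp Require Import all_classical all_reals all_analysis.
From mathcomp Require Import complex.
From mathcomp Require Import ring lra.

Set Implicit Arguments.
Unset Strict Implicit.
Unset Printing Implicit Defensive.

Import Order.TTheory GRing.Theory Num.Theory.
Import numFieldNormedType.Exports.

Local Open Scope ring_scope.
Local Open Scope complex_scope.
Local Open Scope classical_set_scope.

(** The estimate lives on one disc, but b2 and b3 are defined through D^kG(0) as elements of nested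
    operator spaces. Regularity is therefore needed for maps with values in such spaces: the Cauchy
    theory is vector-valued, and completeness has to pass to spaces of operators. The Lipschitz
    estimate asks for a bound on increments, not for a formula, so finite sums around a square
    replace integrals: it is enough that the sums of difference quotients become small and that the
    sum of 1/z stays away from 0. The constant 12 combines the perimeter 8 of the square, a kernel
    bound 2 |a|, the lower bound 4 and the scaling of a disc of radius 3/2 to radius r. Third
    differences enter because the symmetry of the second derivative is read off from second
    differences of the map, with a third difference as error. The rotation in w(t) = i t has a
    purpose: with w(t) = t the term -2 b2^2 would lower the value, whereas b2 = i Phi'(0) makes it 2
    Phi'(0)^2 and turns every triangle inequality of the estimate into an equality. *)

(** * Real-valued norms and derivatives in epsilon-delta form *)

Section RealNorm.
Variable R : realType.
Implicit Types (V W : normedModType R[i]).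

(* Norms over R[i] take their values in R[i]; all estimates are made in R. *)
Definition rnorm V (x : V) : R := complex.Re `|x|.

Lemma rnormE V (x : V) : (rnorm x)%:C = `|x|.
Proof. by rewrite /rnorm RRe_real// ger0_real. Qed.

Lemma rnorm_ge0 V (x : V) : 0 <= rnorm x.
Proof. by rewrite -lecR rnormE normr_ge0. Qed.

Lemma rnorm0 V : rnorm (0 : V) = 0.
Proof. by rewrite /rnorm normr0. Qed.

Lemma rnorm0_eq0 V (x : V) : rnorm x = 0 -> x = 0.
Proof. by move=> h; apply/normr0_eq0; rewrite -rnormE h. Qed.

Lemma rnorm_eq0 V (x : V) : (rnorm x == 0) = (x == 0).
Proof. by apply/eqP/eqP => [/rnorm0_eq0//|->]; exact: rnorm0. Qed.

Lemma rnorm_gt0 V (x : V) : (0 < rnorm x) = (x != 0).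
Proof. by rewrite lt_def rnorm_ge0 rnorm_eq0 andbT. Qed.

Lemma rnormD V (x y : V) : rnorm (x + y) <= rnorm x + rnorm y.
Proof. by rewrite -lecR rmorphD /= !rnormE ler_normD. Qed.

Lemma rnormN V (x : V) : rnorm (- x) = rnorm x.
Proof. by rewrite /rnorm normrN. Qed.

Lemma rnorm_distC V (x y : V) : rnorm (x - y) = rnorm (y - x).
Proof. by rewrite /rnorm distrC. Qed.

Lemma rnormB V (x y : V) : rnorm (x - y) <= rnorm x + rnorm y.
Proof. by rewrite -[rnorm y]rnormN rnormD. Qed.

Lemma rnorm_tri V (x y z : V) : rnorm (x - z) <= rnorm (x - y) + rnorm (y - z).
Proof. by have := rnormD (x - y) (y - z); rewrite addrA subrK. Qed.

Lemma rnormZ V (a : R[i]^o) (x : V) : rnorm (a *: x) = rnorm a * rnorm x.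
Proof. by apply/complexI; rewrite rmorphM /= !rnormE normrZ. Qed.

Lemma rnormM (a b : R[i]^o) : rnorm (a * b) = rnorm a * rnorm b.
Proof. exact: (rnormZ a b). Qed.

Lemma rnormV (a : R[i]^o) : rnorm (a^-1 : R[i]^o) = (rnorm a)^-1.
Proof. by apply/complexI; rewrite fmorphV /= !rnormE normfV. Qed.

Lemma rnorm1 : rnorm (1 : R[i]^o) = 1.
Proof. by rewrite /rnorm normr1. Qed.

Lemma rnormX (a : R[i]^o) n : rnorm (a ^+ n : R[i]^o) = rnorm a ^+ n.
Proof. by elim: n => [|n IH]; rewrite ?rnorm1// !exprS rnormM IH. Qed.

Lemma rnorm_real (r : R) : rnorm (r%:C : R[i]^o) = `|r|.
Proof. by rewrite /rnorm normc_def /= expr0n addr0 sqrtr_sqr. Qed.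

Lemma rnorm_sq (a : R[i]^o) :
  rnorm a ^+ 2 = complex.Re a ^+ 2 + complex.Im a ^+ 2.
Proof.
by rewrite /rnorm normc_def /= sqr_sqrtr// addr_ge0// sqr_ge0.
Qed.

Lemma rnorm_i : rnorm ('i%C : R[i]^o) = 1.
Proof.
have := rnorm_sq ('i%C : R[i]^o); rewrite /= expr0n expr1n add0r => /eqP.
by rewrite sqrp_eq1 ?rnorm_ge0// => /eqP.
Qed.

Lemma Re_le_rnorm (a : R[i]^o) : `|complex.Re a| <= rnorm a.
Proof.
by rewrite -(@ler_pXn2r _ 2)// ?nnegrE ?rnorm_ge0// rnorm_sq real_normK ?num_real//
  lerDl sqr_ge0.
Qed.

Lemma Im_le_rnorm (a : R[i]^o) : `|complex.Im a| <= rnorm a.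
Proof.
by rewrite -(@ler_pXn2r _ 2)// ?nnegrE ?rnorm_ge0// rnorm_sq real_normK ?num_real//
  lerDr sqr_ge0.
Qed.

Lemma rnorm_le_ReIm (a : R[i]^o) :
  rnorm a <= `|complex.Re a| + `|complex.Im a|.
Proof.
rewrite -(@ler_pXn2r _ 2)// ?nnegrE ?rnorm_ge0 ?addr_ge0// rnorm_sq.
rewrite sqrrD !real_normK ?num_real// lerD2r lerDl mulrn_wge0// mulr_ge0//.
Qed.

Lemma normr_le_rnorm V (x : V) (e : R) : (`|x| <= e%:C) = (rnorm x <= e).
Proof. by rewrite -rnormE lecR. Qed.

Lemma normr_lt_rnorm V (x : V) (e : R) : (`|x| < e%:C) = (rnorm x < e).
Proof. by rewrite -rnormE ltcR. Qed.

Lemma unit_ballE V (x : V) : unit_ball x <-> rnorm x < 1.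
Proof. by rewrite /unit_ball /= -[1]/(1%:C) normr_lt_rnorm. Qed.

Lemma cpos_real (e : R[i]) : 0 < e -> exists2 r : R, 0 < r & e = r%:C.
Proof.
move=> e0; exists (complex.Re e); last by rewrite RRe_real// gtr0_real.
by move: e0; rewrite ltcE => /andP[].
Qed.

Lemma nbhs_rnormP V (x : V) (P : set V) :
  (\forall y \near x, P y) <->
  exists2 d : R, 0 < d & forall y, rnorm (y - x) < d -> P y.
Proof.
split=> [/nbhs_ballP[e /= /cpos_real[d d0 ->] H]|[d d0 H]].
  by exists d => // y yx; apply: H; rewrite -ball_normE /= distrC normr_lt_rnorm.
apply/nbhs_ballP; exists d%:C => /=; first by rewrite ltcR.
by move=> y; rewrite -ball_normE /= distrC normr_lt_rnorm; exact: H.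
Qed.

(** Only the o(h) estimate, with real radii and a closed ball of increments. Linearity and
    boundedness of [L] are supplied separately, so that [L] may be an explicit formula. *)
Definition fdiff V W (f : V -> W) (x : V) (L : V -> W) : Prop :=
  forall e : R, 0 < e -> exists2 d : R, 0 < d &
    forall h, rnorm h <= d -> rnorm (f (x + h) - f x - L h) <= e * rnorm h.

Lemma littleo_rnormP V W (f : V -> W) (x : V) (L : V -> W) :
  (f \o shift x = cst (f x) + L +o_ 0 id) <-> fdiff f x L.
Proof.
rewrite eqaddoP; split.
  move=> H e e0; have /H/nbhs_rnormP[d d0 {}H] : 0 < e%:C by rewrite ltcR.
  exists (d / 2); first lra.
  move=> h hd; have := H h; rewrite subr0 => /(_ _)/wrap[|]; first lra.
  rewrite -[X in `|X|]/(f (h + x) - (f x + L h)) -[X in _ * `|X|]/h -[`|h|]rnormE.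
  by rewrite -rmorphM /= normr_le_rnorm opprD addrA [h + x]addrC.
move=> H _ /cpos_real[e e0 ->]; have [d d0 {}H] := H e e0.
apply/nbhs_rnormP; exists d => // h; rewrite subr0 => /ltW/H.
rewrite -[X in _ -> `|X| <= _]/(f (h + x) - (f x + L h)) -[X in _ * `|X|]/h.
by rewrite -[`|h|]rnormE -rmorphM /= normr_le_rnorm opprD addrA [h + x]addrC.
Qed.

Lemma differentiable_fdiff V W (f : V -> W) x :
  differentiable f x -> fdiff f x ('d f x).
Proof. by move=> /diff_locallyP[_ /littleo_rnormP]. Qed.

Lemma bounded_continuous V W (L : {linear V -> W}) (K : R) :
  (forall x, rnorm (L x) <= K * rnorm x) -> continuous L.
Proof.
move=> LK; apply: bounded_linear_continuous; apply/linear_boundedP.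
exists `|K|%:C; split; first by rewrite realE lecR normr_ge0.
move=> M KM x; rewrite -[`|L x|]rnormE (le_trans _ (ler_wpM2r (normr_ge0 x) (ltW KM)))//.
by rewrite -[`|x|]rnormE -rmorphM lecR (le_trans (LK x))// ler_wpM2r ?rnorm_ge0// ler_norm.
Qed.

Lemma fdiff_diff V W (f : V -> W) x (L : V -> W) (K : R) :
  linear L -> (forall h, rnorm (L h) <= K * rnorm h) -> fdiff f x L ->
  differentiable f x /\ 'd f x = L :> (V -> W).
Proof.
move=> lL LK /littleo_rnormP H.
pose lM := GRing.isLinear.Build _ _ _ _ _ lL.
pose L' : {linear V -> W} := HB.pack L lM.
have cL : continuous L by apply: (@bounded_continuous _ _ L' K).
have dL : 'd f x = L :> (V -> W) := @diff_unique _ _ _ f L' x cL H.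
by split=> //; apply/diff_locallyP; rewrite dL.
Qed.

Definition cderiv V (f : R[i]^o -> V) (z : R[i]^o) (d : V) : Prop :=
  fdiff f z (fun h : R[i]^o => h *: d).

Lemma cderiv_diff V (f : R[i]^o -> V) z d :
  cderiv f z d -> differentiable f z /\ derive1 f z = d.
Proof.
move=> H; have [|h|df dE] := fdiff_diff (K := rnorm d) _ _ H.
- by move=> a u v; rewrite scalerDl scalerA.
- by rewrite rnormZ mulrC.
by split=> //; rewrite derive1E' // dE /= scale1r.
Qed.

Lemma diff_cderiv V (f : R[i]^o -> V) z :
  differentiable f z -> cderiv f z (derive1 f z).
Proof.
move=> df; have := differentiable_fdiff df; rewrite /cderiv.
congr fdiff; apply/funext => h.
by rewrite derive1E'// -linearZ /= [_ *: _]mulr1.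
Qed.

Lemma cderiv_unique V (f : R[i]^o -> V) z a b :
  cderiv f z a -> cderiv f z b -> a = b.
Proof. by move=> /cderiv_diff[_ <-] /cderiv_diff[_ <-]. Qed.

Lemma fdiff_line V W (f : V -> W) (x h : V) (s : R[i]^o) (L : V -> W) :
  linear L -> fdiff f (x + s *: h) L ->
  cderiv (fun t : R[i]^o => f (x + t *: h)) s (L h).
Proof.
move=> lL fL e e0; have LZ t : L (t *: h) = t *: L h.
  pose L' : {linear V -> W} := HB.pack L (GRing.isLinear.Build _ _ _ _ _ lL).
  exact: (linearZ_LR L').
have xE t : f (x + (s + t) *: h) = f (x + s *: h + t *: h).
  by rewrite scalerDl addrA.
have [h0|h0] := eqVneq h 0.
  exists 1 => // t _; rewrite xE -LZ h0 !scaler0 !addr0 subrr add0r rnormN.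
  by rewrite -(scaler0 _ 0) -h0 LZ scale0r rnorm0 mulr_ge0 ?rnorm_ge0 ?ltW.
have hp : 0 < rnorm h by rewrite rnorm_gt0.
have [d d0 Hd] := fL (e / rnorm h) (divr_gt0 e0 hp).
exists (d / rnorm h); first exact: divr_gt0.
move=> t; rewrite ler_pdivlMr// -rnormZ => /Hd.
by rewrite LZ xE rnormZ mulrCA divfK ?gt_eqF// mulrC.
Qed.

End RealNorm.

(** * Completeness along geometrically convergent sequences *)

Section GeometricCompleteness.
Variable R : realType.
Implicit Types (V W : normedModType R[i]).

Definition seq_lim V (u : nat -> V) (l : V) : Prop :=
  forall e : R, 0 < e -> exists N, forall n, (N <= n)%N -> rnorm (u n - l) <= e.

(* Completeness for sequences with geometrically decreasing steps: this form
   passes from Y to multi_op X Y k without any completeness instance. *)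
Definition geo_complete V : Prop := forall (u : nat -> V) (K : R),
  (forall n, rnorm (u n.+1 - u n) <= K / 2 ^+ n) -> exists l, seq_lim u l.

Lemma exp2_gt (x : R) : exists n : nat, x < 2 ^+ n.
Proof.
have /archimedean.Num.Theory.archi_boundP := normr_ge0 x.
set n := Num.bound _ => xn; exists n.
rewrite (le_lt_trans (ler_norm x))// (lt_le_trans xn)//.
by rewrite -natrX ler_nat ltnW// ltn_expl.
Qed.

Lemma div_exp2_small (K e : R) : 0 < e ->
  exists N, forall n, (N <= n)%N -> K / 2 ^+ n <= e.
Proof.
move=> e0; have [N HN] := exp2_gt (K / e); exists N => n Nn.
rewrite ler_pdivrMr ?exprn_gt0// mulrC -ler_pdivrMr// (le_trans (ltW HN))//.
by rewrite ler_weXn2l// ler1n.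
Qed.

(** The bound is the exact partial sum of the geometric series; the subtracted term is what lets the
    induction on [k] close. *)
Lemma geo_tail V (u : nat -> V) (K : R) :
  (forall n, rnorm (u n.+1 - u n) <= K / 2 ^+ n) ->
  forall k n, rnorm (u (n + k)%N - u n) <= 2 * K / 2 ^+ n - 2 * K / 2 ^+ (n + k).
Proof.
move=> uK; elim=> [|k IH] n; first by rewrite addn0 !subrr rnorm0.
rewrite addnS; apply: le_trans (rnorm_tri _ (u (n + k)%N) _) _.
apply: le_trans (lerD (uK _) (IH n)) _.
have e0 : 2 ^+ (n + k) != 0 :> R by rewrite expf_neq0.
have -> : 2 * K / 2 ^+ (n + k).+1 = K / 2 ^+ (n + k).
  by rewrite exprS; field.
set a := K / _; have -> : 2 * K / 2 ^+ (n + k) = 2 * a by rewrite /a mulrA.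
lra.
Qed.

Lemma geo_K_ge0 V (u : nat -> V) (K : R) :
  (forall n, rnorm (u n.+1 - u n) <= K / 2 ^+ n) -> 0 <= K.
Proof. by move=> /(_ 0%N); rewrite expr0 divr1; apply: le_trans; exact: rnorm_ge0. Qed.

Lemma geo_lim_bound V (u : nat -> V) (K : R) l :
  (forall n, rnorm (u n.+1 - u n) <= K / 2 ^+ n) -> seq_lim u l ->
  forall n, rnorm (u n - l) <= 2 * K / 2 ^+ n.
Proof.
move=> uK ul n; apply/ler_addgt0Pr => e /ul[N HN].
apply: le_trans (rnorm_tri _ (u (n + N)%N) _) _; apply: lerD; last exact/HN/leq_addl.
rewrite rnorm_distC; apply: le_trans (geo_tail uK _ _) _.
by rewrite gerBl divr_ge0// mulr_ge0// (geo_K_ge0 uK).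
Qed.

Lemma seq_lim_unique V (u : nat -> V) l l' : seq_lim u l -> seq_lim u l' -> l = l'.
Proof.
move=> ul ul'; apply/eqP; rewrite -subr_eq0 -rnorm_eq0 eq_le rnorm_ge0 andbT.
apply/ler_addgt0Pr => e e0; rewrite add0r.
have e2 : 0 < e / 2 by lra.
have [N HN] := ul _ e2; have [M HM] := ul' _ e2.
have := HN _ (leq_maxl N M); rewrite rnorm_distC => h1.
have h2 := HM _ (leq_maxr N M).
by apply: le_trans (rnorm_tri _ (u (maxn N M)) _) _; lra.
Qed.

Lemma seq_lim_shift V (u : nat -> V) l k :
  seq_lim (fun n => u (n + k)%N) l -> seq_lim u l.
Proof.
move=> H e /H[N HN]; exists (N + k)%N => n Nn.
have kn : (k <= n)%N by apply: leq_trans Nn; exact: leq_addl.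
by have := HN (n - k)%N; rewrite subnK//; apply; rewrite leq_subRL// addnC.
Qed.

(** The limit is the supremum of the lower bounds [u n - 2 * K / 2 ^+ n]; by [vw] each of them lies
    below every upper bound [u m + 2 * K / 2 ^+ m]. *)
Lemma geo_complete_real (u : nat -> R) (K : R) :
  (forall n, `|u n.+1 - u n| <= K / 2 ^+ n) ->
  exists l, forall n, `|u n - l| <= 2 * K / 2 ^+ n.
Proof.
move=> uK.
pose u' n : R[i]^o := (u n)%:C.
have uK' n : rnorm (u' n.+1 - u' n) <= K / 2 ^+ n.
  by rewrite /u' -rmorphB rnorm_real.
have K0 := geo_K_ge0 uK'.
have T n k : `|u (n + k)%N - u n| <= 2 * K / 2 ^+ n.
  have := geo_tail uK' k n; rewrite /u' -rmorphB rnorm_real.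
  by move/le_trans; apply; rewrite gerBl divr_ge0// mulr_ge0.
have T' n m : (n <= m)%N -> `|u m - u n| <= 2 * K / 2 ^+ n.
  by move=> nm; have := T n (m - n)%N; rewrite subnKC.
pose v n := u n - 2 * K / 2 ^+ n.
have vw n m : v n <= u m + 2 * K / 2 ^+ m.
  rewrite /v; have [nm|/ltnW mn] := leqP n m.
    have := T' _ _ nm; rewrite ler_distl => /andP[h _].
    by apply: (le_trans h); rewrite lerDl divr_ge0// mulr_ge0.
  have := T' _ _ mn; rewrite ler_distl => /andP[_ h].
  by apply: le_trans h; rewrite gerBl divr_ge0// mulr_ge0.
exists (sup (range v)) => n; rewrite distrC ler_distl; apply/andP; split.
  apply: ub_le_sup; last by exists n.
  by exists (u 0%N + 2 * K / 2 ^+ 0%N) => _ [m _ <-].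
by apply: ge_sup; [exists (v 0%N), 0%N|move=> _ [m _ <-]; exact: vw].
Qed.

Lemma geo_complete_C : geo_complete R[i]^o.
Proof.
move=> u K uK.
have [a Ha] : exists l, forall n, `|complex.Re (u n) - l| <= 2 * K / 2 ^+ n.
  apply: geo_complete_real => n; apply: le_trans (uK n).
  by rewrite -raddfB; exact: Re_le_rnorm.
have [b Hb] : exists l, forall n, `|complex.Im (u n) - l| <= 2 * K / 2 ^+ n.
  apply: geo_complete_real => n; apply: le_trans (uK n).
  by rewrite -raddfB; exact: Im_le_rnorm.
exists (a +i* b) => e e0; have [N HN] := div_exp2_small (4 * K) e0.
exists N => n /HN; apply: le_trans.
apply: le_trans (rnorm_le_ReIm _) _; rewrite !raddfB /=.
apply: le_trans (lerD (Ha n) (Hb n)) _; set t := 2 ^+ n.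
by rewrite -mulrDl -mulrDl -natrD.
Qed.

(** The only place where the completeness of the Banach space itself is used; from here on it is
    carried as the hypothesis [geo_complete]. *)
Lemma geo_complete_banach (X : completeNormedModType R[i]) : geo_complete X.
Proof.
move=> u K uK.
have : cvg (u @ \oo).
  apply/cauchy_cvgP/cauchy_exP => _ /cpos_real[e e0 ->].
  have e2 : 0 < e / 2 by lra.
  have [N HN] := div_exp2_small (2 * K) e2.
  exists (u N); exists N => // n /= Nn.
  rewrite -ball_normE /= normr_lt_rnorm rnorm_distC.
  have := geo_tail uK (n - N) N; rewrite subnKC// => /le_lt_trans; apply.
  have /le_lt_trans -> // : 2 * K / 2 ^+ N - 2 * K / 2 ^+ n <= e / 2; last lra.
  apply: le_trans (HN _ (leqnn N)).
  by rewrite gerBl divr_ge0// mulr_ge0// (geo_K_ge0 uK).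
move=> /cvg_ex[l ul]; exists l => e e0.
have : \forall y \near l, rnorm (y - l) <= e.
  by apply/nbhs_rnormP; exists e => // y /ltW.
by move=> /ul[N _ HN]; exists N => n /HN.
Qed.

Lemma rnorm_op V W (T : bounded_op V W) x : rnorm (T x) <= rnorm T * rnorm x.
Proof. by rewrite -lecR rmorphM /= !rnormE normr_bounded_op op_norm_ub. Qed.

Lemma rnorm_op_le V W (T : bounded_op V W) (M : R) : 0 <= M ->
  (forall x, rnorm x <= 1 -> rnorm (T x) <= M) -> rnorm T <= M.
Proof.
move=> M0 TM; rewrite /rnorm normr_bounded_op /op_norm /=.
apply: ge_sup; first by exists (complex.Re `|T 0|), 0 => //=; rewrite normr0.
by move=> _ [x /= x1 <-]; apply: TM; rewrite -normr_le_rnorm.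
Qed.

Lemma bounded_opP V W (f : V -> W) (K : R) : linear f ->
  (forall x, rnorm (f x) <= K * rnorm x) ->
  exists T : bounded_op V W, T = f :> (V -> W).
Proof.
move=> lf fK.
pose f' : {linear V -> W} := HB.pack f (GRing.isLinear.Build _ _ _ _ _ lf).
have fP : f \in @bounded_linear R V W.
  by apply/asboolP; split=> //; exact: (@bounded_continuous _ _ _ f' K).
by exists (BoundedOp fP).
Qed.

Lemma seq_lim_rnorm_le V (u : nat -> V) l (M : R) : seq_lim u l ->
  (forall n, rnorm (u n) <= M) -> rnorm l <= M.
Proof.
move=> ul uM; apply/ler_addgt0Pr => e /ul[N /(_ N (leqnn N)) HN].
rewrite -[l](subKr (u N)); apply: le_trans (rnormB _ _) _.
exact: lerD.
Qed.

Lemma seq_limD V (u v : nat -> V) l m : seq_lim u l -> seq_lim v m ->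
  seq_lim (fun n => u n + v n) (l + m).
Proof.
move=> ul vm e e0; have e2 : 0 < e / 2 by lra.
have [N HN] := ul _ e2; have [M HM] := vm _ e2.
exists (maxn N M) => n; rewrite geq_max => /andP[/HN h1 /HM h2].
by rewrite opprD addrACA; apply: le_trans (rnormD _ _) _; lra.
Qed.

Lemma seq_limZ V (u : nat -> V) l (a : R[i]^o) : seq_lim u l ->
  seq_lim (fun n => a *: u n) (a *: l).
Proof.
move=> ul e e0; have a1 : 0 < rnorm a + 1 by have := rnorm_ge0 a; lra.
have [N HN] := ul _ (divr_gt0 e0 a1); exists N => n /HN h.
rewrite -scalerBr rnormZ (le_trans (ler_wpM2l (rnorm_ge0 a) h))//.
by rewrite mulrCA ger_pMr// ler_pdivrMr// mul1r lerDl.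
Qed.

Lemma seq_lim_op V W (u : nat -> bounded_op V W) l x : seq_lim u l ->
  seq_lim (fun n => u n x) (l x).
Proof.
move=> ul e e0; have a1 : 0 < rnorm x + 1 by have := rnorm_ge0 x; lra.
have [N HN] := ul _ (divr_gt0 e0 a1); exists N => n /HN h.
apply: le_trans (rnorm_op (u n - l) x) _.
rewrite (le_trans (ler_wpM2r (rnorm_ge0 x) h))//.
by rewrite mulrAC -mulrA ger_pMr// ler_pdivrMr// mul1r lerDl.
Qed.

(** The limit is taken pointwise. The tail bound at [x] is proportional to the norm of [x], hence
    uniform on the unit ball; this gives both the boundedness of the limit and convergence in
    operator norm. *)
Lemma geo_complete_op V W : geo_complete W -> geo_complete (bounded_op V W).
Proof.
move=> cW u K uK.
have ux x n : rnorm (u n.+1 x - u n x) <= K * rnorm x / 2 ^+ n.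
  rewrite mulrAC; apply: le_trans (rnorm_op (u n.+1 - u n) x) _.
  by rewrite ler_wpM2r ?rnorm_ge0.
have /choice[l Hl] : forall x, exists l, seq_lim (fun n => u n x) l.
  by move=> x; exact: cW (ux x).
have lin : linear l.
  move=> a x y; apply: (seq_lim_unique (Hl _)).
  have := seq_limD (seq_limZ a (Hl x)) (Hl y).
  by congr seq_lim; apply/funext => n; rewrite linearP.
have bnd x : rnorm (l x) <= (rnorm (u 0%N) + 2 * K) * rnorm x.
  rewrite -[l x](subKr (u 0%N x)); apply: le_trans (rnormB _ _) _.
  rewrite mulrDl lerD ?rnorm_op//.
  by have := geo_lim_bound (ux x) (Hl x) 0; rewrite expr0 divr1 mulrA.
have [T TE] := bounded_opP lin bnd; exists T => e e0.
have [N HN] := div_exp2_small (2 * K) e0; exists N => n /HN h.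
apply: rnorm_op_le => [|x x1]; first exact: ltW.
rewrite -[(u n - T) x]/(u n x - T x) TE.
apply: le_trans (geo_lim_bound (ux x) (Hl x) n) _.
rewrite mulrA mulrAC (le_trans _ h)// ler_piMr// divr_ge0// mulr_ge0//.
exact: geo_K_ge0 uK.
Qed.

End GeometricCompleteness.

(** * Midpoint sums and Goursat's theorem *)

Section MidpointSums.
Variables (R : realType) (V : normedModType R[i]).
Local Notation C := (R[i]^o).
Implicit Types (f g : C -> V) (a b c p q r z : C) (D : C -> Prop).

Definition mid a b : C := (a + b) / 2.

(* Midpoint sums over dyadic subdivisions replace path integrals: the sum of
   level n.+1 is exactly additive at the midpoint, so no limit is needed. *)
Fixpoint msum n f a b : V :=
  if n is m.+1 then msum m f a (mid a b) + msum m f (mid a b) b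
  else (b - a) *: f (mid a b).

Lemma midC a b : mid a b = mid b a.
Proof. by rewrite /mid addrC. Qed.

Lemma msum_sym n f a b : msum n f b a = - msum n f a b.
Proof.
elim: n a b => [|n IH] a b /=; first by rewrite midC -scaleNr opprB.
by rewrite midC IH [X in _ + X]IH opprD addrC.
Qed.

Lemma msumD n f g a b :
  msum n (fun z => f z + g z) a b = msum n f a b + msum n g a b.
Proof.
elim: n a b => [|n IH] a b /=; first by rewrite scalerDr.
by rewrite !IH addrACA.
Qed.

Lemma msumZ n (k : C) f a b :
  msum n (fun z => k *: f z) a b = k *: msum n f a b.
Proof.
elim: n a b => [|n IH] a b /=; first by rewrite !scalerA mulrC.
by rewrite !IH scalerDr.
Qed.

Lemma msumB n f g a b :
  msum n (fun z => f z - g z) a b = msum n f a b - msum n g a b.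
Proof.
have := msumZ n (-1) g a b; rewrite scaleN1r => <-; rewrite -msumD.
by congr (msum n _ a b); apply/funext => z; rewrite scaleN1r.
Qed.

(** Midpoint convexity is enough to keep every sample point of [msum] inside [D]. *)
Definition midclosed D := forall a b, D a -> D b -> D (mid a b).

Lemma mid_subl a b : mid a b - a = (b - a) / 2.
Proof. by rewrite /mid; field. Qed.

Lemma mid_subr a b : b - mid a b = (b - a) / 2.
Proof. by rewrite /mid; field. Qed.

Lemma rnorm_half (a : C) : rnorm (a / 2 : C) = rnorm a / 2.
Proof.
rewrite rnormM rnormV; congr (_ / _).
have -> : (2 : R[i]) = (2%:R : R)%:C by rewrite rmorph_nat.
by rewrite rnorm_real normr_nat.
Qed.

Lemma msum_bound D n f a b (M : R) : midclosed D -> D a -> D b ->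
  (forall z, D z -> rnorm (f z) <= M) -> rnorm (msum n f a b) <= M * rnorm (b - a).
Proof.
move=> DD + + fM; elim: n a b => [|n IH] a b Da Db /=.
  by rewrite rnormZ mulrC ler_wpM2r ?rnorm_ge0//; apply/fM/DD.
have Dm := DD _ _ Da Db.
apply: le_trans (rnormD _ _) _; apply: le_trans (lerD (IH _ _ Da Dm) (IH _ _ Dm Db)) _.
by rewrite mid_subl mid_subr rnorm_half -mulrDr -splitr.
Qed.

Lemma msum_cst n (v : V) a b : msum n (fun=> v) a b = (b - a) *: v.
Proof.
elim: n a b => [//|n IH] a b /=.
by rewrite !IH -scalerDl; congr (_ *: _); rewrite addrC addrA subrK.
Qed.

Lemma msum_lin n (v : V) c a b :
  msum n (fun z => (z - c) *: v) a b = (((b - c) ^+ 2 - (a - c) ^+ 2) / 2) *: v.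
Proof.
elim: n a b => [|n IH] a b /=.
  by rewrite scalerA; congr (_ *: _); rewrite /mid; field.
by rewrite !IH -scalerDl; congr (_ *: _); rewrite /mid; field.
Qed.

Lemma msum_scale n f (u : C) a b :
  msum n f (u * a) (u * b) = u *: msum n (fun z => f (u * z)) a b.
Proof.
have mE x y : mid (u * x) (u * y) = u * mid x y by rewrite /mid -mulrDr mulrA.
elim: n a b => [|n IH] a b /=; first by rewrite mE -mulrBr scalerA.
by rewrite mE !IH scalerDr.
Qed.

Definition tri n f p q r : V := msum n f p q + msum n f q r + msum n f r p.

(** The inner edges are run through once in each direction and cancel; the outer sides split exactly
    because the level drops by one. *)
Lemma tri_split n f p q r :
  tri n.+1 f p q r =
  tri n f p (mid p q) (mid r p) + tri n f (mid p q) q (mid q r) +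
  tri n f (mid r p) (mid q r) r + tri n f (mid p q) (mid q r) (mid r p).
Proof.
rewrite /tri /=; set a := mid p q; set b := mid q r; set c := mid r p.
rewrite [msum n f b a]msum_sym [msum n f a c]msum_sym [msum n f c b]msum_sym.
set x1 := msum n f p a; set x2 := msum n f a q; set x3 := msum n f q b.
set x4 := msum n f b r; set x5 := msum n f r c; set x6 := msum n f c p.
set y1 := msum n f c a; set y2 := msum n f a b; set y3 := msum n f b c.
rewrite -[LHS]addr0.
have -> : x1 - y1 + x6 + (x2 + x3 - y2) + (- y3 + x4 + x5) + (y2 + y3 + y1) =
  x1 + x2 + (x3 + x4) + (x5 + x6) + ((y1 - y1) + (y2 - y2) + (y3 - y3)).
  rewrite (AC ((3*3)*3*3) ((1*4)*(5*8)*(9*3)*((12*2)*(10*6)*(11*7))))/=.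
  by [].
by rewrite !subrr !addr0.
Qed.

Lemma triB n f g p q r :
  tri n (fun z => f z - g z) p q r = tri n f p q r - tri n g p q r.
Proof. by rewrite /tri !msumB !opprD !addrA (ACl (1*3*5*2*4*6)). Qed.

(** The midpoint rule is exact for affine functions, so nothing remains around a closed triangle. *)
Lemma tri_affine n (v w : V) c p q r :
  tri n (fun z => w + (z - c) *: v) p q r = 0.
Proof.
rewrite /tri !msumD !msum_cst !msum_lin !addrA.
rewrite (ACl ((1*3*5)*(2*4*6)))/= -!scalerDl.
rewrite [X in X *: w](_ : _ = 0) ?scale0r ?add0r; last by ring.
rewrite -[X in X *: v]/((_ + _ + _) * 2^-1).
by rewrite [X in X *: v](_ : _ = 0) ?scale0r//; field.
Qed.

Definition perim p q r : R := rnorm (q - p) + rnorm (r - q) + rnorm (p - r).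

Lemma tri_bound D n f p q r (M : R) : midclosed D -> D p -> D q -> D r ->
  (forall z, D z -> rnorm (f z) <= M) -> rnorm (tri n f p q r) <= M * perim p q r.
Proof.
move=> DD Dp Dq Dr fM; rewrite /tri /perim !mulrDr.
apply: le_trans (rnormD _ _) _; apply: lerD; last exact: msum_bound fM.
by apply: le_trans (rnormD _ _) _; apply: lerD; exact: msum_bound fM.
Qed.

Lemma midclosed_disc c (k : R) : midclosed (fun z => rnorm (z - c) <= k).
Proof.
move=> a b ha hb; have -> : mid a b - c = ((a - c) + (b - c)) / 2.
  by rewrite /mid; field.
rewrite rnorm_half; have := rnormD (a - c) (b - c); lra.
Qed.

Lemma Re_mid a b : complex.Re (mid a b) = (complex.Re a + complex.Re b) / 2.
Proof.
rewrite /mid; have -> : (2^-1 : R[i]) = (2^-1 : R)%:C by rewrite fmorphV rmorph_nat.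
by case: a b => [a1 a2] [b1 b2] /=; rewrite mulr0 subr0.
Qed.

Lemma midclosed_halfplane (k : R) : midclosed (fun z => k <= complex.Re z).
Proof. by move=> a b ha hb; rewrite Re_mid; lra. Qed.

Lemma midclosedI D D' : midclosed D -> midclosed D' ->
  midclosed (fun z => D z /\ D' z).
Proof. by move=> h h' a b [? ?] [? ?]; split; [exact: h|exact: h']. Qed.

Definition seqclosed D :=
  forall (u : nat -> C) l, (forall n, D (u n)) -> seq_lim u l -> D l.

(** Stands for a contour integral of norm at most [e], without presupposing that the sums
    converge. *)
Definition tri_small f p q r (e : R) :=
  exists N, forall n, (N <= n)%N -> rnorm (tri n f p q r) <= e.

Lemma tri_small_split f p q r (e1 e2 e3 e4 : R) :
  tri_small f p (mid p q) (mid r p) e1 ->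
  tri_small f (mid p q) q (mid q r) e2 ->
  tri_small f (mid r p) (mid q r) r e3 ->
  tri_small f (mid p q) (mid q r) (mid r p) e4 ->
  tri_small f p q r (e1 + e2 + e3 + e4).
Proof.
move=> [N1 H1] [N2 H2] [N3 H3] [N4 H4].
exists (maxn (maxn N1 N2) (maxn N3 N4)).+1 => -[//|n].
rewrite ltnS !geq_max => /andP[/andP[/H1 h1 /H2 h2] /andP[/H3 h3 /H4 h4]].
rewrite tri_split; do 3 (apply: le_trans (rnormD _ _) _; apply: lerD => //).
Qed.

Lemma perim_sub p q r :
  [/\ perim p (mid p q) (mid r p) = perim p q r / 2,
      perim (mid p q) q (mid q r) = perim p q r / 2,
      perim (mid r p) (mid q r) r = perim p q r / 2 &
      perim (mid p q) (mid q r) (mid r p) = perim p q r / 2].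
Proof.
have h1 a b c : mid b c - mid a b = (c - a) / 2 by rewrite /mid; field.
rewrite /perim; split; rewrite ?mid_subl ?mid_subr ?h1 -?[mid r p - mid p q]opprB
  -?[mid p q - mid q r]opprB -?[mid q r - mid r p]opprB ?h1 ?rnormN ?rnorm_half.
all: have := rnorm_distC p q; have := rnorm_distC q r; have := rnorm_distC r p; lra.
Qed.

Lemma perim_ge p q r : [/\ rnorm (q - p) <= perim p q r,
  rnorm (r - p) <= perim p q r & rnorm (r - q) <= perim p q r].
Proof.
rewrite /perim [rnorm (r - p)]rnorm_distC.
have := rnorm_ge0 (q - p); have := rnorm_ge0 (r - q); have := rnorm_ge0 (p - r).
by move=> *; split; lra.
Qed.

Lemma perim_ge0 p q r : 0 <= perim p q r.
Proof. by rewrite !addr_ge0// rnorm_ge0. Qed.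

(** Bisection: if smallness fails for a triangle with tolerance [e], it fails for one of its
    quarters with [e / 4]. The nested triangles shrink to a point of [D], where the affine part of
    [f] sums to 0 and the remainder is too small for the failure to persist. *)
Lemma goursat D f : midclosed D -> seqclosed D ->
  (forall z, D z -> exists d, cderiv f z d) ->
  forall p q r, D p -> D q -> D r -> forall e : R, 0 < e -> tri_small f p q r e.
Proof.
move=> DD Dseq Df p0 q0 r0 Dp0 Dq0 Dr0 e e0; apply: contrapT => bad0.
pose P := perim p0 q0 r0; have P0 : 0 <= P by exact: perim_ge0.
pose Inv (x : nat * (C * C * C)) := let: (k, (p, q, r)) := x in
  [/\ D p, D q, D r, perim p q r <= P / 2 ^+ k & ~ tri_small f p q r (e / 4 ^+ k)].
have step (x : nat * (C * C * C)) : exists t' : C * C * C, Inv x ->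
    Inv (x.1.+1, t') /\ rnorm (t'.1.1 - x.2.1.1) <= P / 2 ^+ x.1.
  case: x => k [[p q] r]; have [|nI] := pselect (Inv (k, (p, q, r))); last first.
    by exists (p, q, r).
  case=> Dp Dq Dr pe bad; have [e1 e2 e3 e4] := perim_sub p q r.
  have [g1 g2 _] := perim_ge p q r; have g3 := perim_ge0 p q r.
  have Dpq := DD _ _ Dp Dq; have Dqr := DD _ _ Dq Dr; have Drp := DD _ _ Dr Dp.
  have pe2 : perim p q r / 2 <= P / 2 ^+ k.+1.
    by rewrite exprSr invfM mulrA ler_pM2r// invr_gt0.
  have pq : rnorm (mid p q - p) <= P / 2 ^+ k.
    by rewrite mid_subl rnorm_half; lra.
  have rp : rnorm (mid r p - p) <= P / 2 ^+ k.
    by rewrite midC mid_subl rnorm_half; lra.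
  have [s1|] := pselect (tri_small f p (mid p q) (mid r p) (e / 4 ^+ k.+1)); last first.
    by move=> b; exists (p, mid p q, mid r p) => _; split; [split=> //; rewrite e1|];
      rewrite /= ?subrr ?rnorm0 ?divr_ge0.
  have [s2|] := pselect (tri_small f (mid p q) q (mid q r) (e / 4 ^+ k.+1)); last first.
    by move=> b; exists (mid p q, q, mid q r) => _; split; [split=> //; rewrite e2|].
  have [s3|] := pselect (tri_small f (mid r p) (mid q r) r (e / 4 ^+ k.+1)); last first.
    by move=> b; exists (mid r p, mid q r, r) => _; split; [split=> //; rewrite e3|].
  have [s4|] := pselect (tri_small f (mid p q) (mid q r) (mid r p) (e / 4 ^+ k.+1));
      last first.
    by move=> b; exists (mid p q, mid q r, mid r p) => _; split; [split=> //; rewrite e4|].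
  have := tri_small_split s1 s2 s3 s4.
  suff -> : e / 4 ^+ k.+1 + e / 4 ^+ k.+1 + e / 4 ^+ k.+1 + e / 4 ^+ k.+1 = e / 4 ^+ k by [].
  have k0 : 4 ^+ k != 0 :> R by rewrite expf_neq0.
  by rewrite exprS; field.
have /choice[F HF] := step.
pose fix t k := if k is j.+1 then F (j, t j) else (p0, q0, r0).
have It k : Inv (k, t k).
  elim: k => [|k IH]; first by rewrite /= !expr0 !divr1; split.
  by have [] := HF _ IH.
have ut k : rnorm ((t k.+1).1.1 - (t k).1.1) <= P / 2 ^+ k.
  by have [] := HF _ (It k).
have [l ul] := geo_complete_C (u := fun k => (t k).1.1) ut.
have tl := geo_lim_bound ut ul.
have Dl : D l.
  apply: (Dseq _ l _ ul) => k.
  by have := It k; rewrite /Inv; case: (t k) => [[? ?] ?] [].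
have [d Hd] := Df _ Dl.
(* The k-th triangle has perimeter at most P / 2^k and lies within 3 P / 2^k of [l], so an error c
   |z - l| sums to at most 3 c P^2 / 4^k. The added 1 keeps the denominator positive when P = 0. *)
have E0 : 0 < 3 * P ^+ 2 + 1 by have := sqr_ge0 P; lra.
have [dl dl0 {}Hd] := Hd _ (divr_gt0 e0 E0).
have [k /(_ k (leqnn k)) Hk] := div_exp2_small (3 * P) dl0.
have := It k; have := tl k; rewrite /Inv; case: (t k) => [[p q] r] /= pl [_ _ _ pe]; apply.
exists 0%N => n _.
have [g1 g2 _] := perim_ge p q r.
pose rho := 3 * P / 2 ^+ k.
have rhoE : rho = 2 * P / 2 ^+ k + P / 2 ^+ k.
  by rewrite /rho -mulrDl; congr (_ / _); lra.
have near x : rnorm (x - p) <= P / 2 ^+ k -> rnorm (x - l) <= rho.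
  by move=> xp; apply: le_trans (rnorm_tri x p l) _; rewrite rhoE; lra.
have Pk : 0 <= P / 2 ^+ k by rewrite divr_ge0.
have ap : tri n f p q r = tri n (fun z => f z - (f l + (z - l) *: d)) p q r.
  by rewrite triB tri_affine subr0.
rewrite ap; apply: le_trans (tri_bound (M := e / (3 * P ^+ 2 + 1) * rho)
  (D := fun z => rnorm (z - l) <= rho) _ (@midclosed_disc _ _) _ _ _ _) _.
- by apply: near; rewrite subrr rnorm0.
- by apply: near; lra.
- by apply: near; lra.
- move=> z zl; have := Hd (z - l) (le_trans zl Hk).
  rewrite [l + _]addrC subrK opprD addrA => /le_trans; apply.
  by rewrite ler_wpM2l// divr_ge0// ltW.
have e1 : 0 <= e / (3 * P ^+ 2 + 1) by rewrite divr_ge0// ltW.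
apply: (@le_trans _ _ (e / (3 * P ^+ 2 + 1) * rho * (P / 2 ^+ k))).
  by rewrite ler_wpM2l// mulr_ge0// /rho divr_ge0// mulr_ge0.
have k0 : 2 ^+ k != 0 :> R by rewrite expf_neq0.
have -> : e / (3 * P ^+ 2 + 1) * rho * (P / 2 ^+ k) =
    (3 * P ^+ 2) / (3 * P ^+ 2 + 1) * (e / 4 ^+ k).
  have -> : 4 ^+ k = 2 ^+ k * 2 ^+ k :> R.
    by rewrite -exprMn; congr (_ ^+ _); ring.
  by rewrite /rho; field; rewrite k0 gt_eqF.
rewrite ler_piMl//; first by rewrite divr_ge0 ?ltW// exprn_ge0.
by rewrite ler_pdivrMr// mul1r lerDl.
Qed.

(** Goursat with a bounded singularity at the vertex [a]. Three of the four quarters lie in the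
    convex region [D'], which excludes [a], and are handled by [goursat]; the remaining corner has
    half the perimeter, so k repetitions leave at most M perim / 2^k. The constant [c] provides the
    half-plane that separates the quarters from [a]. *)
Lemma tri_small_vertex D f (a : C) (M : R) : midclosed D -> seqclosed D -> D a ->
  (forall z, D z -> rnorm (f z) <= M) ->
  (forall z, D z -> z != a -> exists d, cderiv f z d) ->
  forall (p q : C) (c : R), 0 < c -> D p -> D q ->
  complex.Re a + c <= complex.Re p -> complex.Re a + c <= complex.Re q ->
  forall e : R, 0 < e -> tri_small f a p q e.
Proof.
move=> DD Ds Da fM Df.
have step k : forall (p q : C) (c : R), 0 < c -> D p -> D q ->
    complex.Re a + c <= complex.Re p -> complex.Re a + c <= complex.Re q ->
    forall e : R, 0 < e -> tri_small f a p q (e + M * perim a p q / 2 ^+ k).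
  elim: k => [|k IH] p q c c0 Dp Dq pc qc e e0.
    exists 0%N => n _; rewrite expr0 divr1.
    by apply: le_trans (tri_bound n DD Da Dp Dq fM) _; rewrite lerDr ltW.
  have Dap := DD _ _ Da Dp; have Dpq := DD _ _ Dp Dq; have Dqa := DD _ _ Dq Da.
  pose D' z := D z /\ complex.Re a + c / 2 <= complex.Re z.
  have DD' : midclosed D' by apply: midclosedI => //; exact: midclosed_halfplane.
  have Ds' : seqclosed D'.
    move=> u l uD ul; split; first by apply: Ds ul => n; have [] := uD n.
    apply/ler_addgt0Pr => e' /ul[N /(_ N (leqnn N)) HN].
    have [_ h] := uD N; have := Re_le_rnorm (u N - l); rewrite raddfB /= => h2.
    by have := le_trans (ler_norm _) h2; lra.
  have D'f z : D' z -> exists d, cderiv f z d.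
    move=> [Dz zc]; apply: Df => //; apply/eqP => za; move: zc; rewrite za; lra.
  have e4 : 0 < e / 4 by lra.
  have [e1 _ _ _] := perim_sub a p q.
  have R1 := Re_mid a p; have R2 := Re_mid p q; have R3 := Re_mid q a.
  have c2 : 0 < c / 2 by lra.
  have s1 := IH (mid a p) (mid q a) (c / 2) c2 Dap Dqa _ _ _ e4.
  have D1 : D' (mid a p) by split=> //; rewrite R1; lra.
  have D2 : D' (mid p q) by split=> //; rewrite R2; lra.
  have D3 : D' (mid q a) by split=> //; rewrite R3; lra.
  have D4 : D' p by split=> //; lra.
  have D5 : D' q by split=> //; lra.
  have := tri_small_split (s1 D1.2 D3.2)
    (goursat DD' Ds' D'f D1 D4 D2 e4) (goursat DD' Ds' D'f D3 D2 D5 e4)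
    (goursat DD' Ds' D'f D1 D2 D3 e4).
  rewrite e1; congr tri_small; rewrite exprS.
  have k0 : 2 ^+ k != 0 :> R by rewrite expf_neq0.
  by field.
move=> p q c c0 Dp Dq pc qc e e0.
have e2 : 0 < e / 2 by lra.
have [k /(_ k (leqnn k)) Hk] := div_exp2_small (M * perim a p q) e2.
have [N HN] := step k p q c c0 Dp Dq pc qc _ e2.
by exists N => n /HN h; apply: le_trans h _; lra.
Qed.

End MidpointSums.

(** * Product, quotient and scaling rules for derivatives *)

Section ProductRule.
Variable R : realType.
Implicit Types (V W : normedModType R[i]).

Lemma fdiff_lip V W (f : V -> W) x (L : V -> W) (K : R) :
  (forall h, rnorm (L h) <= K * rnorm h) -> fdiff f x L ->
  exists2 d : R, 0 < d & forall h, rnorm h <= d ->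
    rnorm (f (x + h) - f x) <= (K + 1) * rnorm h.
Proof.
move=> LK /(_ 1 ltr01)[d d0 Hd]; exists d => // h /Hd; have := LK h.
have := rnormD (f (x + h) - f x - L h) (L h); rewrite subrK mulrDl; lra.
Qed.

Lemma fdiffZ V W (k : V -> R[i]^o) (f : V -> W) x (K : V -> R[i]^o) (L : V -> W)
    (CK CL : R) :
  (forall h, rnorm (K h) <= CK * rnorm h) -> (forall h, rnorm (L h) <= CL * rnorm h) ->
  fdiff k x K -> fdiff f x L ->
  fdiff (fun z => k z *: f z) x (fun h => K h *: f x + k x *: L h).
Proof.
move=> KC LC dk df e e0.
have [d0 d0p H0] := fdiff_lip LC df.
set A := rnorm (f x); set B := rnorm (k x).
have A0 : 0 <= A by exact: rnorm_ge0.
have B0 : 0 <= B by exact: rnorm_ge0.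
pose c := `|CL| + 1; have c0 : 0 < c by have := normr_ge0 CL; rewrite /c; lra.
pose ck := `|CK| * c + 1.
have ck0 : 0 < ck by rewrite ltr_wpDl// mulr_ge0// ltW.
have A1 : 0 < 3 * (A + 1) by lra.
have B1 : 0 < 3 * (B + 1) by lra.
have [d1 d1p H1] := dk _ (divr_gt0 e0 A1).
have [d2 d2p H2] := df _ (divr_gt0 e0 B1).
pose d := Num.min (Num.min d0 d1) (Num.min (Num.min d2 c^-1) (e / (3 * ck))).
exists d.
  by rewrite !lt_min d0p d1p d2p invr_gt0 c0 divr_gt0// mulr_gt0.
move=> h; rewrite !le_min => /andP[/andP[/H0 h0 /H1 h1] /andP[/andP[/H2 h2 h3] h4]].
have hp := rnorm_ge0 h.
have h0' : rnorm (f (x + h) - f x) <= c * rnorm h.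
  by apply: le_trans h0 _; rewrite ler_wpM2r// lerD2r ler_norm.
have fb : rnorm (f (x + h)) <= A + 1.
  have := rnormD (f (x + h) - f x) (f x); rewrite subrK -/A.
  have : c * rnorm h <= 1 by rewrite mulrC -ler_pdivlMr// div1r.
  lra.
have -> : k (x + h) *: f (x + h) - k x *: f x - (K h *: f x + k x *: L h) =
  (k (x + h) - k x - K h) *: f (x + h) + K h *: (f (x + h) - f x) +
  k x *: (f (x + h) - f x - L h).
  rewrite !scalerBl !scalerBr !opprD; set a := k (x + h) *: _; set b := k x *: f x.
  set p := K h *: f x; set q := k x *: L h; set r := k x *: _; set s := K h *: f _.
  clearbody a b p q r s; rewrite [a - r - s + _]addrA subrK [a - r - p]addrAC -[r - b - q]addrA.
  by rewrite [_ + (r + _)]addrA subrK [RHS]addrA [a - p - b]addrAC -[RHS]addrA.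
apply: le_trans (rnormD _ _) _; have -> : e * rnorm h = (e / 3 * rnorm h + e / 3 * rnorm h) + e / 3 * rnorm h by lra.
apply: lerD; first (apply: le_trans (rnormD _ _) _; apply: lerD).
- rewrite rnormZ; apply: le_trans (ler_pM _ _ h1 fb) _; rewrite ?rnorm_ge0//.
  by rewrite le_eqVlt; apply/orP; left; apply/eqP; field; rewrite gt_eqF//; lra.
- rewrite rnormZ.
  have kk : rnorm (K h) <= `|CK| * rnorm h.
    by apply: le_trans (KC h) _; rewrite ler_wpM2r// ler_norm.
  apply: le_trans (ler_pM _ _ kk h0') _; rewrite ?rnorm_ge0//.
  have : rnorm h * ck <= e / 3.
    by move: h4; rewrite invfM mulrA ler_pdivlMr.
  have : `|CK| * c * rnorm h <= ck * rnorm h by rewrite ler_wpM2r// /ck lerDl.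
  move=> u1 u2; have -> : `|CK| * rnorm h * (c * rnorm h) = `|CK| * c * rnorm h * rnorm h by ring.
  by rewrite ler_wpM2r//; lra.
rewrite rnormZ -/B; apply: le_trans (ler_wpM2l B0 h2) _.
have -> : B * (e / (3 * (B + 1)) * rnorm h) = B / (B + 1) * (e / 3 * rnorm h).
  by field; rewrite gt_eqF//; lra.
rewrite ler_piMl//; first by rewrite mulr_ge0// divr_ge0// ltW.
by rewrite ler_pdivrMr; lra.
Qed.

Lemma cderivZ V (k : R[i]^o -> R[i]^o) (f : R[i]^o -> V) z k' d :
  cderiv k z k' -> cderiv f z d ->
  cderiv (fun z => k z *: f z) z (k' *: f z + k z *: d).
Proof.
move=> dk df; have := fdiffZ (CK := rnorm k') (CL := rnorm d) _ _ dk df.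
have E W (w : W) : forall h : R[i]^o, rnorm (h *: w) <= rnorm w * rnorm h.
  by move=> h; rewrite rnormZ mulrC.
move=> /(_ (E _ _) (E _ _)); rewrite /cderiv; congr fdiff; apply/funext => h.
by rewrite scalerDr !scalerA [h * k z]mulrC.
Qed.

Lemma cderivB V (f g : R[i]^o -> V) z d d' :
  cderiv f z d -> cderiv g z d' -> cderiv (fun z => f z - g z) z (d - d').
Proof.
move=> df dg e e0; have e2 : 0 < e / 2 by lra.
have [d1 d1p H1] := df _ e2; have [d2 d2p H2] := dg _ e2.
exists (Num.min d1 d2); first by rewrite lt_min d1p.
move=> h; rewrite le_min => /andP[/H1 h1 /H2 h2].
have -> : f (z + h) - g (z + h) - (f z - g z) - h *: (d - d') =
  (f (z + h) - f z - h *: d) - (g (z + h) - g z - h *: d').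
  by rewrite scalerBr !opprD !opprK !addrA (ACl (1*3*5*2*4*6)).
by apply: le_trans (rnormB _ _) _; lra.
Qed.

Lemma cderiv_cst V (v : V) z : cderiv (fun=> v) z 0.
Proof.
move=> e e0; exists 1 => // h _.
by rewrite scaler0 subr0 subrr rnorm0 mulr_ge0 ?rnorm_ge0 ?ltW.
Qed.

Lemma cderiv_id z : cderiv (fun z : R[i]^o => z) z 1.
Proof.
move=> e e0; exists 1 => // h _.
rewrite [z + h]addrC addrK [h *: _]mulr1 subrr rnorm0 mulr_ge0 ?rnorm_ge0 ?ltW//.
Qed.

Lemma cderivV (k : R[i]^o -> R[i]^o) z k' : cderiv k z k' -> k z != 0 ->
  exists d, cderiv (fun z => (k z)^-1 : R[i]^o) z d.
Proof.
move=> /cderiv_diff[dk _] k0; eexists; apply: diff_cderiv.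
exact: differentiableV.
Qed.

Lemma cderiv_scale V (f : R[i]^o -> V) (u s : R[i]^o) d :
  cderiv f (u * s) d -> cderiv (fun z => f (u * z)) s (u *: d).
Proof.
move=> df; have := @fdiff_line R R[i]^o V f 0 u s (fun h : R[i]^o => h *: d).
rewrite add0r [s *: u]mulrC => /(_ _ df)/wrap[a x y|].
  by rewrite scalerDl scalerA.
by congr cderiv; apply/funext => t; rewrite add0r [t *: u]mulrC.
Qed.

Lemma cderiv_bounded V (f : R[i]^o -> V) z d : cderiv f z d ->
  exists K : R, exists2 r : R, 0 < r & forall h, rnorm h <= r ->
    rnorm (f (z + h) - f z) <= K * rnorm h.
Proof.
move=> df; exists (rnorm d + 1); apply: (fdiff_lip (K := rnorm d) _ df) => h.
by rewrite rnormZ mulrC.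
Qed.

End ProductRule.

(** * Cauchy's theorem on a square and the Lipschitz estimate *)

Section SquareContour.
Variable R : realType.
Local Notation C := (R[i]^o).
Implicit Types (V : normedModType R[i]).

Let I : C := 'i%C.
Let v : C := 1 -i* 1.
Let w : C := 1 +i* 1.

Let Iv : I * v = w.
Proof. by rewrite /I /v /w; apply/eqP; rewrite eq_complex /=; apply/andP; split; apply/eqP; ring. Qed.

Let I4 : I ^+ 4 = 1.
Proof. by rewrite -[4%N]/(2 * 2)%N exprM sqr_i sqrrN expr1n. Qed.

Let nI : rnorm I = 1.
Proof. exact: rnorm_i. Qed.

Let nIX j : rnorm (I ^+ j : C) = 1.
Proof. by rewrite rnormX nI expr1n. Qed.

Let nv : rnorm v <= 3 / 2.
Proof.
have := rnorm_sq v; have := rnorm_ge0 v; rewrite /v /= sqrrN !expr1n => h1 h2.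
by rewrite leNgt; apply/negP => h3; nra.
Qed.

Let nw : rnorm w <= 3 / 2.
Proof. by rewrite -Iv rnormM nI mul1r; exact: nv. Qed.

(** The boundary of the square with corners 1 - i, 1 + i, -1 + i, -1 - i, as the four rotated copies
    of its right side from [v] to [w]. Every estimate is thereby reduced to the right side. The
    square lies in the disc [D] of radius 3/2 because the square root of 2 is at most 3/2. *)
Definition square_sum V n (f : C -> V) : V :=
  \sum_(j < 4) msum n f (I ^+ j * v) (I ^+ j * w).

Lemma square_sumE V n (f : C -> V) :
  square_sum n f = \sum_(j < 4) I ^+ j *: msum n (fun z => f (I ^+ j * z)) v w.
Proof. by apply: eq_bigr => j _; exact: msum_scale. Qed.

Lemma square_sumB V n (f g : C -> V) :
  square_sum n (fun z => f z - g z) = square_sum n f - square_sum n g.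
Proof. by rewrite -sumrB; apply: eq_bigr => j _; exact: msumB. Qed.

Let D (z : C) := rnorm z <= 3 / 2.

Let midD : midclosed D.
Proof.
move=> a b Da Db; have := @midclosed_disc R 0 (3 / 2) a b; rewrite !subr0.
exact.
Qed.

Let seqD : seqclosed D.
Proof.
move=> u l uD ul; apply/ler_addgt0Pr => e /ul[N /(_ N (leqnn N)) HN].
by have := rnormB (u N) (u N - l); rewrite subKr; have := uD N; rewrite /D; lra.
Qed.

Let DI j z : D z -> D (I ^+ j * z).
Proof. by rewrite /D rnormM nIX mul1r. Qed.

(** Four sides of length 2. A bound on |z| >= 1 is enough because the right side lies in Re z >= 1;
    there the kernels 1 / (z - a) are under control. *)
Lemma square_sum_bound V n (f : C -> V) (M : R) :
  (forall z, 1 <= rnorm z -> D z -> rnorm (f z) <= M) ->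
  rnorm (square_sum n f) <= 8 * M.
Proof.
move=> fM; rewrite square_sumE.
have H (j : 'I_4) : rnorm (I ^+ j *: msum n (fun z => f (I ^+ j * z)) v w) <= 2 * M.
  rewrite rnormZ nIX mul1r.
  apply: le_trans (msum_bound (M := M) (D := fun z => D z /\ 1 <= complex.Re z) n _ _ _ _) _.
  - by apply: midclosedI => //; exact: midclosed_halfplane.
  - by split; [exact: nv|rewrite /v].
  - by split; [exact: nw|rewrite /w].
  - move=> z [Dz z1]; apply: fM; last exact: DI.
    rewrite rnormM nIX mul1r; apply: le_trans z1 _.
    by apply: le_trans (ler_norm _) _; exact: Re_le_rnorm.
  have -> : w - v = (2 : R)%:C * I.
    by apply/eqP; rewrite eq_complex /=; apply/andP; split; apply/eqP; ring.
  by rewrite rnormM nI mulr1 rnorm_real normr_nat mulrC.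
have -> : 8 * M = \sum_(j < 4) 2 * M by rewrite !big_ord_recr big_ord0 /=; lra.
elim/big_ind2 : _ => // [|a b a' b' h h']; first by rewrite rnorm0.
by apply: le_trans (rnormD _ _) _; exact: lerD.
Qed.

(** The square is cut into four triangles with common vertex [a], where [q] is only bounded. The
    segments from [a] to the corners cancel, as P 4 = P 0, and each triangle, rotated to the right
    side, falls under [tri_small_vertex] with separation 1/2. *)
Lemma square_sum_small V (q : C -> V) (a : C) (M : R) : rnorm a <= 1 / 2 ->
  (forall z, D z -> rnorm (q z) <= M) ->
  (forall z, D z -> z != a -> exists d, cderiv q z d) ->
  forall e : R, 0 < e -> exists N, forall n, (N <= n)%N -> rnorm (square_sum n q) <= e.
Proof.
move=> a2 qM Dq e e0; have e4 : 0 < e / 4 by lra.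
have In0 j : I ^+ j != 0 by rewrite expf_neq0// -rnorm_gt0 nI.
pose a' j : C := (I ^+ j)^-1 * a.
have na' j : rnorm (a' j) <= 1 / 2 by rewrite rnormM rnormV nIX invr1 [_ * rnorm a]mul1r.
have Da' j : D (a' j) by rewrite /D; apply: le_trans (na' j) _; lra.
have Ia' j : I ^+ j * a' j = a by rewrite /a' mulrA mulfV// mul1r.
have small j : tri_small (fun z => q (I ^+ j * z)) (a' j) v w (e / 4).
  have Ra : complex.Re (a' j) + 1 / 2 <= 1.
    by have := le_trans (ler_norm _) (le_trans (Re_le_rnorm (a' j)) (na' j)); lra.
  apply: (@tri_small_vertex _ _ D _ _ M midD seqD (Da' j) _ _ v w (1 / 2)) => //; try lra.
  - by move=> z Dz; apply/qM/DI.
  - move=> z Dz za; have [|d Hd] := Dq (I ^+ j * z) (DI j Dz).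
      by apply: contra za => /eqP za; rewrite /a' -za mulrA mulVf// mul1r.
    by eexists; apply: cderiv_scale Hd.
have [N HN] := choice small.
exists (\max_(j < 4) N j)%N => n Nn.
have -> : square_sum n q = \sum_(j < 4) I ^+ j *: tri n (fun z => q (I ^+ j * z)) (a' j) v w.
  pose P (j : nat) := msum n q a (I ^+ j * v).
  have E j : I ^+ j *: tri n (fun z => q (I ^+ j * z)) (a' j) v w =
      P j + msum n q (I ^+ j * v) (I ^+ j * w) - P j.+1.
    rewrite /tri !scalerDr -!msum_scale Ia' /P exprSr -[I ^+ j * I * v]mulrA Iv.
    by rewrite [msum n q _ a]msum_sym.
  rewrite /square_sum !big_ord_recr !big_ord0 /= !add0r !E.
  have P4 : P 4%N = P 0%N by rewrite /P I4 expr0.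
  rewrite P4; move: (P 0%N) (P 1%N) (P 2%N) (P 3%N) => p0 p1 p2 p3.
  move: (msum n q (I ^+ 0 * v) _) (msum n q (I ^+ 1 * v) _) => x0 x1.
  move: (msum n q (I ^+ 2 * v) _) (msum n q (I ^+ 3 * v) _) => x2 x3.
  by rewrite !addrA !subrK -!addrA [RHS]addrC !addrA subrK.
apply: le_trans (_ : \sum_(j < 4) e / 4 <= e); last first.
  by rewrite !big_ord_recr big_ord0 /=; lra.
have H (j : 'I_4) : rnorm (I ^+ j *: tri n (fun z => q (I ^+ j * z)) (a' j) v w) <= e / 4.
  rewrite rnormZ nIX mul1r; apply: HN; apply: leq_trans Nn.
  exact: (@leq_bigmax _ (fun j : 'I_4 => N j) j).
elim/big_ind2 : _ => // [|x b x' b' h h']; first by rewrite rnorm0.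
by apply: le_trans (rnormD _ _) _; exact: lerD.
Qed.

Let inv (z : C) : C := z^-1.

(* A lower bound by 4 is all that is used of the winding number 2 pi i. *)
Lemma square_sum_inv n : 4 <= rnorm (square_sum n inv).
Proof.
have -> : square_sum n inv = 4 * msum n inv v w.
  rewrite square_sumE (eq_bigr (fun=> msum n inv v w)); last first.
    move=> j _; rewrite -msumZ; congr (msum n _ v w); apply/funext => z.
    rewrite /inv -[_ *: _]/(_ * _) invfM mulrA mulfV ?mul1r// expf_neq0// -rnorm_gt0 nI//.
  by rewrite sumr_const card_ord mulr_natl.
(* At 1 + i y the imaginary part of (b - a) / z is (Im b - Im a) / (1 + y^2), at least half the
   length since |y| <= 1. The right side of length 2 thus gives at least 1, and the four sides
   contribute equally. *)
have aux m (a b : C) : complex.Re a = 1 -> complex.Re b = 1 ->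
    `|complex.Im a| <= 1 -> `|complex.Im b| <= 1 -> complex.Im a <= complex.Im b ->
    (complex.Im b - complex.Im a) / 2 <= complex.Im (msum m inv a b).
  have Im_mid (x y : C) : complex.Im (mid x y) = (complex.Im x + complex.Im y) / 2.
    rewrite /mid; have -> : (2^-1 : R[i]) = (2^-1 : R)%:C by rewrite fmorphV rmorph_nat.
    by case: x y => [a1 a2] [b1 b2] /=; rewrite mulr0 add0r.
  elim: m a b => [|m IH] a b a1 b1 ia ib ab /=.
    rewrite /inv -[_ *: _]/(_ * _).
    have := Re_mid a b; have := Im_mid a b.
    case: (mid a b) => x y /= yE xE; rewrite a1 b1 in xE.
    have {}xE : x = 1 by lra.
    case: a b a1 b1 ia ib ab yE => [a1 a2] [b1 b2] /= -> ->.
    rewrite !ler_norml xE => ia ib ab yE.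
    rewrite subrr mul0r add0r mul1r expr1n.
    have y1 : y ^+ 2 <= 1 by nra.
    have y0 : 0 <= y ^+ 2 by exact: sqr_ge0.
    rewrite ler_wpM2l ?subr_ge0// lef_pV2 ?posrE; lra.
  have Rm : complex.Re (mid a b) = 1 by rewrite Re_mid a1 b1; lra.
  have Imm := Im_mid a b.
  rewrite raddfD /=.
  have h1 := IH a (mid a b) a1 Rm ia; have h2 := IH (mid a b) b Rm b1.
  move: ia ib h1 h2; rewrite Imm !ler_norml => /andP[ia1 ia2] /andP[ib1 ib2].
  have hm : -1 <= (complex.Im a + complex.Im b) / 2 <= 1 by apply/andP; split; lra.
  have ca : complex.Im a <= (complex.Im a + complex.Im b) / 2 by lra.
  have cb : (complex.Im a + complex.Im b) / 2 <= complex.Im b by lra.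
  by move=> /(_ hm ca) h1 /(_ hm); rewrite ib1 ib2 => /(_ isT cb) h2; lra.
have H := aux n v w erefl erefl.
have {}H : (1 - - 1) / 2 <= complex.Im (msum n inv v w).
  by apply: H; rewrite /v /w /= ?normrN ?normr1//; lra.
have {}H : 1 <= complex.Im (msum n inv v w) by have := H; lra.
rewrite rnormM; have -> : rnorm (4 : C) = 4.
  have -> : (4 : R[i]) = (4%:R : R)%:C by rewrite rmorph_nat.
  by rewrite rnorm_real normr_nat.
by have := le_trans (ler_norm _) (Im_le_rnorm (msum n inv v w)); lra.
Qed.

Lemma msum_vec V n (k : C -> C) (x : V) a b :
  msum n (fun z => k z *: x) a b = msum n k a b *: x.
Proof.
elim: n a b => [|n IH] a b /=; first by rewrite scalerA.
by rewrite !IH scalerDl.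
Qed.

Lemma square_sum_vec V n (k : C -> C) (x : V) :
  square_sum n (fun z => k z *: x) = square_sum n k *: x.
Proof. by rewrite /square_sum scaler_suml; apply: eq_bigr => j _; exact: msum_vec. Qed.

(** The sum of the difference quotient (f z - f b) / (z - b) is small for b = a and for b = 0; this
    is Cauchy's formula with the winding sum [W b] in place of 2 pi i. As [W a] and [W 0] need not
    agree, their difference is estimated too. Both errors are at most 16 M |a|, and division by 4 <=
    |W 0| leaves 8 M |a|. *)
Lemma cauchy_lipschitz_square V (f : C -> V) (M : R) (a : C) :
  (forall z : C, rnorm z <= 3 / 2 -> exists d, cderiv f z d) ->
  (forall z : C, rnorm z <= 3 / 2 -> rnorm (f z) <= M) ->
  rnorm a <= 1 / 2 -> rnorm (f a - f 0) <= 8 * M * rnorm a.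
Proof.
move=> df fM a2.
have M0 : 0 <= M.
  by apply: le_trans (rnorm_ge0 (f 0)) (fM 0 _); rewrite rnorm0; lra.
pose q b z := (z - b)^-1 *: (f z - f b).
have qB b : rnorm b <= 1 / 2 -> exists B, forall z, D z -> rnorm (q b z) <= B.
  move=> b2; have [|d Hd] := df b; first lra.
  have [K [r r0 H]] := cderiv_bounded Hd.
  have Mr0 : 0 <= 2 * M / r by rewrite divr_ge0 ?mulr_ge0// ltW.
  exists (`|K| + 2 * M / r) => z Dz; have [->|zb] := eqVneq z b.
    by rewrite /q subrr invr0 scale0r rnorm0 addr_ge0.
  have zb0 : 0 < rnorm (z - b) by rewrite rnorm_gt0 subr_eq0.
  rewrite /q rnormZ rnormV mulrC ler_pdivrMr//.
  have [zr|zr] := leP (rnorm (z - b)) r.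
    have := H _ zr; rewrite [b + _]addrC subrK => /le_trans; apply.
    rewrite ler_wpM2r ?rnorm_ge0// (le_trans (ler_norm _))// lerDl//.
  apply: le_trans (rnormB _ _) _.
  have h1 : rnorm (f z) + rnorm (f b) <= 2 * M.
    by have := fM z Dz; have := fM b _; move=> /(_ _)/wrap[|]; lra.
  apply: le_trans h1 _; rewrite [leRHS]mulrDl ler_wpDl ?mulr_ge0 ?rnorm_ge0//.
  by rewrite mulrAC ler_pdivlMr// ler_wpM2l ?mulr_ge0// ltW.
have dq b z : D z -> z != b -> exists d, cderiv (q b) z d.
  move=> /df[d Hd] zb.
  have := cderivV (cderivB (cderiv_id z) (cderiv_cst b z)); rewrite subr_eq0.
  move=> /(_ zb)[k Hk]; have := cderivZ Hk (cderivB Hd (cderiv_cst (f b) z)).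
  by move=> H; eexists; exact: H.
have [Ba HBa] := qB a a2.
have [|B0 HB0] := qB 0; first by rewrite rnorm0; lra.
have r00 : rnorm (0 : C) <= 1 / 2 by rewrite rnorm0; lra.
apply/ler_addgt0Pr => e e0; have e2 : 0 < e by lra.
have [N1 H1] := square_sum_small a2 HBa (dq a) e2.
have [N2 H2] := square_sum_small r00 HB0 (dq 0) e2.
pose n := maxn N1 N2.
have {}H1 := H1 n (leq_maxl _ _); have {}H2 := H2 n (leq_maxr _ _).
pose W b : C := square_sum n (fun z => (z - b)^-1 : C).
have qE b : square_sum n (q b) = square_sum n (fun z => (z - b)^-1 *: f z) - W b *: f b.
  rewrite -square_sum_vec -square_sumB; congr (square_sum n _).
  by apply/funext => z; rewrite /q scalerBr.
have kb (z : C) : 1 <= rnorm z -> rnorm ((z - a)^-1 - (z - 0)^-1 : C) <= 2 * rnorm a.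
  move=> z1; have za : 1 / 2 <= rnorm (z - a).
    by have := rnormD (z - a) a; rewrite subrK; lra.
  have z0 : z != 0 by rewrite -rnorm_gt0; lra.
  have za0 : z - a != 0 by rewrite -rnorm_gt0; lra.
  have -> : (z - a)^-1 - (z - 0)^-1 = a * ((z - a)^-1 * z^-1).
    by rewrite subr0; field; rewrite z0 za0.
  rewrite rnormM mulrC ler_wpM2r ?rnorm_ge0// rnormM !rnormV.
  have i1 : (rnorm (z - a))^-1 <= 2.
    by rewrite invf_ple ?posrE; lra.
  have i2 : (rnorm z)^-1 <= 1 by rewrite invf_ple ?posrE ?invr1; lra.
  by rewrite -[2]mulr1 ler_pM// invr_ge0 rnorm_ge0.
have W0 : W 0 = square_sum n inv.
  by congr (square_sum n _); apply/funext => z; rewrite subr0.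
have key : W 0 *: (f a - f 0) =
    square_sum n (fun z => ((z - a)^-1 - (z - 0)^-1) *: f z) -
    square_sum n (q a) + square_sum n (q 0) - (W a - W 0) *: f a.
  have -> : (fun z => ((z - a)^-1 - (z - 0)^-1) *: f z) =
      (fun z => (z - a)^-1 *: f z - (z - 0)^-1 *: f z).
    by apply/funext => z; rewrite scalerBl.
  rewrite square_sumB !qE scalerBr scalerBl !opprB.
  move: (square_sum n _) (square_sum n _) => s t.
  move: (W 0 *: f a) (W 0 *: f 0) (W a *: f a) => x y z.
  by rewrite [t - s + _]addrC [z - t + _]addrA subrK [z - s + _]addrA subrK [RHS]addrC addrA subrK.
have b1 : rnorm (square_sum n (fun z => ((z - a)^-1 - (z - 0)^-1) *: f z)) <=
    8 * (2 * rnorm a * M).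
  apply: square_sum_bound => z z1 Dz; rewrite rnormZ.
  by apply: ler_pM; rewrite ?rnorm_ge0//; [exact: kb|exact: fM].
have b2 : rnorm (W a - W 0) <= 8 * (2 * rnorm a).
  by rewrite /W -square_sumB; apply: square_sum_bound => z z1 Dz; exact: kb.
have b3 : rnorm ((W a - W 0) *: f a) <= 8 * (2 * rnorm a) * M.
  by rewrite rnormZ; apply: ler_pM; rewrite ?rnorm_ge0//; apply: fM; lra.
have b4 : 4 * rnorm (f a - f 0) <= rnorm (W 0 *: (f a - f 0)).
  by rewrite rnormZ ler_wpM2r ?rnorm_ge0// W0; exact: square_sum_inv.
have := rnormB (square_sum n (fun z => ((z - a)^-1 - (z - 0)^-1) *: f z) -
    square_sum n (q a) + square_sum n (q 0)) ((W a - W 0) *: f a).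
rewrite -key.
have := rnormD (square_sum n (fun z => ((z - a)^-1 - (z - 0)^-1) *: f z) -
    square_sum n (q a)) (square_sum n (q 0)).
have := rnormB (square_sum n (fun z => ((z - a)^-1 - (z - 0)^-1) *: f z))
    (square_sum n (q a)).
lra.
Qed.

(** Scaling by [c] = 2 r / 3 carries the disc of radius 3/2 to radius r and turns 8 into 12. For |z|
    > r / 3 the trivial bound 2 M is already smaller than the claim. *)
Lemma cauchy_lipschitz V (f : C -> V) (M r : R) : 0 < r ->
  (forall z : C, rnorm z <= r -> exists d, cderiv f z d) ->
  (forall z : C, rnorm z <= r -> rnorm (f z) <= M) ->
  forall z : C, rnorm z <= r -> rnorm (f z - f 0) <= 12 * M / r * rnorm z.
Proof.
move=> r0 df fM z zr.
have M0 : 0 <= M.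
  by apply: le_trans (rnorm_ge0 (f 0)) (fM 0 _); rewrite rnorm0 ltW.
have [z3|z3] := leP (rnorm z) (r / 3); last first.
  apply: (@le_trans _ _ (2 * M)).
    have := rnormB (f z) (f 0); have := fM z zr; have := fM 0.
    by rewrite rnorm0 => /(_ (ltW r0)); lra.
  have -> : 12 * M / r * rnorm z = M * (12 * rnorm z / r) by field; rewrite gt_eqF.
  by rewrite mulrC ler_wpM2l// ler_pdivlMr//; lra.
pose c : C := (2 * r / 3)%:C; have c0 : c != 0.
  by rewrite -rnorm_gt0 rnorm_real normr_gt0; lra.
have nc : rnorm c = 2 * r / 3 by rewrite rnorm_real ger0_norm//; lra.
have Dc (y : C) : rnorm y <= 3 / 2 -> rnorm (c * y) <= r.
  by move=> y3; rewrite rnormM nc; have := rnorm_ge0 y; nra.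
have zc : z = c * (c^-1 * z) by rewrite mulrA mulfV// mul1r.
have := @cauchy_lipschitz_square V (fun y => f (c * y)) M (c^-1 * z).
rewrite -zc mulr0 => H; apply: le_trans (H _ _ _) _.
- by move=> y /Dc/df[d Hd]; eexists; apply: cderiv_scale Hd.
- by move=> y /Dc/fM.
- by rewrite rnormM rnormV nc mulrC ler_pdivrMr; lra.
rewrite rnormM rnormV nc.
by rewrite le_eqVlt; apply/orP; left; apply/eqP; field; rewrite gt_eqF.
Qed.

End SquareContour.

(** * Holomorphy of the Fréchet derivative *)

Section FrechetHolomorphic.
Variable R : realType.
Local Notation C := (R[i]^o).
Implicit Types (X Y Z : normedModType R[i]).

(** Differentiability along complex lines only: this is what the one-variable estimate consumes, and
    it is inherited by differences. *)
Definition line_holo X Y (F : X -> Y) (x0 : X) (s : R) := forall x h (t : C),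
  rnorm (x + t *: h - x0) <= s -> exists d, cderiv (fun t : C => F (x + t *: h)) t d.

Definition bounded_on X Y (F : X -> Y) (x0 : X) (s M : R) :=
  forall x, rnorm (x - x0) <= s -> rnorm (F x) <= M.

Definition dif X Y (k : X) (F : X -> Y) (x : X) : Y := F (x + k) - F x.

Lemma difC X Y (h k : X) (F : X -> Y) x : dif h (dif k F) x = dif k (dif h F) x.
Proof.
rewrite /dif [x + k + h]addrAC !opprB addrACA [RHS]addrACA; congr (_ + _).
by rewrite addrC.
Qed.

Lemma rnorm_shift X (x x0 h : X) : rnorm (x + h - x0) <= rnorm (x - x0) + rnorm h.
Proof. by rewrite addrAC rnormD. Qed.

(** [cauchy_lipschitz] at t = 1 for t -> F (x + t h) on the disc of radius s / (2 |h|), whence 24 =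
    2 * 12. *)
Lemma dif_bound X Y (F : X -> Y) x0 s M x h : 0 < s ->
  line_holo F x0 s -> bounded_on F x0 s M ->
  rnorm (x - x0) <= s / 2 -> rnorm h <= s / 2 ->
  rnorm (dif h F x) <= 24 * M / s * rnorm h.
Proof.
move=> s0 lF bF xs hs; have [->|h0] := eqVneq h 0.
  by rewrite /dif addr0 subrr !rnorm0 mulr0.
have hp : 0 < rnorm h by rewrite rnorm_gt0.
have r0 : 0 < s / (2 * rnorm h) by rewrite divr_gt0// mulr_gt0.
have D (t : C) : rnorm t <= s / (2 * rnorm h) -> rnorm (x + t *: h - x0) <= s.
  rewrite ler_pdivlMr ?mulr_gt0// => tr; apply: le_trans (rnorm_shift _ _ _) _.
  by rewrite rnormZ; lra.
have := cauchy_lipschitz r0 (fun t tr => lF x h t (D t tr)) (fun t tr => bF _ (D t tr)).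
move=> /(_ 1); rewrite scale1r scale0r addr0 rnorm1 => /(_ _)/wrap[|].
  by rewrite ler_pdivlMr ?mulr_gt0//; lra.
move=> /le_trans; apply; rewrite le_eqVlt; apply/orP; left; apply/eqP.
by field; rewrite !gt_eqF.
Qed.

Lemma line_holo_dif X Y (F : X -> Y) x0 s k :
  line_holo F x0 s -> rnorm k <= s / 2 -> line_holo (dif k F) x0 (s / 2).
Proof.
move=> lF ks x h t xt.
have [|d Hd] := lF (x + k) h t.
  by rewrite [x + k + _]addrAC; apply: le_trans (rnorm_shift _ _ _) _; lra.
have [|d' Hd'] := lF x h t; first by have := rnorm_ge0 k; lra.
exists (d - d'); have := cderivB Hd Hd'; congr cderiv.
by apply/funext => u; rewrite /dif addrAC.
Qed.

(* Iterating the Lipschitz estimate on differences replaces Cauchy's estimates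
   for the first three derivatives. *)
Lemma third_difference_bound X Y (F : X -> Y) x0 s M : 0 < s ->
  line_holo F x0 s -> bounded_on F x0 s M ->
  exists K : R, exists2 r : R, 0 < r & [/\ 0 <= K,
   (forall x m, rnorm (x - x0) <= r -> rnorm m <= r ->
     rnorm (dif m F x) <= K * rnorm m),
   (forall x h m, rnorm (x - x0) <= r -> rnorm h <= r -> rnorm m <= r ->
     rnorm (dif m (dif h F) x) <= K * rnorm h * rnorm m) &
   forall x h k m, rnorm (x - x0) <= r -> rnorm h <= r -> rnorm k <= r ->
     rnorm m <= r -> rnorm (dif m (dif h (dif k F)) x) <= K * rnorm h * rnorm k * rnorm m].
Proof.
move=> s0 lF bF.
have M0 : 0 <= M.
  by apply: le_trans (rnorm_ge0 (F x0)) (bF x0 _); rewrite subrr rnorm0 ltW.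
have s2 : 0 < s / 2 by lra.
have s4 : 0 < s / 2 / 2 by lra.
pose K1 := 24 * M / s; pose K2 := 24 * K1 / (s / 2); pose K3 := 24 * K2 / (s / 2 / 2).
have K10 : 0 <= K1 by apply: divr_ge0; [exact: mulr_ge0|exact: ltW].
have K20 : 0 <= K2 by apply: divr_ge0; [exact: mulr_ge0|exact: ltW].
have K30 : 0 <= K3 by apply: divr_ge0; [exact: mulr_ge0|exact: ltW].
have b1 k : rnorm k <= s / 2 -> bounded_on (dif k F) x0 (s / 2) (K1 * rnorm k).
  by move=> ks x xs; exact: dif_bound lF bF _ _.
have b2 h k : rnorm k <= s / 2 -> rnorm h <= s / 2 / 2 ->
    bounded_on (dif h (dif k F)) x0 (s / 2 / 2) (K2 * rnorm k * rnorm h).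
  move=> ks hs x xs.
  have := dif_bound s2 (line_holo_dif lF ks) (b1 k ks) xs hs.
  by move=> /le_trans; apply; rewrite /K2 !mulrA [_ * rnorm k / _]mulrAC.
exists (K1 + K2 + K3), (s / 2 / 2 / 2); first lra.
split.
- by rewrite !addr_ge0.
- move=> x m xs ms; apply: le_trans (b1 m _ x _) _; try lra.
  by rewrite ler_wpM2r ?rnorm_ge0//; lra.
- move=> x h m xs hs ms; apply: le_trans (b2 m h _ _ x _) _; try lra.
  by rewrite !ler_wpM2r ?rnorm_ge0//; lra.
move=> x h k m xs hs ks ms.
have ks2 : rnorm k <= s / 2 by lra.
have hs4 : rnorm h <= s / 2 / 2 by lra.
have := dif_bound s4 (line_holo_dif (line_holo_dif lF ks2) hs4) (b2 h k ks2 hs4) xs ms.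
move=> /le_trans; apply; rewrite ler_wpM2r ?rnorm_ge0//.
have -> : 24 * (K2 * rnorm k * rnorm h) / (s / 2 / 2) = K3 * rnorm h * rnorm k.
  by rewrite /K3; field; rewrite gt_eqF.
by rewrite !ler_wpM2r ?rnorm_ge0//; lra.
Qed.

Lemma fdiff_shift X Y (F : X -> Y) x k L : fdiff F (x + k) L ->
  fdiff (fun x => F (x + k)) x L.
Proof. by move=> dF e /dF[d d0 Hd]; exists d => // h; rewrite [x + h + k]addrAC => /Hd. Qed.

Lemma fdiffB X Y (F G : X -> Y) x L M : fdiff F x L -> fdiff G x M ->
  fdiff (fun x => F x - G x) x (fun h => L h - M h).
Proof.
move=> dF dG e e0; have e2 : 0 < e / 2 by lra.
have [d1 d1p H1] := dF _ e2; have [d2 d2p H2] := dG _ e2.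
exists (Num.min d1 d2); first by rewrite lt_min d1p.
move=> h; rewrite le_min => /andP[/H1 h1 /H2 h2].
have -> : F (x + h) - G (x + h) - (F x - G x) - (L h - M h) =
  (F (x + h) - F x - L h) - (G (x + h) - G x - M h).
  by rewrite !opprD !opprK !addrA (ACl (1*3*5*2*4*6)).
by apply: le_trans (rnormB _ _) _; lra.
Qed.

Lemma fdiff_dif X Y (F : X -> Y) (P : X -> X -> Y) k x :
  fdiff F x (P x) -> fdiff F (x + k) (P (x + k)) ->
  fdiff (dif k F) x (fun h => P (x + k) h - P x h).
Proof. by move=> h1 h2; apply: fdiffB => //; exact: fdiff_shift. Qed.

Let pw (n : nat) : C := (2 ^+ n : R)%:C.
Let iw (n : nat) : C := ((2 ^+ n)^-1 : R)%:C.

Let npw n : rnorm (pw n) = 2 ^+ n.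
Proof. by rewrite rnorm_real ger0_norm. Qed.

Let niw n : rnorm (iw n) = (2 ^+ n)^-1.
Proof. by rewrite rnorm_real ger0_norm// invr_ge0. Qed.

Let p0 n : (2 ^+ n : R) != 0. Proof. by rewrite expf_neq0. Qed.

Let pwiw n : pw n * iw n = 1.
Proof. by rewrite -rmorphM /= mulfV. Qed.

Definition dyadic_quotient X Y (F : X -> Y) (x h : X) (n : nat) : Y :=
  pw n *: dif (iw n *: h) F x.

Lemma dyadic_quotient_fdiff X Y (F : X -> Y) x (L : X -> Y) h : linear L ->
  fdiff F x L -> seq_lim (dyadic_quotient F x h) (L h).
Proof.
move=> lL dF e e0.
have LZ (t : C) : L (t *: h) = t *: L h.
  pose L' : {linear X -> Y} := HB.pack L (GRing.isLinear.Build _ _ _ _ _ lL).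
  exact: (linearZ_LR L').
have h1 : 0 < rnorm h + 1 by have := rnorm_ge0 h; lra.
have [d d0 Hd] := dF _ (divr_gt0 e0 h1).
have [N HN] := div_exp2_small (rnorm h) d0; exists N => n /HN hn.
have := Hd (iw n *: h); rewrite rnormZ niw mulrC => /(_ hn) H.
have -> : dyadic_quotient F x h n - L h =
    pw n *: (F (x + iw n *: h) - F x - L (iw n *: h)).
  by rewrite LZ [RHS]scalerBr scalerA pwiw scale1r.
rewrite rnormZ npw.
apply: le_trans (ler_wpM2l _ H) _; first by rewrite exprn_ge0.
have -> : 2 ^+ n * (e / (rnorm h + 1) * (rnorm h / 2 ^+ n)) =
   e * (rnorm h / (rnorm h + 1)) by field; rewrite p0 gt_eqF.
by rewrite ler_piMr ?ltW// ltr_pdivrMr// mul1r ltrDl.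
Qed.

(** With k = h / 2^(n+1), consecutive dyadic quotients differ by exactly -2^n times the second
    difference of F in direction k. *)
Lemma dyadic_quotient_step X Y (F : X -> Y) x (K r : R) h n :
  (forall h, rnorm h <= r -> rnorm (dif h (dif h F) x) <= K * rnorm h ^+ 2) ->
  rnorm h <= r * 2 ^+ n ->
  rnorm (dyadic_quotient F x h n.+1 - dyadic_quotient F x h n) <=
    K * rnorm h ^+ 2 / 4 / 2 ^+ n.
Proof.
move=> HK hr; pose k := iw n.+1 *: h.
have pS : pw n.+1 = pw n * 2 by rewrite /pw exprSr rmorphM /= rmorph_nat.
have ik : iw n *: h = k + k.
  rewrite /k -scalerDl; congr (_ *: _); rewrite -rmorphD /=; congr (_%:C).
  by rewrite exprS; field.
have -> : dyadic_quotient F x h n.+1 - dyadic_quotient F x h n =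
    - (pw n *: dif k (dif k F) x).
  rewrite /dyadic_quotient pS -/k ik -scalerA -scalerBr -scalerN; congr (_ *: _).
  rewrite scaler_nat mulr2n /dif !opprB !addrA.
  set a := F (x + k); set b := F x; set c := F (x + k + k).
  by rewrite subrK.
have nk : rnorm k = rnorm h / 2 ^+ n.+1 by rewrite rnormZ niw mulrC.
rewrite rnormN rnormZ npw.
have kr : rnorm k <= r.
  rewrite nk ler_pdivrMr ?exprn_gt0// (le_trans hr)// exprS mulrCA ler_peMl ?ler1n//.
  by apply: le_trans hr; exact: rnorm_ge0.
apply: le_trans (ler_wpM2l _ (HK _ kr)) _; first by rewrite exprn_ge0.
by rewrite nk [2 ^+ n.+1]exprS le_eqVlt; apply/orP; left; apply/eqP; field.
Qed.

(** Sums the steps of [dyadic_quotient_step] from n = 0, where the quotient is the difference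
    itself. This is a Taylor remainder obtained from second differences based at the single point
    [x]. *)
Lemma second_difference_taylor X Y (F : X -> Y) x (K r : R) h l :
  (forall h, rnorm h <= r -> rnorm (dif h (dif h F) x) <= K * rnorm h ^+ 2) ->
  rnorm h <= r -> seq_lim (dyadic_quotient F x h) l ->
  rnorm (dif h F x - l) <= K * rnorm h ^+ 2 / 2.
Proof.
move=> HK hr Hl.
have st n : rnorm (dyadic_quotient F x h n.+1 - dyadic_quotient F x h n) <=
    K * rnorm h ^+ 2 / 4 / 2 ^+ n.
  apply: dyadic_quotient_step HK _; rewrite (le_trans hr)// ler_peMr ?exprn_ege1 ?ler1n//.
  exact: le_trans (rnorm_ge0 h) hr.
have := geo_lim_bound st Hl 0; rewrite expr0 divr1 /dyadic_quotient.
rewrite /pw /iw expr0 invr1 !scale1r => /le_trans; apply; lra.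
Qed.

Lemma dyadic_quotient_lim X Y (F : X -> Y) x (K r : R) h : 0 < r -> geo_complete Y ->
  (forall h, rnorm h <= r -> rnorm (dif h (dif h F) x) <= K * rnorm h ^+ 2) ->
  exists l, seq_lim (dyadic_quotient F x h) l.
Proof.
move=> r0 cY HK; have [N HN] := exp2_gt (rnorm h / r).
have [n|l Hl] := cY (fun n => dyadic_quotient F x h (n + N)%N)
  (K * rnorm h ^+ 2 / 4 / 2 ^+ N).
  rewrite addSn -[leRHS]mulrA -invfM -exprD addnC.
  apply: dyadic_quotient_step HK _; rewrite mulrC -ler_pdivrMr// (le_trans (ltW HN))//.
  by rewrite ler_weXn2l ?ler1n// leq_addr.
by exists l; exact: seq_lim_shift Hl.
Qed.

(** Serves to turn bounds for differences of a map into operator bounds for differences of its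
    derivative: the derivative of [dif h F] is the difference of the derivatives. Large [v] are
    reached by dyadic scaling. *)
Lemma derivative_le X Y (F : X -> Y) x (L : X -> Y) (K r : R) : linear L -> 0 < r ->
  fdiff F x L -> (forall m, rnorm m <= r -> rnorm (dif m F x) <= K * rnorm m) ->
  forall v, rnorm (L v) <= K * rnorm v.
Proof.
move=> lL r0 dF HK v; have [N HN] := exp2_gt (rnorm v / r).
apply: (@seq_lim_rnorm_le _ _ (fun n => dyadic_quotient F x v (n + N)%N)).
  move=> e e0; have [M HM] := dyadic_quotient_fdiff v lL dF e0.
  by exists M => n Mn; apply: HM; rewrite (leq_trans Mn)// leq_addr.
move=> n; have nr : rnorm (iw (n + N) *: v) <= r.
  rewrite rnormZ niw mulrC ler_pdivrMr ?exprn_gt0// mulrC -ler_pdivrMr//.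
  by rewrite (le_trans (ltW HN))// ler_weXn2l ?ler1n// leq_addl.
rewrite rnormZ npw; apply: le_trans (ler_wpM2l _ (HK _ nr)) _.
  by rewrite exprn_ge0.
by rewrite rnormZ niw mulrCA mulVKf.
Qed.

Lemma frechet_fdiff X Y (F : X -> Y) x : differentiable F x ->
  fdiff F x (frechet F x).
Proof. by move=> dF; rewrite frechetE//; exact: differentiable_fdiff. Qed.

Lemma linear_opB X Y (T S : bounded_op X Y) : linear (fun h => T h - S h).
Proof. by move=> a u v; rewrite !bounded_op_linear scalerBr opprD addrACA. Qed.

(* The second derivative B h is the limit of 2^n (F'(x0 + h/2^n) - F'(x0)); it is
   additive in h because second differences commute, which makes B symmetric. *)
Lemma differentiable_frechet X Y (F : X -> Y) x0 (s : R) : geo_complete Y -> 0 < s ->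
  (forall x, rnorm (x - x0) <= s -> differentiable F x) ->
  differentiable (frechet F) x0.
Proof.
move=> cY s0 dF; set P := frechet F.
have PF x : rnorm (x - x0) <= s -> fdiff F x (P x).
  by move=> /dF; exact: frechet_fdiff.
have x0s : rnorm (x0 - x0) <= s by rewrite subrr rnorm0 ltW.
(* Differentiability at [x0] makes [F] bounded on a ball around [x0], as the difference bounds
   require. *)
have [d1 d10 H1] := fdiff_lip (fun h => rnorm_op (P x0) h) (PF _ x0s).
pose s' := Num.min s d1; have s'0 : 0 < s' by rewrite lt_min s0.
have lF : line_holo F x0 s'.
  move=> x h t; rewrite le_min => /andP[/PF xs _].
  by eexists; apply: fdiff_line xs; exact: linearP.
have bF : bounded_on F x0 s' (rnorm (F x0) + (rnorm (P x0) + 1) * s').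
  move=> x xs; have : rnorm (x - x0) <= d1.
    by move: xs; rewrite le_min => /andP[].
  move=> /H1; rewrite [x0 + _]addrC subrK => h1.
  rewrite -[F x](subrK (F x0)) addrC; apply: le_trans (rnormD _ _) _.
  rewrite lerD2l (le_trans h1)// ler_wpM2l// addr_ge0 ?rnorm_ge0//.
have [K [r0 r00 [K0 B1 B2 B3]]] := third_difference_bound s'0 lF bF.
pose r := Num.min r0 (s / 4); have r_gt0 : 0 < r by rewrite lt_min r00; lra.
have rr0 y : y <= r -> y <= r0 by rewrite le_min => /andP[].
have rs y : y <= r -> y <= s / 4 by rewrite le_min => /andP[].
have x0r : rnorm (x0 - x0) <= r0 by rewrite subrr rnorm0 ltW.
(* [P (x0 + h) - P x0] is the derivative of [dif h F] at [x0], so second differences of [F] control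
   first differences of [P], and in [P2] third differences control second ones. *)
have P1 h : rnorm h <= r -> rnorm (dif h P x0) <= K * rnorm h.
  move=> hr; apply: rnorm_op_le => [|v v1]; first by rewrite mulr_ge0// rnorm_ge0.
  have := derivative_le (K := K * rnorm h) (r := r0) (@linear_opB _ _ (P (x0 + h)) (P x0)) r00.
  have F1 : fdiff (dif h F) x0 (fun u => P (x0 + h) u - P x0 u).
    apply: (@fdiff_dif _ _ F (fun y u => P y u)); apply: PF => //; rewrite addrC addKr.
    by have := rs _ hr; lra.
  move=> /(_ _ _ F1) H; apply: le_trans (H _ v) _.
    by move=> m mr; apply: B2 => //; exact: rr0.
  by rewrite ler_piMr// mulr_ge0// rnorm_ge0.
have P2 h : rnorm h <= r -> rnorm (dif h (dif h P) x0) <= K * rnorm h ^+ 2.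
  move=> hr; apply: rnorm_op_le => [|v v1]; first by rewrite mulr_ge0// sqr_ge0.
  have F1 y : rnorm (y - x0) <= s / 2 ->
      fdiff (dif h F) y (fun u => P (y + h) u - P y u).
    move=> ys; apply: (@fdiff_dif _ _ F (fun y u => P y u)); apply: PF; first lra.
    by apply: le_trans (rnorm_shift _ _ _) _; have := rs _ hr; lra.
  have F2 : fdiff (dif h (dif h F)) x0
      (fun u => (P (x0 + h + h) u - P (x0 + h) u) - (P (x0 + h) u - P x0 u)).
    apply: (@fdiff_dif _ _ (dif h F) (fun y u => P (y + h) u - P y u)); apply: F1.
      by rewrite subrr rnorm0; lra.
    by rewrite addrC addKr; have := rs _ hr; lra.
  have L2 : linear (fun u => (P (x0 + h + h) u - P (x0 + h) u) - (P (x0 + h) u - P x0 u)).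
    move=> a u w; have l1 := @linear_opB _ _ (P (x0 + h + h)) (P (x0 + h)) a u w.
    have l2 := @linear_opB _ _ (P (x0 + h)) (P x0) a u w.
    by rewrite /= in l1 l2 *; rewrite l1 l2 opprD addrACA -scalerBr.
  have := derivative_le (K := K * rnorm h * rnorm h) (r := r0) L2 r00 F2.
  move=> H; apply: le_trans (H _ v) _.
    by move=> m mr; apply: B3 => //; exact: rr0.
  by rewrite expr2 mulrA ler_piMr// !mulr_ge0// rnorm_ge0.
have /choice[B HB] : forall h, exists l, seq_lim (dyadic_quotient P x0 h) l.
  by move=> h; exact: dyadic_quotient_lim r_gt0 (geo_complete_op cY) P2.
(* [w h v n] is a second difference of [F] scaled by 4^n, symmetric in h and v by [difC]. It tends
   to [B h v], because replacing the increment in direction v by the derivative leaves a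
   third-difference error of order 2^-n. *)
have sym h v : B h v = B v h.
  pose w h v n := (pw n * pw n) *: dif (iw n *: v) (dif (iw n *: h) F) x0.
  have wl h' v' : seq_lim (w h' v') (B h' v').
    move=> e e0.
    have e2 : 0 < e / 2 by lra.
    have [N1 HN1] := seq_lim_op v' (HB h') e2.
    have [N2 HN2] := exp2_gt ((rnorm h' + rnorm v') / r).
    have [N3 HN3] := div_exp2_small (K * rnorm h' * rnorm v' ^+ 2 / 2) e2.
    exists (maxn N1 (maxn N2 N3)) => n; rewrite !geq_max => /and3P[n1 n2 n3].
    have hv : rnorm h' / 2 ^+ n <= r /\ rnorm v' / 2 ^+ n <= r.
      have : (rnorm h' + rnorm v') / r <= 2 ^+ n.
        by rewrite (le_trans (ltW HN2))// ler_weXn2l ?ler1n.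
      rewrite ler_pdivrMr// => hvr; rewrite !ler_pdivrMr ?exprn_gt0//.
      by have := rnorm_ge0 h'; have := rnorm_ge0 v'; split; rewrite mulrC; lra.
    pose A := dif (iw n *: h') F; pose k := iw n *: v'.
    have nh : rnorm (iw n *: h') = rnorm h' / 2 ^+ n by rewrite rnormZ niw mulrC.
    have nk : rnorm k = rnorm v' / 2 ^+ n by rewrite rnormZ niw mulrC.
    have FA : fdiff A x0 (fun u => P (x0 + iw n *: h') u - P x0 u).
      apply: (@fdiff_dif _ _ F (fun y u => P y u)); apply: PF => //; rewrite addrC addKr nh.
      by have := rs _ hv.1; lra.
    have BA u : rnorm u <= r -> rnorm (dif u (dif u A) x0) <=
        K * (rnorm h' / 2 ^+ n) * rnorm u ^+ 2.
      move=> ur; have := B3 x0 u (iw n *: h') u x0r (rr0 _ ur).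
      rewrite nh => /(_ (rr0 _ hv.1) (rr0 _ ur)) /le_trans; apply.
      by rewrite expr2 [leRHS]mulrA [K * rnorm u * _]mulrAC.
    have kr : rnorm k <= r by rewrite nk; exact: hv.2.
    have lA := dyadic_quotient_fdiff k (@linear_opB _ _ (P (x0 + iw n *: h')) (P x0)) FA.
    have TA := second_difference_taylor BA kr lA.
    have E : w h' v' n - dyadic_quotient P x0 h' n v' =
      (pw n * pw n) *: (dif k A x0 - (P (x0 + iw n *: h') k - P x0 k)).
      rewrite scalerBr; congr (_ - _).
      rewrite -[LHS]/(pw n *: (P (x0 + iw n *: h') v' - P x0 v')).
      have Pk (T : bounded_op X Y) : T k = iw n *: T v' by rewrite /k linearZ_LR.
      by rewrite !Pk -scalerBr scalerA -mulrA pwiw mulr1.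
    apply: le_trans (rnorm_tri _ (dyadic_quotient P x0 h' n v') _) _.
    have h2 := HN1 _ n1.
    suff : rnorm (w h' v' n - dyadic_quotient P x0 h' n v') <= e / 2 by lra.
    rewrite E rnormZ rnormM npw.
    apply: le_trans (ler_wpM2l _ TA) _; first by rewrite mulr_ge0 ?exprn_ge0.
    apply: le_trans (HN3 _ n3); rewrite nk le_eqVlt; apply/orP; left; apply/eqP.
    by field.
  apply: (seq_lim_unique (wl h v)); have := wl v h.
  by congr seq_lim; apply/funext => n; rewrite /w difC.
have opE (T S : bounded_op X Y) : (forall v, T v = S v) -> T = S.
  by move=> TS; apply: val_inj; apply/funext.
have Blin : linear B.
  move=> a u v; apply: opE => w.
  by rewrite -[RHS]/(a *: B u w + B v w) sym bounded_op_linear (sym w u) (sym w v).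
have Bsmall h : rnorm h <= r -> rnorm (B h) <= K * rnorm h.
  move=> hr; apply: (seq_lim_rnorm_le (HB h)) => n.
  have nr : rnorm (iw n *: h) <= r.
    rewrite rnormZ niw mulrC ler_pdivrMr ?exprn_gt0// (le_trans hr)//.
    by rewrite ler_peMr ?(ltW r_gt0)// exprn_ege1// ler1n.
  rewrite rnormZ npw; apply: le_trans (ler_wpM2l _ (P1 _ nr)) _.
    by rewrite exprn_ge0.
  by rewrite rnormZ niw mulrCA mulVKf.
have Bbound h : rnorm (B h) <= K * rnorm h.
  have [n Hn] := exp2_gt (rnorm h / r).
  have nr : rnorm (iw n *: h) <= r.
    by rewrite rnormZ niw mulrC ler_pdivrMr ?exprn_gt0// mulrC -ler_pdivrMr// ltW.
  pose B' : {linear X -> bounded_op X Y} := HB.pack B (GRing.isLinear.Build _ _ _ _ _ Blin).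
  have := Bsmall _ nr; have -> : B (iw n *: h) = iw n *: B h by exact: (linearZ_LR B').
  by rewrite !rnormZ mulrCA ler_pM2l// niw invr_gt0 exprn_gt0.
apply: (proj1 (fdiff_diff Blin Bbound _)) => e e0.
have K1 : 0 < K + 1 by lra.
exists (Num.min r (e / (K + 1))).
  by rewrite lt_min r_gt0 divr_gt0.
move=> h; rewrite le_min => /andP[hr he].
apply: le_trans (second_difference_taylor P2 hr (HB h)) _.
rewrite expr2 mulrA mulrAC ler_wpM2r ?rnorm_ge0//.
have := rnorm_ge0 h; move: he; rewrite ler_pdivlMr//; lra.
Qed.

End FrechetHolomorphic.

(** * Compactness of closed discs and existence of maxima *)

Section DiscExtremum.
Variable R : realType.
Local Notation C := (R[i]^o).

Lemma rnorm_continuous (V : normedModType R[i]) : continuous (@rnorm R V : V -> R).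
Proof.
move=> x; apply/cvgrPdist_le => e e0; apply/nbhs_rnormP; exists e => // y /ltW yx.
apply: le_trans yx; rewrite ler_norml.
have := rnormD (x - y) y; have := rnormD (y - x) x; rewrite !subrK.
by rewrite [rnorm (x - y)]rnorm_distC; lra.
Qed.

Lemma real_complex_continuous : continuous (fun x : R => x%:C : C).
Proof.
move=> x; apply/cvgrPdist_le => _ /cpos_real[e e0 ->].
near=> y; rewrite normr_le_rnorm -rmorphB rnorm_real.
by near: y; exact: cvgr_dist_le.
Unshelve. all: by end_near. Qed.

Lemma compact_disc (r : R) : compact [set z : C | rnorm z <= r].
Proof.
pose f (p : R * R) : C := p.1%:C + 'i%C * p.2%:C.
have cf : continuous f.
  move=> p; apply: cvgD.
    apply: (@cvg_comp _ _ _ fst (fun x : R => x%:C : C) _ (nbhs p.1)); first exact: cvg_fst.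
    exact: real_complex_continuous.
  apply: cvgM; first exact: cvg_cst.
  apply: (@cvg_comp _ _ _ snd (fun x : R => x%:C : C) _ (nbhs p.2)); first exact: cvg_snd.
  exact: real_complex_continuous.
have cS : compact (`[- r, r]%classic `*` `[- r, r]%classic : set (R * R)).
  by apply: compact_setX; exact: segment_compact.
have cI : compact (f @` (`[- r, r]%classic `*` `[- r, r]%classic)).
  exact: continuous_compact (continuous_subspaceT cf) cS.
apply: (subclosed_compact _ cI).
  rewrite -[X in closed X]/((@rnorm R C) @^-1` [set x | x <= r]).
  by apply: closed_comp => [z _|]; [exact: rnorm_continuous|exact: closed_le].
move=> z /= zr; exists (complex.Re z, complex.Im z); last first.
  by rewrite /f /= [RHS]complexE.
have := le_trans (Re_le_rnorm z) zr; have := le_trans (Im_le_rnorm z) zr.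
by rewrite !ler_norml /= !in_itv /= => -> ->.
Qed.

Lemma disc_max (u : C -> R) (r : R) : 0 <= r ->
  (forall z : C, rnorm z <= r -> {for z, continuous u}) ->
  exists2 z0 : C, rnorm z0 <= r & forall z : C, rnorm z <= r -> u z <= u z0.
Proof.
move=> r0 cu; have [||z0] := @compact_EVT_max C R u _ _ (@compact_disc r).
- by exists 0; rewrite /= rnorm0.
- rewrite continuous_subspace_in => z; rewrite inE /= => zr.
  by apply: continuous_subspaceT_for => //; exact: cu.
by rewrite inE /= => z0r H; exists z0 => // z zr; apply: H; rewrite inE.
Qed.

End DiscExtremum.

(** * Mean value inequality, chain rule and second-order expansion *)

Section OneVariable.
Variable R : realType.
Local Notation C := (R[i]^o).
Implicit Types (f w : C -> C) (z : C).

Lemma fdiff_local (V W : normedModType R[i]) (f g : V -> W) x (s : R) L : 0 < s ->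
  (forall y, rnorm (y - x) <= s -> f y = g y) -> fdiff f x L -> fdiff g x L.
Proof.
move=> s0 fg df e /df[d d0 Hd]; exists (Num.min s d); first by rewrite lt_min s0.
move=> h; rewrite le_min => /andP[hs /Hd]; rewrite !fg ?subrr ?rnorm0 ?(ltW s0)//.
by rewrite addrC addKr.
Qed.

(** [derive1 f z] is [frechet f z] evaluated at 1, and evaluation is linear and bounded. *)
Lemma differentiable_derive1 f z0 (s : R) : 0 < s ->
  (forall z, rnorm (z - z0) <= s -> differentiable f z) ->
  differentiable (derive1 f) z0.
Proof.
move=> s0 df.
have /frechet_fdiff dF := differentiable_frechet (geo_complete_C (R := R)) s0 df.
suff : cderiv (derive1 f) z0 (frechet (frechet f) z0 1 1) by move=> /cderiv_diff[].
apply: (@fdiff_local _ _ (fun z => frechet f z 1)  _ _ s) => // [z zs|].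
  by rewrite frechetE ?derive1E'//; exact: df.
move=> e /dF[d d0 Hd]; exists d => // h /Hd; apply: le_trans.
have := rnorm_op (frechet f (z0 + h) - frechet f z0 - frechet (frechet f) z0 h) 1.
rewrite rnorm1 mulr1; apply: le_trans.
rewrite -[X in _ <= rnorm X]/(frechet f (z0 + h) 1 - frechet f z0 1 - frechet (frechet f) z0 h 1).
have -> : frechet (frechet f) z0 h = h *: frechet (frechet f) z0 1.
  by rewrite -linearZ_LR /=; congr (frechet _ _ _); rewrite [RHS]mulr1.
exact: lexx.
Qed.

(** Bisection again: if the increment over a segment exceeds (M + e) times its length, so does the
    increment over one of its halves. The segments shrink to a point whose derivative would be too
    large. *)
Lemma mean_value_inequality (V : normedModType R[i]) (D : C -> Prop) (f : C -> V) (M : R) :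
  midclosed D -> seqclosed D ->
  (forall z, D z -> exists2 d, cderiv f z d & rnorm d <= M) ->
  forall a b, D a -> D b -> rnorm (f b - f a) <= M * rnorm (b - a).
Proof.
move=> DD Ds Df a0 b0 Da0 Db0.
have [->|ab] := eqVneq b0 a0; first by rewrite !subrr !rnorm0 mulr0.
pose P := rnorm (b0 - a0); have P0 : 0 < P by rewrite rnorm_gt0 subr_eq0.
rewrite leNgt; apply/negP => lt; pose e := (rnorm (f b0 - f a0) / P - M) / 2.
have e0 : 0 < e by rewrite divr_gt0// subr_gt0 ltr_pdivlMr.
have bad0 : (M + e) * P < rnorm (f b0 - f a0).
  rewrite -ltr_pdivlMr// /e; move: e0; rewrite /e; set q := rnorm _ / P; lra.
pose Inv (x : nat * (C * C)) := let: (k, (a, b)) := x in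
  [/\ D a, D b, rnorm (b - a) = P / 2 ^+ k & (M + e) * rnorm (b - a) < rnorm (f b - f a)].
have step (x : nat * (C * C)) : exists t : C * C, Inv x ->
    Inv (x.1.+1, t) /\ rnorm (t.1 - x.2.1) <= P / 2 ^+ x.1.
  case: x => k [a b]; have [|nI] := pselect (Inv (k, (a, b))); last by exists (a, b).
  case=> Da Db abk bad; have Dm := DD _ _ Da Db.
  have n1 : rnorm (mid a b - a) = P / 2 ^+ k.+1.
    by rewrite mid_subl rnorm_half abk exprSr invfM mulrA.
  have n2 : rnorm (b - mid a b) = P / 2 ^+ k.+1.
    by rewrite mid_subr rnorm_half abk exprSr invfM mulrA.
  have le : P / 2 ^+ k.+1 <= P / 2 ^+ k.
    rewrite ler_wpM2l ?(ltW P0)// lef_pV2 ?posrE ?exprn_gt0//.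
    by rewrite ler_weXn2l// ler1n.
  have [h1|h1] := ltP ((M + e) * rnorm (mid a b - a)) (rnorm (f (mid a b) - f a)).
    by exists (a, mid a b) => _; split; [split|rewrite /= subrr rnorm0 divr_ge0// ltW].
  exists (mid a b, b) => _; split; last by rewrite /= n1.
  split=> //; rewrite ltNge; apply/negP => h2.
  have := rnorm_tri (f b) (f (mid a b)) (f a); rewrite leNgt => /negP; apply.
  apply: le_lt_trans (lerD h2 h1) _; apply: le_lt_trans bad.
  rewrite -mulrDr n1 n2 abk exprSr invfM mulrA -mulrDr.
  by rewrite -splitr mulrA.
have /choice[F HF] := step.
pose fix t k := if k is j.+1 then F (j, t j) else (a0, b0).
have It k : Inv (k, t k).
  elim: k => [|k IH]; first by rewrite /= expr0 divr1.
  by have [] := HF _ IH.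
have ut k : rnorm ((t k.+1).1 - (t k).1) <= P / 2 ^+ k by have [] := HF _ (It k).
have [l ul] := geo_complete_C (u := fun k => (t k).1) ut.
have tl := geo_lim_bound ut ul.
have Dl : D l.
  apply: (Ds _ l _ ul) => k.
  by have := It k; rewrite /Inv; case: (t k) => [? ?] [].
have [d Hd dM] := Df _ Dl.
(* The endpoints of a segment of length q lie within 2 q and 3 q of [l]; with slope e / 6 the two
   errors add up to 5/6 e q < e q. *)
have e6 : 0 < e / 6 by lra.
have [dl dl0 {}Hd] := Hd _ e6.
have [k /(_ k (leqnn k)) Hk] := div_exp2_small (3 * P) dl0.
have := It k; have := tl k; rewrite /Inv; case: (t k) => [a b] /= al [_ _ abk].
apply/negP; rewrite -leNgt abk.
pose q := P / 2 ^+ k; have q0 : 0 < q by rewrite divr_gt0.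
have al' : rnorm (a - l) <= 2 * q by rewrite mulrA.
have bl : rnorm (b - l) <= 3 * q.
  by apply: le_trans (rnorm_tri _ a _) _; rewrite abk -/q; lra.
have kq : 3 * q <= dl by rewrite mulrA.
have ha := Hd (a - l) _; have hb := Hd (b - l) _.
have {}ha := ha (le_trans al' _); have {}ha : rnorm (f (l + (a - l)) - f l - (a - l) *: d) <= e / 6 * rnorm (a - l).
  by apply: ha; lra.
have {}hb := hb (le_trans bl kq).
rewrite [l + _]addrC subrK in ha; rewrite [l + _]addrC subrK in hb.
have -> : f b - f a = (f b - f l - (b - l) *: d) - (f a - f l - (a - l) *: d) + (b - a) *: d.
  have -> : b - a = (b - l) - (a - l) by rewrite opprB addrA subrK.
  rewrite [X in _ = _ + X]scalerBl; move: ((b - l) *: d) ((a - l) *: d) => x y.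
  by rewrite addrACA subrK -opprD subrK opprB addrA subrK.
apply: le_trans (rnormD _ _) _; rewrite rnormZ abk -/q.
have := rnormB (f b - f l - (b - l) *: d) (f a - f l - (a - l) *: d).
have : q * rnorm d <= q * M by rewrite ler_wpM2l// ltW.
have : e / 6 * rnorm (a - l) <= e / 6 * (2 * q) by rewrite ler_wpM2l// ltW.
have : e / 6 * rnorm (b - l) <= e / 6 * (3 * q) by rewrite ler_wpM2l// ltW.
have : 0 < e * q by rewrite mulr_gt0.
have -> : (M + e) * q = q * M + e * q by ring.
have -> : e / 6 * (3 * q) = e * q / 2 by field.
have -> : e / 6 * (2 * q) = e * q / 3 by field.
lra.
Qed.

Lemma cderivD (V : normedModType R[i]) (f g : C -> V) z d d' :
  cderiv f z d -> cderiv g z d' -> cderiv (fun z => f z + g z) z (d + d').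
Proof.
move=> df dg; have := cderivB df (cderivB (cderiv_cst 0 z) dg).
rewrite sub0r opprK; congr cderiv.
by apply/funext => w; rewrite sub0r opprK.
Qed.

Lemma cderivM f g z d d' :
  cderiv f z d -> cderiv g z d' -> cderiv (fun z => f z * g z) z (d * g z + f z * d').
Proof. by move=> df dg; exact: cderivZ. Qed.

Lemma fdiff_comp (U V W : normedModType R[i]) (f : U -> V) (g : V -> W) x
    (L : U -> V) (M : V -> W) (K K' : R) :
  (forall h, rnorm (L h) <= K * rnorm h) -> linear M ->
  (forall h, rnorm (M h) <= K' * rnorm h) ->
  fdiff f x L -> fdiff g (f x) M -> fdiff (g \o f) x (fun h => M (L h)).
Proof.
move=> LK lM MK df dg e e0.
have MB a b : M (a - b) = M a - M b.
  by have := lM (-1) b a; rewrite !scaleN1r [- b + a]addrC [RHS]addrC.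
have [d0 d00 H0] := fdiff_lip LK df.
pose k := `|K| + 1; have k0 : 0 < k by have := normr_ge0 K; rewrite /k; lra.
pose k' := `|K'| + 1; have k'0 : 0 < k' by have := normr_ge0 K'; rewrite /k'; lra.
have e1 : 0 < e / (2 * k) by rewrite divr_gt0// mulr_gt0.
have e2 : 0 < e / (2 * k') by rewrite divr_gt0// mulr_gt0.
have [d1 d10 H1] := dg _ e1; have [d2 d20 H2] := df _ e2.
exists (Num.min d0 (Num.min (d1 / k) d2)).
  by rewrite !lt_min d00 d20 divr_gt0.
move=> h; rewrite !le_min => /andP[/H0 h0 /andP[hd1 /H2 h2]] /=.
set u := f (x + h) - f x.
have uk : rnorm u <= k * rnorm h.
  by apply: le_trans h0 _; rewrite ler_wpM2r ?rnorm_ge0// lerD2r ler_norm.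
have ud : rnorm u <= d1 by apply: le_trans uk _; rewrite mulrC -ler_pdivlMr.
have := H1 _ ud; rewrite [f x + u]addrC subrK => h1.
have -> : g (f (x + h)) - g (f x) - M (L h) =
    (g (f (x + h)) - g (f x) - M u) + M (u - L h) by rewrite (MB u) addrA subrK.
apply: le_trans (rnormD _ _) _.
have h3 : rnorm (M (u - L h)) <= e / 2 * rnorm h.
  apply: le_trans (MK _) _; apply: (@le_trans _ _ (k' * rnorm (u - L h))).
    by rewrite ler_wpM2r ?rnorm_ge0// /k'; have := ler_norm K'; lra.
  apply: le_trans (ler_wpM2l (ltW k'0) h2) _.
  by rewrite le_eqVlt; apply/orP; left; apply/eqP; field; rewrite gt_eqF.
have h4 : e / (2 * k) * rnorm u <= e / 2 * rnorm h.
  apply: le_trans (ler_wpM2l (ltW e1) uk) _.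
  by rewrite le_eqVlt; apply/orP; left; apply/eqP; field; rewrite gt_eqF.
lra.
Qed.

Lemma cderiv_comp (V : normedModType R[i]) f (g : C -> V) z d d' :
  cderiv f z d -> cderiv g (f z) d' -> cderiv (fun x : C => g (f x)) z (d *: d').
Proof.
move=> df dg; have E (W : normedModType R[i]) (y : W) (h : C) :
    rnorm (h *: y) <= rnorm y * rnorm h by rewrite rnormZ mulrC.
have := fdiff_comp (E _ d) _ (E _ d') df dg.
move=> /(_ _)/wrap[a u v|]; first by rewrite scalerDl scalerA.
by rewrite /cderiv; congr fdiff; apply/funext => h; rewrite scalerA.
Qed.

Lemma cderiv_shift (V : normedModType R[i]) (f : C -> V) z0 z d :
  cderiv f (z0 + z) d -> cderiv (fun x : C => f (z0 + x)) z d.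
Proof.
move=> df; have := cderiv_comp (cderivD (cderiv_cst z0 z) (cderiv_id z)) df.
by rewrite add0r scale1r.
Qed.

Lemma midclosed_disc0 (r : R) : midclosed (fun z : C => rnorm z <= r).
Proof.
move=> a b ar br; have := @midclosed_disc R 0 r a b; rewrite !subr0; exact.
Qed.

Lemma seqclosed_disc0 (r : R) : seqclosed (fun z : C => rnorm z <= r).
Proof.
move=> u l uD ul; apply/ler_addgt0Pr => e' /ul[N /(_ N (leqnn N)) HN].
by have := rnormB (u N) (u N - l); rewrite subKr; have := uD N; lra.
Qed.

(** The remainder [E] has as derivative the first-order remainder of f' at [z0], which is small
    since f' is differentiable there; the mean value inequality passes this on to [E]. *)
Lemma taylor2 f z0 (s : R) : 0 < s ->
  (forall z, rnorm (z - z0) <= s -> differentiable f z) ->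
  forall e : R, 0 < e -> exists2 d : R, 0 < d & forall h : C, rnorm h <= d ->
    rnorm (f (z0 + h) - f z0 - h * derive1 f z0 -
           h ^+ 2 / 2 * derive1 (derive1 f) z0) <= e * rnorm h ^+ 2.
Proof.
move=> s0 df e e0; have dg := diff_cderiv (differentiable_derive1 s0 df).
have [d d0 Hd] := dg _ e0; exists (Num.min s d); first by rewrite lt_min s0.
move=> h; rewrite le_min => /andP[hs hd].
move: Hd; set g2 : C := derive1 (derive1 f) z0; set g1 : C := derive1 f z0 => Hd.
pose E (w : C) : C := f (z0 + w) - (f z0 + (w * g1 + w * w * (2^-1 * g2))).
have dE (w : C) : rnorm w <= rnorm h ->
    exists2 d, cderiv E w d & rnorm d <= e * rnorm h.
  move=> wh; exists (derive1 f (z0 + w) - g1 - w * g2).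
    have c0 : cderiv (fun x : C => f (z0 + x)) w (derive1 f (z0 + w)).
      by apply: cderiv_shift; apply/diff_cderiv/df; rewrite addrC addKr; lra.
    have c1 := cderivM (cderiv_id w) (cderiv_cst g1 w).
    have c2 := cderivM (cderivM (cderiv_id w) (cderiv_id w)) (cderiv_cst (2^-1 * g2) w).
    have := cderivB c0 (cderivD (cderiv_cst (f z0) w) (cderivD c1 c2)).
    by congr cderiv; field.
  apply: le_trans (Hd w _) _; first lra.
  by rewrite ler_wpM2l// ltW.
have := mean_value_inequality (@midclosed_disc0 (rnorm h)) (@seqclosed_disc0 (rnorm h)) dE.
move=> /(_ 0 h); rewrite rnorm0 => /(_ (rnorm_ge0 h) (lexx _)).
have -> : E 0 = 0 by rewrite /E !mul0r !addr0 subrr.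
rewrite !subr0 -mulrA -expr2; apply: le_trans.
rewrite /E le_eqVlt; apply/orP; left; apply/eqP; congr rnorm.
by rewrite opprD !addrA opprD addrA; congr (_ - _); rewrite expr2 mulrA.
Qed.

Definition slope w (z : C) : C := if z == 0 then derive1 w 0 else w z / z.

Lemma slopeE w z : w 0 = 0 -> w z = z * slope w z.
Proof.
move=> w0; rewrite /slope; have [->|z0] := eqVneq z 0; first by rewrite w0 mul0r.
by rewrite mulrC divfK.
Qed.

(** The expansion of [taylor2] at 0, divided by h; this makes the singularity of w(z) / z
    removable. *)
Lemma cderiv_slope0 w (s : R) : 0 < s -> w 0 = 0 ->
  (forall z, rnorm z <= s -> differentiable w z) ->
  cderiv (slope w) 0 (derive1 (derive1 w) 0 / 2).
Proof.
move=> s0 w0 dw e e0.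
have [|d d0 Hd] := @taylor2 w 0 s s0 _ e e0; first by move=> z; rewrite subr0; exact: dw.
exists d => // h /Hd; rewrite !add0r w0 subr0 /slope eqxx.
have [->|h0] := eqVneq h 0; first by rewrite subrr scale0r subrr rnorm0 mulr0.
have hp : 0 < rnorm h by rewrite rnorm_gt0.
set a := derive1 (derive1 w) 0; set b := derive1 w 0.
have -> : w h - h * b - h ^+ 2 / 2 * a = h * (w h / h - b - h *: (a / 2)).
  by rewrite -[h *: _]/(h * _); field.
by rewrite rnormM expr2 mulrA mulrC ler_pM2r.
Qed.

Lemma differentiable_slope w (s : R) : 0 < s -> w 0 = 0 ->
  (forall z, rnorm z <= s -> differentiable w z) ->
  forall z, rnorm z < s -> differentiable (slope w) z.
Proof.
move=> s0 w0 dw z zs; have [->|z0] := eqVneq z 0.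
  by have [] := cderiv_diff (cderiv_slope0 s0 w0 dw).
have zp : 0 < rnorm z by rewrite rnorm_gt0.
have [k Hk] := cderivV (cderiv_id z) z0.
have := cderivM (diff_cderiv (dw z (ltW zs))) Hk.
have z2 : 0 < rnorm z / 2 by lra.
suff : forall d, cderiv (fun z => w z * z^-1) z d -> differentiable (slope w) z by apply.
move=> d H; suff : cderiv (slope w) z d by move=> /cderiv_diff[].
apply: fdiff_local z2 _ H => y yz; rewrite /slope ifN//.
apply/eqP => y0; move: yz; rewrite y0 sub0r rnormN; lra.
Qed.

End OneVariable.

(** * The maximum principle and the lemmas of Schwarz and Schwarz-Pick *)

Section MaximumPrinciple.
Variable R : realType.
Local Notation C := (R[i]^o).
Implicit Types (f w k : C -> C) (z : C).

(* The quadrature over h, ih, -h, -ih annihilates the linear and quadratic terms. *)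
Lemma four_point_mean (a b c h : C) :
  let p (x : C) : R := rnorm (a + x * b + x ^+ 2 * c) ^+ 2 in
  p h + p ('i%C * h) + p (- h) + p (- ('i%C * h)) =
  4 * (rnorm a ^+ 2 + rnorm h ^+ 2 * rnorm b ^+ 2 + rnorm h ^+ 4 * rnorm c ^+ 2).
Proof.
rewrite /= (_ : rnorm h ^+ 4 = (rnorm h ^+ 2) ^+ 2); last by rewrite -exprM.
rewrite !rnorm_sq; case: a b c h => [a1 a2] [b1 b2] [c1 c2] [h1 h2] /=.
by ring.
Qed.

Lemma four_point_norm (a h : C) :
  rnorm (a + h) ^+ 2 + rnorm (a + 'i%C * h) ^+ 2 + rnorm (a - h) ^+ 2 +
  rnorm (a - 'i%C * h) ^+ 2 = 4 * (rnorm a ^+ 2 + rnorm h ^+ 2).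
Proof.
by rewrite !rnorm_sq; case: a h => [a1 a2] [h1 h2] /=; ring.
Qed.

(** Averaging over z0 + h, z0 + i h, z0 - h, z0 - i h raises e |z|^2 by e t^2 and does not lower the
    squared modulus of the second Taylor polynomial; the Taylor error is made smaller than this
    gain. *)
Lemma no_interior_max f z0 (s e : R) : 0 < s -> 0 < e ->
  (forall z, rnorm (z - z0) <= s -> differentiable f z) ->
  ~ (forall z, rnorm (z - z0) <= s ->
       rnorm (f z) ^+ 2 + e * rnorm z ^+ 2 <= rnorm (f z0) ^+ 2 + e * rnorm z0 ^+ 2).
Proof.
move=> s0 e0 df H.
pose a : C := f z0; pose b : C := derive1 f z0; pose c : C := 2^-1 * derive1 (derive1 f) z0.
pose q (x : C) : C := a + x * b + x ^+ 2 * c.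
pose K := rnorm a + rnorm b + rnorm c; have K0 : 0 <= K by rewrite !addr_ge0 ?rnorm_ge0.
(* [K] bounds [q] for |x| <= 1. Passing from [f] to [q] costs at most 2 n t^2 K in the squared
   modulus, and this [n] keeps the cost within e t^2 / 2. *)
pose n := e / (4 * (K + 1)).
have n0 : 0 < n by rewrite divr_gt0// mulr_gt0// ltr_wpDl.
have [d d0 Hd] := taylor2 s0 df n0.
pose t := Num.min 1 (Num.min s d).
have t0 : 0 < t by rewrite !lt_min ltr01 s0.
have [t1 [ts td]] : t <= 1 /\ t <= s /\ t <= d.
  by rewrite !ge_min !lexx !orbT.
pose h : C := t%:C.
have nh : rnorm h = t by rewrite rnorm_real gtr0_norm.
have nI : rnorm ('i%C : C) = 1.
  by apply/eqP; rewrite -(@eqrXn2 _ 2)// ?rnorm_ge0// rnorm_sq /= expr0n expr1n add0r.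
have key (x : C) : rnorm x = t ->
    rnorm (q x) ^+ 2 - 2 * n * t ^+ 2 * K + e * rnorm (z0 + x) ^+ 2 <=
    rnorm (f z0) ^+ 2 + e * rnorm z0 ^+ 2.
  move=> xt; have := H (z0 + x); rewrite [z0 + x]addrC addrK xt => /(_ ts).
  rewrite [x + z0]addrC; apply: le_trans; rewrite lerD2r.
  have := Hd x; rewrite xt => /(_ td).
  have -> : f (z0 + x) - f z0 - x * derive1 f z0 - x ^+ 2 / 2 * derive1 (derive1 f) z0 =
     f (z0 + x) - q x.
    by rewrite /q /a /b /c !opprD !addrA mulrA.
  move=> fq; have qf : rnorm (q x) <= rnorm (f (z0 + x)) + n * t ^+ 2.
    by have := rnormB (f (z0 + x)) (f (z0 + x) - q x); rewrite subKr; lra.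
  have qK : rnorm (q x) <= K.
    apply: le_trans (rnormD _ _) _; rewrite /K lerD//; last first.
      by rewrite rnormM rnormX xt ler_piMl ?rnorm_ge0// exprn_ile1// ltW.
    apply: le_trans (rnormD _ _) _; rewrite lerD2l rnormM xt ler_piMl ?rnorm_ge0//.
  have nt : 0 <= n * t ^+ 2 by rewrite mulr_ge0 ?sqr_ge0 ?ltW.
  have := rnorm_ge0 (q x); have := rnorm_ge0 (f (z0 + x)).
  have -> : 2 * n * t ^+ 2 * K = 2 * (n * t ^+ 2) * K by ring.
  move: qf qK nt; move: (n * t ^+ 2) (rnorm (q x)) (rnorm (f (z0 + x))) => m u v qf qK nt v0 u0.
  have mu : m * u <= m * K by rewrite ler_wpM2l.
  have [um|um] := leP u m; first by nra.
  have : 0 <= (v - (u - m)) * (v + (u - m)) by rewrite mulr_ge0//; lra.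
  by have := sqr_ge0 m; lra.
have k1 := key h nh.
have k2 := key ('i%C * h) _; rewrite rnormM nI mul1r in k2; have {}k2 := k2 nh.
have k3 := key (- h) _; rewrite rnormN in k3; have {}k3 := k3 nh.
have k4 := key (- ('i%C * h)) _; rewrite rnormN rnormM nI mul1r in k4; have {}k4 := k4 nh.
have m1 := four_point_mean a b c h; have m2 := four_point_norm z0 h.
rewrite /= -!/(q _) nh in m1; rewrite nh in m2.
have b2 : 0 <= t ^+ 2 * rnorm b ^+ 2 by rewrite mulr_ge0// sqr_ge0.
have c2 : 0 <= t ^+ 4 * rnorm c ^+ 2 by rewrite mulr_ge0// ?sqr_ge0// exprn_ge0// ltW.
have et : 0 < e * t ^+ 2 by rewrite mulr_gt0// exprn_gt0.
have nK : 2 * n * t ^+ 2 * K <= e * t ^+ 2 / 2.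
  have -> : 2 * n * t ^+ 2 * K = K / (K + 1) * (e * t ^+ 2 / 2).
    by rewrite /n; field; rewrite gt_eqF// ltr_wpDl.
  by rewrite ler_piMl ?divr_ge0 ?(ltW et)// ler_pdivrMr ?ltr_wpDl// mul1r lerDl.
have e4 : e * rnorm (z0 + h) ^+ 2 + e * rnorm (z0 + 'i%C * h) ^+ 2 +
   e * rnorm (z0 - h) ^+ 2 + e * rnorm (z0 - 'i%C * h) ^+ 2 =
   4 * (e * rnorm z0 ^+ 2 + e * t ^+ 2).
  by rewrite -!mulrDr m2; ring.
rewrite -/a in k1 k2 k3 k4; lra.
Qed.

(** |f|^2 + e |z|^2 attains its maximum over the closed disc, and by [no_interior_max] only on the
    circle; then e tends to 0. *)
Lemma maximum_principle f (r r' M : R) : 0 < r -> r < r' ->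
  (forall z, rnorm z < r' -> differentiable f z) ->
  (forall z, rnorm z = r -> rnorm (f z) <= M) ->
  forall z, rnorm z <= r -> rnorm (f z) <= M.
Proof.
move=> r0 rr' df fM z1 z1r.
have M0 : 0 <= M.
  apply: le_trans (rnorm_ge0 _) (fM r%:C _).
  by rewrite rnorm_real gtr0_norm.
suff H (e : R) : 0 < e -> rnorm (f z1) ^+ 2 <= M ^+ 2 + e * r ^+ 2.
  rewrite -(@ler_pXn2r _ 2)// ?nnegrE ?rnorm_ge0//.
  apply/ler_addgt0Pr => e e0; have := H (e / r ^+ 2).
  by rewrite divfK ?gt_eqF ?exprn_gt0//; apply; rewrite divr_gt0// exprn_gt0.
move=> e0.
pose u (z : C) : R := rnorm (f z) * rnorm (f z) + e * (rnorm z * rnorm z).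
have uE z : u z = rnorm (f z) ^+ 2 + e * rnorm z ^+ 2 by rewrite /u -!expr2.
have cu z : rnorm z <= r -> {for z, continuous u}.
  move=> zr; have cf : {for z, continuous f}.
    by apply: differentiable_continuous; apply: df; lra.
  have c1 : rnorm (f x) @[x --> z] --> rnorm (f z).
    by apply: cvg_comp; [exact: cf|exact: rnorm_continuous].
  have c2 : rnorm x @[x --> z] --> rnorm z by exact: rnorm_continuous.
  exact: (cvgD (cvgM c1 c1) (cvgM (cvg_cst e) (cvgM c2 c2))).
have [z0 z0r z0M] := disc_max (ltW r0) cu.
have z1u : rnorm (f z1) ^+ 2 <= u z0.
  by apply: le_trans (z0M z1 z1r); rewrite uE lerDl mulr_ge0 ?sqr_ge0// ltW.
apply: le_trans z1u _.
have [z0lt|] := ltP (rnorm z0) r; last first.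
  move=> rz0; have z0E : rnorm z0 = r by apply/eqP; rewrite eq_le z0r.
  by rewrite uE z0E lerD2r ler_pXn2r ?nnegrE ?rnorm_ge0//; exact: fM.
exfalso; have s0 : 0 < (r - rnorm z0) / 2 by lra.
have sr z : rnorm (z - z0) <= (r - rnorm z0) / 2 -> rnorm z <= r.
  by have := rnormD (z - z0) z0; rewrite subrK; lra.
apply: (no_interior_max s0 e0 (f := f) (z0 := z0)).
  by move=> z /sr zr; apply: df; lra.
by move=> z /sr /z0M; rewrite !uE.
Qed.

Lemma le_inv_forall (x : R) : (forall r : R, 0 < r -> r < 1 -> r * x <= 1) -> x <= 1.
Proof.
move=> H; rewrite leNgt; apply/negP => x1.
pose r := (1 + x) / (2 * x).
have x0 : 0 < x by lra.
have r1 : r < 1 by rewrite /r ltr_pdivrMr; lra.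
have r0 : 0 < r by rewrite divr_gt0//; lra.
have := H r r0 r1; rewrite /r mulrAC ler_pdivrMr; nra.
Qed.

(** On |z| = r the quotient w(z) / z is bounded by 1 / r; the maximum principle extends this to the
    disc and r tends to 1. *)
Lemma schwarz_slope w : w 0 = 0 -> (forall z, rnorm z < 1 -> differentiable w z) ->
  (forall z, rnorm z < 1 -> rnorm (w z) < 1) ->
  forall z, rnorm z < 1 -> rnorm (slope w z) <= 1.
Proof.
move=> w0 dw w1 z z1.
have dk (x : C) : rnorm x < 1 -> differentiable (slope w) x.
  move=> x1; pose s := (1 + rnorm x) / 2.
  apply: (@differentiable_slope _ w s) => //; rewrite /s.
  - by have := rnorm_ge0 x; lra.
  - by move=> y ys; apply: dw; lra.
  - lra.
apply: le_inv_forall => r' r'0 r'1.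
pose r := Num.max r' ((1 + rnorm z) / 2).
have r0 : 0 < r by rewrite lt_max r'0.
have r1 : r < 1 by rewrite gt_max r'1; lra.
have zr : rnorm z <= r by rewrite le_max; apply/orP; right; lra.
have := @maximum_principle (slope w) r 1 r^-1 r0 r1 dk.
move=> /(_ _ z zr)/wrap[x xr|H].
  have x0 : x != 0 by rewrite -rnorm_gt0 xr.
  rewrite /slope (negbTE x0) rnormM rnormV xr ler_piMl ?invr_ge0 ?(ltW r0)//.
  by apply/ltW/w1; rewrite xr.
apply: (@le_trans _ _ (r * rnorm (slope w z))).
  by rewrite ler_wpM2r ?rnorm_ge0// le_max lexx.
by rewrite mulrC -ler_pdivlMr// div1r.
Qed.

Lemma schwarz_derive w : w 0 = 0 -> (forall z, rnorm z < 1 -> differentiable w z) ->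
  (forall z, rnorm z < 1 -> rnorm (w z) < 1) -> rnorm (derive1 w 0 : C) <= 1.
Proof.
move=> w0 dw w1; have := schwarz_slope w0 dw w1 (z := 0).
by rewrite rnorm0 /slope eqxx; apply.
Qed.

Lemma pick_denominator (a z : C) : rnorm a < 1 -> rnorm z < 1 -> 1 - a^*%C * z != 0.
Proof.
move=> a1 z1; have na : rnorm (a^*%C : C) = rnorm a.
  apply/eqP; rewrite -(@eqrXn2 _ 2)// ?rnorm_ge0// !rnorm_sq.
  by case: a {a1} => x y /=; rewrite sqrrN.
rewrite subr_eq0; apply/eqP => E; have := rnormM (a^*%C) z; rewrite -E rnorm1 na.
have := rnorm_ge0 a; have := rnorm_ge0 z; nra.
Qed.

Lemma pick_bound (a z : C) : rnorm a < 1 -> rnorm z < 1 ->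
  rnorm ((z - a) / (1 - a^*%C * z) : C) < 1.
Proof.
move=> a1 z1; have d0 := pick_denominator a1 z1.
have dp : 0 < rnorm (1 - a^*%C * z : C) by rewrite rnorm_gt0.
rewrite rnormM rnormV ltr_pdivrMr// mul1r -(@ltr_pXn2r _ 2)// ?nnegrE ?rnorm_ge0//.
have E : rnorm (1 - a^*%C * z : C) ^+ 2 - rnorm (z - a) ^+ 2 =
    (1 - rnorm a ^+ 2) * (1 - rnorm z ^+ 2).
  by rewrite !rnorm_sq; case: a z {a1 z1 d0 dp} => [a1 a2] [z1 z2] /=; ring.
rewrite -subr_gt0 E mulr_gt0// subr_gt0 expr_lt1// rnorm_ge0//.
Qed.

(** The disc automorphism taking a = k(0) to 0, composed with [k], vanishes at 0 and has derivative
    d / (1 - |a|^2) there, so the Schwarz lemma applies. *)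
Lemma schwarz_pick k (d : C) : (forall z, rnorm z < 1 -> differentiable k z) ->
  (forall z, rnorm z < 1 -> rnorm (k z) < 1) -> cderiv k 0 d ->
  rnorm d <= 1 - rnorm (k 0) ^+ 2.
Proof.
move=> dk k1 k'; pose a := k 0.
have a1 : rnorm a < 1 by apply: k1; rewrite rnorm0.
pose D (z : C) : C := 1 - a^*%C * k z.
pose g (z : C) : C := (k z - a) * (D z)^-1.
have D0 z : rnorm z < 1 -> D z != 0 by move=> /k1; exact: pick_denominator.
have dg z (e : C) : rnorm z < 1 -> cderiv k z e ->
    exists i : C, cderiv g z (e * (D z)^-1 + (k z - a) * i).
  move=> z1 ke; have cD : cderiv D z (0 - (0 * k z + a^*%C * e)).
    by apply: cderivB; [exact: cderiv_cst|apply: cderivM => //; exact: cderiv_cst].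
  have [i Hi] := cderivV cD (D0 z z1); exists i.
  have := cderivM (cderivB ke (cderiv_cst a z)) Hi.
  by rewrite subr0.
have g0 : g 0 = 0 by rewrite /g /a subrr mul0r.
have dg0 : derive1 g 0 = d * (D 0)^-1.
  have [|i] := dg 0 d _ k'; first by rewrite rnorm0.
  by rewrite /a subrr mul0r addr0 => /cderiv_diff[].
have := schwarz_derive g0 _ _; rewrite dg0.
have D00 : D 0 = (1 - rnorm a ^+ 2 : R)%:C.
  rewrite /D -/a rnorm_sq; case: (a) => x y.
  by apply/eqP; rewrite eq_complex /=; apply/andP; split; apply/eqP; ring.
have a2 : 0 < 1 - rnorm a ^+ 2 by rewrite subr_gt0 expr_lt1// rnorm_ge0.
rewrite rnormM rnormV D00 rnorm_real gtr0_norm// => H.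
rewrite -[leRHS]mul1r -ler_pdivrMr//; apply: H => z z1.
  by have [i /cderiv_diff[]] := dg z _ z1 (diff_cderiv (dk z z1)).
exact: pick_bound a1 (k1 z z1).
Qed.

End MaximumPrinciple.

(** * From Fréchet derivatives to one complex variable *)

Section DirectionalDerivatives.
Variable R : realType.
Local Notation C := (R[i]^o).
Implicit Types (X Y : normedModType R[i]).

Lemma linear_scale Y (W : normedModType R[i]) (M : Y -> W) : linear M ->
  forall (a : C) y, M (a *: y) = a *: M y.
Proof.
move=> lM a y; pose M' : {linear Y -> W} := HB.pack M (GRing.isLinear.Build _ _ _ _ _ lM).
exact: (linearZ_LR M').
Qed.

Lemma linear_add Y (W : normedModType R[i]) (M : Y -> W) : linear M ->
  forall x y, M (x + y) = M x + M y.
Proof. by move=> lM x y; have := lM 1 x y; rewrite !scale1r. Qed.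

Lemma cderiv_linear Y (W : normedModType R[i]) (F : C -> Y) (M : Y -> W) (K : R) s d :
  linear M -> (forall y, rnorm (M y) <= K * rnorm y) -> cderiv F s d ->
  cderiv (fun t : C => M (F t)) s (M d).
Proof.
move=> lM MK dF.
have dM : fdiff M (F s) M.
  move=> e e0; exists 1 => // h _.
  by rewrite linear_add// [M (F s) + _]addrC addrK subrr rnorm0 mulr_ge0 ?rnorm_ge0 ?ltW.
have := fdiff_comp (K := rnorm d) _ lM MK dF dM.
move=> /(_ _)/wrap[h|]; first by rewrite rnormZ mulrC.
by rewrite /cderiv; congr fdiff; apply/funext => h; rewrite linear_scale.
Qed.

Lemma geo_complete_multi X Y k : geo_complete Y -> geo_complete (multi_op X Y k).
Proof. by move=> cY; elim: k => [//|k IH]; exact: geo_complete_op. Qed.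

Lemma diag_op_linear X Y k (z : X) : linear (@diag_op R X Y k z).
Proof.
elim: k => [//|k IH] a T S /=.
exact: (IH a (T z) (S z)).
Qed.

Lemma diag_op_bounded X Y k (z : X) (T : multi_op X Y k) :
  rnorm (diag_op z T) <= rnorm z ^+ k * rnorm T.
Proof.
elim: k T => [|k IH] T /=; first by rewrite expr0 mul1r.
apply: le_trans (IH _) _; rewrite exprSr -mulrA ler_wpM2l ?exprn_ge0 ?rnorm_ge0//.
by rewrite mulrC; exact: rnorm_op.
Qed.

Lemma differentiable_frechetn X Y (F : X -> Y) k : geo_complete Y ->
  (forall z, rnorm z < 1 -> differentiable F z) ->
  forall z, rnorm z < 1 -> differentiable (frechetn k F) z.
Proof.
move=> cY dF; elim: k => [//|k IH] z z1.
apply: (@differentiable_frechet _ _ _ _ _ ((1 - rnorm z) / 2)).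
- exact: geo_complete_multi.
- by rewrite divr_gt0// subr_gt0.
- by move=> y yz; apply: IH; have := rnormD (y - z) z; rewrite subrK; lra.
Qed.

Variables (X : normedModType R[i]) (cX : geo_complete X).

(** Differentiating t -> l (D^kG(t x)(z^k)) puts x into the new slot of D^(k+1)G; replacing that x
    by z = r x costs the factor r. *)
Lemma diag_op_derive (G : X -> X) (l : bounded_op X C) (x z : X) (r : R) k (s : C) :
  (forall z, rnorm z < 1 -> differentiable G z) -> z = r%:C *: x ->
  rnorm (s *: x) < 1 ->
  exists2 d : C, cderiv (fun t : C => l (diag_op z (frechetn k G (t *: x)))) s d &
    l (diag_op z (frechetn k.+1 G (s *: x))) = r%:C * d.
Proof.
move=> dG zE sx; have dk := differentiable_frechetn k cX dG sx.
have dl := @fdiff_line _ _ _ (frechetn k G) 0 x s _ (@bounded_op_linear _ _ _ (frechet (frechetn k G) (s *: x))).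
rewrite add0r in dl; have {}dl := dl (frechet_fdiff dk).
have lM : linear (fun T : multi_op X X k => l (diag_op z T)).
  by move=> a T S; rewrite diag_op_linear bounded_op_linear.
have MK (T : multi_op X X k) : rnorm (l (diag_op z T)) <= rnorm l * rnorm z ^+ k * rnorm T.
  apply: le_trans (rnorm_op _ _) _; rewrite -mulrA ler_wpM2l ?rnorm_ge0//.
  exact: diag_op_bounded.
have H := cderiv_linear lM MK dl.
exists (l (diag_op z (frechet (frechetn k G) (s *: x) x))).
  move: H; congr cderiv; apply/funext => t; by rewrite add0r.
have MZ (T : multi_op X X k) : l (diag_op z (r%:C *: T)) = r%:C * l (diag_op z T).
  exact: (linear_scale lM).
by rewrite /= [in X in diag_op z X]zE linearZ_LR /= MZ.
Qed.

Lemma cderiv_near (Y : normedModType R[i]) (f g : C -> Y) s d : rnorm s < 1 ->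
  (forall t : C, rnorm t < 1 -> f t = g t) -> cderiv f s d -> cderiv g s d.
Proof.
move=> s1 fg; have s0 : 0 < (1 - rnorm s) / 2 by lra.
apply: (fdiff_local s0) => y ys; apply: fg.
by have := rnormD (y - s) s; rewrite subrK; lra.
Qed.

Lemma differentiable_derive1_disc (f : C -> C) :
  (forall t, rnorm t < 1 -> differentiable f t) ->
  forall t, rnorm t < 1 -> differentiable (derive1 f) t.
Proof.
move=> df t t1; apply: (@differentiable_derive1 _ _ _ ((1 - rnorm t) / 2)); first lra.
by move=> y yt; apply: df; have := rnormD (y - t) t; rewrite subrK; lra.
Qed.

(** [phi k] stands for t -> l (D^kG(t x)(z^k)). It equals r^k times the k-th derivative of t f(t),
    and at 0 the second and third derivatives of t f(t) are 2 f'(0) and 3 f''(0). *)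
Lemma derivative_chain (f f1 f2 f3 : C -> C) (phi : nat -> C -> C) (r : C) :
  (forall t, rnorm t < 1 -> cderiv f t (f1 t)) ->
  (forall t, rnorm t < 1 -> cderiv f1 t (f2 t)) ->
  (forall t, rnorm t < 1 -> cderiv f2 t (f3 t)) ->
  (forall t, phi 0%N t = f t * t) ->
  (forall k s, rnorm s < 1 -> exists2 d : C, cderiv (phi k) s d & phi k.+1 s = r * d) ->
  phi 2%N 0 = r * (r * (2 * f1 0)) /\ phi 3%N 0 = r * (r * (r * (3 * f2 0))).
Proof.
move=> H1 H2 H3 phi0 step.
have step' k (u : C -> C) s d : (forall t, rnorm t < 1 -> phi k t = u t) ->
    rnorm s < 1 -> cderiv u s d -> phi k.+1 s = r * d.
  move=> E s1 du; have [d' Hd' ->] := step k s s1; congr (_ * _).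
  by apply: cderiv_unique du; apply: cderiv_near Hd'.
have phi1 t : rnorm t < 1 -> phi 1%N t = r * (f1 t * t + f t).
  move=> t1; apply: (step' 0%N (fun t => f t * t)) => //.
  by have := cderivM (H1 t t1) (cderiv_id t); rewrite mulr1.
have phi2 t : rnorm t < 1 -> phi 2%N t = r * (r * (f2 t * t + 2 * f1 t)).
  move=> t1; apply: (step' 1%N _ _ _ phi1) => //.
  have c1 := cderivM (H2 t t1) (cderiv_id t).
  have -> : r * (f2 t * t + 2 * f1 t) =
     0 * (f1 t * t + f t) + r * (f2 t * t + f1 t * 1 + f1 t) by ring.
  exact: cderivM (cderiv_cst r t) (cderivD c1 (H1 t t1)).
have o1 : rnorm (0 : C) < 1 by rewrite rnorm0.
split; first by rewrite phi2// mulr0 add0r.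
apply: (step' 2%N _ _ _ phi2) => //.
have c1 := cderivM (H3 0 o1) (cderiv_id 0).
have c2 := cderivM (cderiv_cst (2 : C) 0) (H2 0 o1).
have -> : r * (r * (3 * f2 0)) = 0 * (r * (f2 0 * 0 + 2 * f1 0)) + r * (0 * (f2 0 * 0 + 2 * f1 0) +
   r * (f3 0 * 0 + f2 0 * 1 + (0 * f1 0 + 2 * f2 0))) by ring.
exact: cderivM (cderiv_cst r 0) (cderivM (cderiv_cst r 0) (cderivD c1 c2)).
Qed.

Lemma diff_radial (g : X -> C) (y : X) : differentiable g y ->
  differentiable (fun z => g z *: z) y /\
  forall v, 'd (fun z => g z *: z) y v = 'd g y v *: y + g y *: v.
Proof.
move=> dg; have dgy := frechet_fdiff dg.
have di : fdiff (fun y : X => y) y (fun h => h).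
  move=> e e0; exists 1 => // h _; rewrite [y + h]addrC addrK subrr rnorm0.
  by rewrite mulr_ge0 ?rnorm_ge0 ?ltW.
have := fdiffZ (CL := 1) (fun h => rnorm_op (frechet g y) h) _ dgy di.
move=> /(_ _)/wrap[h|H]; first by rewrite mul1r.
have [|h|dG dGE] := fdiff_diff (K := rnorm (frechet g y) * rnorm y + rnorm (g y)) _ _ H.
- move=> a u v; rewrite bounded_op_linear scalerDl !scalerDr !scalerA.
  by rewrite [g y * a]mulrC addrACA.
- apply: le_trans (rnormD _ _) _; rewrite !rnormZ mulrDl lerD2r mulrAC.
  by rewrite ler_wpM2r ?rnorm_ge0// rnorm_op.
by split=> // v; rewrite dGE frechetE.
Qed.

(** As l x = 1, l (G(t x)) = t f(t), so [derivative_chain] applies; dividing 2 r^2 f'(0) and 3 r^3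
    f''(0) by k! r^k leaves the two values. *)
Lemma radial_coefs (g : X -> C) (z : X) (l : bounded_op X C) :
  (forall y, rnorm y < 1 -> differentiable g y) -> z != 0 ->
  l z = `|z| ->
  let f (t : C) : C := g (t *: ((rnorm z)^-1%:C *: z)) in
  [/\ forall t, rnorm t < 1 -> differentiable f t,
      coef (fun z => g z *: z) z l 2 = derive1 f 0 &
      coef (fun z => g z *: z) z l 3 = derive1 (derive1 f) 0 / 2].
Proof.
move=> dg z0 lz f.
have r0 : 0 < rnorm z by rewrite rnorm_gt0.
pose r : C := (rnorm z)%:C; pose x := (rnorm z)^-1%:C *: z.
have rn0 : r != 0 by rewrite -rnorm_gt0 rnorm_real normr_gt0 gt_eqF.
have zE : z = (rnorm z)%:C *: x.
  by rewrite scalerA -rmorphM /= mulfV ?gt_eqF// scale1r.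
have nx : rnorm x = 1.
  by rewrite rnormZ rnorm_real gtr0_norm ?invr_gt0// mulVf// gt_eqF.
have lx : l x = 1.
  rewrite linearZ_LR /= lz -rnormE -[_ *: _]/(_ * _) -rmorphM /= mulVf ?gt_eqF//.
have tx (t : C) : rnorm t < 1 -> rnorm (t *: x) < 1 by rewrite rnormZ nx mulr1.
have df t : rnorm t < 1 -> differentiable f t.
  move=> /tx/dg/frechet_fdiff dgx.
  have := @fdiff_line _ _ _ g 0 x t _ (@bounded_op_linear _ _ _ (frechet g (t *: x))).
  rewrite add0r => /(_ dgx) H.
  suff : cderiv f t (frechet g (t *: x) x) by move=> /cderiv_diff[].
  by move: H; congr cderiv; apply/funext => s; rewrite add0r.
pose G z := g z *: z.
have dG y : rnorm y < 1 -> differentiable G y.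
  by move=> /dg/diff_radial[].
have df1 := differentiable_derive1_disc df.
have df2 := differentiable_derive1_disc df1.
pose phi k (t : C) : C := l (diag_op z (frechetn k G (t *: x))).
have step k s : rnorm s < 1 -> exists2 d : C, cderiv (phi k) s d & phi k.+1 s = r * d.
  by move=> s1; exact: (diag_op_derive l k dG zE (tx s s1)).
have phi0 t : phi 0%N t = f t * t.
  have lZ (a : C) y : l (a *: y) = a * l y := linear_scale (@bounded_op_linear _ _ _ l) a y.
  by rewrite -[LHS]/(l (f t *: (t *: x))) 2!lZ lx mulr1.
have [phi2 phi3] := derivative_chain (fun t t1 => diff_cderiv (df t t1))
  (fun t t1 => diff_cderiv (df1 t t1)) (fun t t1 => diff_cderiv (df2 t t1)) phi0 step.
have phiE k : phi k 0 = l (diag_op z (frechetn k G 0)) by rewrite /phi scale0r.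
have zr : `|z| = r by rewrite -rnormE.
have E2 (u v : R[i]) : v != 0 -> v * (v * (2 * u)) / (2`!%:R * v ^+ 2) = u.
  by move=> v0; rewrite (_ : 2`!%:R = 2)//; field.
have E3 (u v : R[i]) : v != 0 -> v * (v * (v * (3 * u))) / (3`!%:R * v ^+ 3) = u / 2.
  by move=> v0; rewrite (_ : 3`!%:R = 6)//; field.
split=> //; rewrite /coef -/G zr -phiE; first by rewrite phi2; exact: E2.
by rewrite phi3; exact: E3.
Qed.

End DirectionalDerivatives.

(** * Schwarz functions, subordination and the coefficient estimate *)

Section CoefficientBound.
Variable R : realType.
Local Notation C := (R[i]^o).
Implicit Types (f w : C -> C).

(** Schwarz-Pick for w(z) / z, whose value and derivative at 0 are the two coefficients. Its modulus
    may reach 1, as for rotations, so it is first multiplied by p < 1; the choice p = (1 + r) / 2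
    gives p^2 >= r. *)
Lemma schwarz_coefs w : w 0 = 0 -> (forall z, rnorm z < 1 -> differentiable w z) ->
  (forall z, rnorm z < 1 -> rnorm (w z) < 1) ->
  rnorm (derive1 w 0 : C) <= 1 /\
  rnorm (derive1 (derive1 w) 0 / 2 : C) <= 1 - rnorm (derive1 w 0 : C) ^+ 2.
Proof.
move=> w0 dw w1; split; first exact: schwarz_derive.
set c1 : C := derive1 w 0; set c2 : C := derive1 (derive1 w) 0 / 2.
have dk (x : C) : rnorm x < 1 -> differentiable (slope w) x.
  move=> x1; apply: (@differentiable_slope _ w ((1 + rnorm x) / 2)) => //.
  - by have := rnorm_ge0 x; lra.
  - by move=> y ys; apply: dw; lra.
  - lra.
have k1 := schwarz_slope w0 dw w1.
have k0 : slope w 0 = c1 by rewrite /slope eqxx.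
have half0 : 0 < (1 / 2 : R) by lra.
have kd : cderiv (slope w) 0 c2.
  by apply: cderiv_slope0 half0 w0 _ => z zs; apply: dw; lra.
clearbody c1 c2; suff : rnorm c2 + rnorm c1 ^+ 2 <= 1 by lra.
apply: le_inv_forall => r r0 r1; pose p := (1 + r) / 2.
have p0 : 0 < p by rewrite /p; lra.
have p1 : p < 1 by rewrite /p; lra.
have H := @schwarz_pick R (fun z => p%:C * slope w z) (0 * slope w 0 + p%:C * c2).
have np : rnorm (p%:C : C) = p by rewrite rnorm_real gtr0_norm.
have {}H : rnorm (0 * slope w 0 + p%:C * c2 : C) <= 1 - rnorm (p%:C * slope w 0 : C) ^+ 2.
  apply: H.
  - move=> z z1; have [] // := cderiv_diff (cderivM (cderiv_cst (p%:C : C) z) (diff_cderiv (dk z z1))).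
  - move=> z /k1 kz; rewrite rnormM np.
    by apply: le_lt_trans p1; rewrite ler_piMr// ltW.
  exact: cderivM (cderiv_cst _ _) kd.
move: H; rewrite mul0r add0r !rnormM np k0 exprMn => H.
have p2 : r <= p ^+ 2.
  rewrite -subr_ge0 (_ : p ^+ 2 - r = ((1 - r) / 2) ^+ 2) ?sqr_ge0//.
  by rewrite /p; field.
have s0 : 0 <= rnorm c2 + rnorm c1 ^+ 2 by rewrite addr_ge0 ?rnorm_ge0 ?sqr_ge0.
apply: le_trans (ler_wpM2r s0 p2) _.
have : p ^+ 2 * rnorm c2 <= p * rnorm c2.
  by rewrite ler_wpM2r ?rnorm_ge0// expr2 ler_piMl// ltW.
lra.
Qed.

(** Two differentiations of f + z f' = f (Phi o w) at 0, freed of denominators. The general [w]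
    serves both the Schwarz function of the upper bound and w(t) = i t of the extremal case. *)
Lemma second_order_chain (f f1 f2 f3 w w1 w2 Phi P1 P2 : C -> C) :
  (forall z, rnorm z < 1 -> cderiv f z (f1 z)) ->
  (forall z, rnorm z < 1 -> cderiv f1 z (f2 z)) ->
  (forall z, rnorm z < 1 -> cderiv f2 z (f3 z)) ->
  (forall z, rnorm z < 1 -> cderiv w z (w1 z)) ->
  (forall z, rnorm z < 1 -> cderiv w1 z (w2 z)) ->
  (forall z, rnorm z < 1 -> cderiv Phi z (P1 z)) ->
  (forall z, rnorm z < 1 -> cderiv P1 z (P2 z)) ->
  (forall z, rnorm z < 1 -> rnorm (w z) < 1) ->
  f 0 = 1 -> w 0 = 0 -> Phi 0 = 1 ->
  (forall z, rnorm z < 1 -> f z + z * f1 z = f z * Phi (w z)) ->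
  f1 0 = P1 0 * w1 0 /\
  2 * f2 0 = 2 * f1 0 * (P1 0 * w1 0) + w2 0 * P1 0 + w1 0 ^+ 2 * P2 0.
Proof.
move=> H1 H2 H3 W1 W2 Q1 Q2 w1b f0 w0 Phi0 id0.
have QW z : rnorm z < 1 -> cderiv (fun z => Phi (w z)) z (w1 z * P1 (w z)).
  by move=> z1; apply: cderiv_comp (W1 z z1) (Q1 _ (w1b z z1)).
have QW2 z : rnorm z < 1 -> cderiv (fun z => P1 (w z)) z (w1 z * P2 (w z)).
  by move=> z1; apply: cderiv_comp (W1 z z1) (Q2 _ (w1b z z1)).
have id1 z : rnorm z < 1 ->
    f1 z + (1 * f1 z + z * f2 z) = f1 z * Phi (w z) + f z * (w1 z * P1 (w z)).
  move=> z1; apply: (@cderiv_unique _ _ (fun z => f z * Phi (w z)) z).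
    apply: (cderiv_near z1 id0).
    exact: cderivD (H1 z z1) (cderivM (cderiv_id z) (H2 z z1)).
  exact: cderivM (H1 z z1) (QW z z1).
have o1 : rnorm (0 : C) < 1 by rewrite rnorm0.
have e1 := id1 0 o1; rewrite w0 Phi0 f0 in e1.
have {}e1 : f1 0 = P1 0 * w1 0.
  have -> : f1 0 = f1 0 + (1 * f1 0 + 0 * f2 0) - f1 0 * 1 by ring.
  by rewrite e1; ring.
split=> //.
have e2 : f2 0 + ((0 * f1 0 + 1 * f2 0) + (1 * f2 0 + 0 * f3 0)) =
   (f2 0 * Phi (w 0) + f1 0 * (w1 0 * P1 (w 0))) +
   (f1 0 * (w1 0 * P1 (w 0)) + f 0 * (w2 0 * P1 (w 0) + w1 0 * (w1 0 * P2 (w 0)))).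
  apply: (@cderiv_unique _ _ (fun z => f1 z * Phi (w z) + f z * (w1 z * P1 (w z))) 0).
    apply: (cderiv_near o1 id1).
    apply: cderivD (H2 0 o1) (cderivD _ _); first exact: cderivM (cderiv_cst _ _) (H2 0 o1).
    exact: cderivM (cderiv_id 0) (H3 0 o1).
  apply: cderivD; first exact: cderivM (H2 0 o1) (QW 0 o1).
  exact: cderivM (H1 0 o1) (cderivM (W2 0 o1) (QW2 0 o1)).
rewrite w0 Phi0 f0 in e2.
have -> : 2 * f2 0 = f2 0 + ((0 * f1 0 + 1 * f2 0) + (1 * f2 0 + 0 * f3 0)) - f2 0 * 1 by ring.
by rewrite e2; ring.
Qed.

(** The Schwarz function is w = h o q with q(z) = 1 + z f'(z) / f(z) and [h] the holomorphic inverse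
    of Phi on its image. The point z = 0, excluded in the hypothesis, is covered by q(0) = 1 =
    Phi(0). *)
Lemma subordination_coefs (Phi f : C -> C) :
  biholomorphic_onto_image (@unit_ball R C) Phi -> Phi 0 = 1 -> f 0 = 1 ->
  (forall z, rnorm z < 1 -> differentiable f z) ->
  (forall z : C, rnorm z < 1 -> z != 0 -> f z != 0 /\
     (Phi @` @unit_ball R C) (1 + z * derive1 f z / f z)) ->
  exists c1 c2 : C, [/\ rnorm c1 <= 1, rnorm c2 <= 1 - rnorm c1 ^+ 2,
    derive1 f 0 = derive1 Phi 0 * c1 &
    2 * derive1 (derive1 f) 0 = 2 * derive1 f 0 * (derive1 Phi 0 * c1) +
      2 * c2 * derive1 Phi 0 + c1 ^+ 2 * derive1 (derive1 Phi) 0].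
Proof.
move=> [hPhi _ [h [hh hK]]] Phi0 f0 df fPhi.
have dPhi z : rnorm z < 1 -> differentiable Phi z by move=> /unit_ballE/hPhi.
have o1 : rnorm (0 : C) < 1 by rewrite rnorm0.
pose q (z : C) : C := 1 + z * derive1 f z / f z.
have q0 : q 0 = 1 by rewrite /q !mul0r addr0.
have fq z : rnorm z < 1 -> f z != 0 /\ (Phi @` @unit_ball R C) (q z).
  move=> z1; have [->|/fPhi] := eqVneq z 0; last exact.
  rewrite f0 q0 oner_eq0; split=> //; exists 0 => //; exact/unit_ballE.
have df1 := differentiable_derive1_disc df.
have df2 := differentiable_derive1_disc df1.
pose w (z : C) : C := h (q z).
have wq z : rnorm z < 1 -> rnorm (w z) < 1 /\ Phi (w z) = q z.
  by move=> /fq[_ [y /[dup] /unit_ballE y1 /hK yK qE]]; rewrite /w -qE yK.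
have w0 : w 0 = 0 by rewrite /w q0 -Phi0 hK//; exact/unit_ballE.
have dw z : rnorm z < 1 -> differentiable w z.
  move=> z1; have [fz0 qz] := fq z z1.
  have [i Hi] := cderivV (diff_cderiv (df z z1)) fz0.
  have cq := cderivD (cderiv_cst (1 : C) z)
    (cderivM (cderivM (cderiv_id z) (diff_cderiv (df1 z z1))) Hi).
  by have [] := cderiv_diff (cderiv_comp cq (diff_cderiv (hh _ qz))).
have [c1b c2b] := schwarz_coefs w0 dw (fun z z1 => (wq z z1).1).
exists (derive1 w 0), (derive1 (derive1 w) 0 / 2).
have dw1 := differentiable_derive1_disc dw.
have dPhi1 := differentiable_derive1_disc dPhi.
have id0 z : rnorm z < 1 -> f z + z * derive1 f z = f z * Phi (w z).
  move=> z1; have [fz0 _] := fq z z1; rewrite (wq z z1).2 /q mulrDr mulr1.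
  by congr (_ + _); rewrite [RHS]mulrC divfK.
have [e1 e2] := second_order_chain (fun z z1 => diff_cderiv (df z z1))
  (fun z z1 => diff_cderiv (df1 z z1)) (fun z z1 => diff_cderiv (df2 z z1))
  (fun z z1 => diff_cderiv (dw z z1)) (fun z z1 => diff_cderiv (dw1 z z1))
  (fun z z1 => diff_cderiv (dPhi z z1)) (fun z z1 => diff_cderiv (dPhi1 z z1))
  (fun z z1 => (wq z z1).1) f0 w0 Phi0 id0.
have E (x : C) : 2 * (x / 2) = x by rewrite mulrC divfK// pnatr_eq0.
by rewrite (E (derive1 (derive1 w) 0)); exact: And4 c1b c2b e1 e2.
Qed.

(* Here b1 = Phi'(0) and b2 = Phi''(0)/2; the hypotheses on them make
   |a3| <= (b2 + b1^2) / 2 and |2 a2^2 - a3| <= (3 b1^2 - b2) / 2. *)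
Lemma coefficient_estimate (b1 b2 : R) (c1 c2 a2 a3 : C) : 0 < b1 ->
  b1 <= b2 + b1 ^+ 2 -> b1 <= 3 * b1 ^+ 2 - b2 ->
  rnorm c1 <= 1 -> rnorm c2 <= 1 - rnorm c1 ^+ 2 ->
  a2 = b1%:C * c1 ->
  4 * a3 = 2 * a2 ^+ 2 + 2 * b1%:C * c2 + 2 * b2%:C * c1 ^+ 2 ->
  rnorm (2 * a2 ^+ 2 * a3 - a3 ^+ 2 - 2 * a2 ^+ 2 + 1 : C) <=
  1 + 2 * b1 ^+ 2 + (3 * b1 ^+ 2 - b2) * (b2 + b1 ^+ 2) / 4.
Proof.
move=> b10 h1 h2 c11 c21 a2E a3E.
have n2 : rnorm (2 : C) = 2.
  have -> : (2 : R[i]) = (2%:R : R)%:C by rewrite rmorph_nat.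
  by rewrite rnorm_real normr_nat.
have n4 : rnorm (4 : C) = 4.
  have -> : (4 : R[i]) = (4%:R : R)%:C by rewrite rmorph_nat.
  by rewrite rnorm_real normr_nat.
have nb (r : R) (x : C) : 0 <= r -> rnorm (r%:C * x : C) = r * rnorm x.
  by move=> r0; rewrite rnormM rnorm_real ger0_norm.
have na2 : rnorm a2 <= b1 by rewrite a2E nb ?ler_piMr// ltW.
have c1s : rnorm c1 ^+ 2 <= 1 by rewrite exprn_ile1// rnorm_ge0.
(* Up to the factor 2 this is b1 c2 + (b2 + b1^2) c1^2. Since |c2| <= 1 - |c1|^2 and b1 <= b2 +
   b1^2, its modulus is at most a convex combination of b1 and b2 + b1^2, hence at most the
   latter. *)
have na3 : rnorm a3 <= (b2 + b1 ^+ 2) / 2.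
  have E : 4 * a3 = 2 * (b1%:C * c2 + (b2 + b1 ^+ 2)%:C * c1 ^+ 2).
    by rewrite a3E a2E rmorphD rmorphXn /=; ring.
  have := rnormM 4 a3; rewrite E rnormM n2 n4 => En.
  have := rnormD (b1%:C * c2 : C) ((b2 + b1 ^+ 2)%:C * c1 ^+ 2).
  rewrite (nb b1) ?(ltW b10)// nb ?rnormX; last lra.
  have : b1 * rnorm c2 <= b1 * (1 - rnorm c1 ^+ 2) by rewrite ler_wpM2l// ltW.
  have : (1 - rnorm c1 ^+ 2) * b1 <= (1 - rnorm c1 ^+ 2) * (b2 + b1 ^+ 2).
    by rewrite ler_wpM2l// subr_ge0.
  lra.
have na : rnorm (2 * a2 ^+ 2 - a3 : C) <= (3 * b1 ^+ 2 - b2) / 2.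
  have E : 4 * (2 * a2 ^+ 2 - a3) = 2 * ((3 * b1 ^+ 2 - b2)%:C * c1 ^+ 2 - b1%:C * c2).
    rewrite mulrBr a3E a2E rmorphB rmorphM /= rmorphXn /= rmorph_nat; ring.
  have := rnormM 4 (2 * a2 ^+ 2 - a3); rewrite E rnormM n2 n4 => En.
  have := rnormB ((3 * b1 ^+ 2 - b2)%:C * c1 ^+ 2 : C) (b1%:C * c2).
  rewrite (nb b1) ?(ltW b10)// nb ?rnormX; last lra.
  have : b1 * rnorm c2 <= b1 * (1 - rnorm c1 ^+ 2) by rewrite ler_wpM2l// ltW.
  have : (1 - rnorm c1 ^+ 2) * b1 <= (1 - rnorm c1 ^+ 2) * (3 * b1 ^+ 2 - b2).
    by rewrite ler_wpM2l// subr_ge0.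
  lra.
have -> : 2 * a2 ^+ 2 * a3 - a3 ^+ 2 - 2 * a2 ^+ 2 + 1 = 1 - 2 * a2 ^+ 2 + (2 * a2 ^+ 2 - a3) * a3.
  by ring.
apply: le_trans (rnormD _ _) _.
have -> : (3 * b1 ^+ 2 - b2) * (b2 + b1 ^+ 2) / 4 = (3 * b1 ^+ 2 - b2) / 2 * ((b2 + b1 ^+ 2) / 2).
  by field.
apply: lerD; last by rewrite rnormM ler_pM// rnorm_ge0.
apply: le_trans (rnormB _ _) _; rewrite rnorm1 (rnormM 2) n2 rnormX lerD2l ler_pM2l//.
by rewrite ler_pXn2r// ?nnegrE ?rnorm_ge0// ltW.
Qed.

(** G'(y) y = h y with h = g(y) + g'(y) y, so the inverse derivative sends G(y) to a vector p(y)
    with h p(y) = g(y) y. The quotient in the definition of the class is therefore h / g(y) = 1 + t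
    f'(t) / f(t). *)
Lemma admissible_disc (X : normedModType R[i]) (Phi : C -> C) (g : X -> C) (z : X)
    (l : bounded_op X C) :
  (forall y, rnorm y < 1 -> differentiable g y) -> Phi 0 = 1 -> g 0 = 1 ->
  inv_deriv_in_class_M Phi (fun z : X => g z *: z) ->
  z != 0 -> support_functionals z l ->
  let f (t : C) : C := g (t *: ((rnorm z)^-1%:C *: z)) in
  forall t : C, rnorm t < 1 -> t != 0 -> f t != 0 /\
     (Phi @` @unit_ball R C) (1 + t * derive1 f t / f t).
Proof.
move=> dg Phi0 g0 [A [AK [_ _ _ HA]]] z0 [lz nl] f t t1 t0.
have r0 : 0 < rnorm z by rewrite rnorm_gt0.
pose x := (rnorm z)^-1%:C *: z.
have nx : rnorm x = 1.
  by rewrite rnormZ rnorm_real gtr0_norm ?invr_gt0// mulVf// gt_eqF.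
have lx : l x = 1.
  rewrite linearZ_LR /= lz -rnormE -[_ *: _]/(_ * _) -rmorphM /= mulVf ?gt_eqF//.
pose y := t *: x.
have ny : rnorm y = rnorm t by rewrite rnormZ nx mulr1.
have y1 : rnorm y < 1 by rewrite ny.
have y0 : y != 0 by rewrite -rnorm_gt0 ny rnorm_gt0.
have yb : unit_ball y by exact/unit_ballE.
have ly : l y = t by rewrite linearZ_LR /= lx [_ *: _]mulr1.
(* [l] takes the value t at y = t x; the unimodular factor [u] turns it into a support functional at
   y. *)
pose u : C := `|t| / t.
have nu : `|u| = 1 by rewrite normrM normfV normr_id mulfV// normr_eq0.
pose l' : bounded_op X C := u *: l.
have ut : u * t = `|t| by rewrite /u divfK.
have l'E v : l' v = u * l v by [].
have l'y : l' y = `|y| by rewrite l'E ly ut -rnormE -ny rnormE.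
have sl' : support_functionals y l'.
  by split=> //; rewrite normrZ nu nl mulr1.
have [dG dGE] := diff_radial (dg y y1).
have [AL _] := AK y yb.
have [lp [w wU wE]] := HA y l' yb y0 sl'.
pose h : C := 'd g y y + g y.
have Ay : h *: A y y = y.
  by have := AL y; rewrite dGE -scalerDl (linear_scale (@bounded_op_linear _ _ _ (A y))).
have pE : A y (g y *: y) = g y *: A y y := linear_scale (@bounded_op_linear _ _ _ (A y)) _ _.
have l'Z (a : C) v : l' (a *: v) = a * l' v := linear_scale (@bounded_op_linear _ _ _ l') _ _.
move: lp wE; rewrite pE l'Z mulf_eq0 negb_or => /andP[gy0 lA0] wE.
split; first exact: gy0.
exists w => //; rewrite wE -l'y -{1}Ay l'Z.
have df : cderiv f t ('d g y x).
  have := @fdiff_line _ _ _ g 0 x t _ (@bounded_op_linear _ _ _ (frechet g y)).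
  rewrite add0r => /(_ (frechet_fdiff (dg y y1))); rewrite frechetE; last exact: dg.
  by congr cderiv; apply/funext => s; rewrite add0r.
have [_ ->] := cderiv_diff df.
have dZ : 'd g y y = t * 'd g y x.
  rewrite -(frechetE (dg y y1)); exact: (linear_scale (@bounded_op_linear _ _ _ (frechet g y)) t x).
have -> : h = g y + t * 'd g y x by rewrite /h dZ addrC.
have -> : f t = g y by [].
move: ('d g y x : C) (g y : C) (l' (A y y) : C) gy0 lA0 => D c q c0 q0.
by field; rewrite c0 q0.
Qed.

End CoefficientBound.

(** * Real form of the hypotheses and the upper bound *)

Section UpperBound.
Variable R : realType.
Local Notation C := (R[i]^o).

(** Positivity of d1 and reality of d2 allow the hypotheses and the bound to be moved from the order
    on R[i] to R, with b1 = d1 and b2 = d2 / 2. *)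
Lemma bound_real (d1 d2 : R[i]) : 0 < d1 -> d2 \is Num.real ->
  2 * d1 - 2 * d1 ^+ 2 <= d2 -> d2 <= 6 * d1 ^+ 2 - 2 * d1 ->
  exists b1 b2 : R, [/\ 0 < b1, d1 = b1%:C, d2 = 2 * b2%:C,
    b1 <= b2 + b1 ^+ 2 /\ b1 <= 3 * b1 ^+ 2 - b2 &
    1 + 2 * d1 ^+ 2 + d1 ^+ 2 / 4 * (3 * d1 - d2 / (2 * d1)) * (d2 / (2 * d1) + d1) =
    (1 + 2 * b1 ^+ 2 + (3 * b1 ^+ 2 - b2) * (b2 + b1 ^+ 2) / 4)%:C].
Proof.
move=> /cpos_real[b1 b10 ->] d2r.
have E n : (n%:R : R[i]) = (n%:R : R)%:C by rewrite rmorph_nat.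
have -> : d2 = 2 * (complex.Re d2 / 2)%:C.
  rewrite E -rmorphM /= mulrC divfK ?pnatr_eq0//.
  by rewrite RRe_real.
move: (complex.Re d2 / 2) => b2 h1 h2.
exists b1, b2; split=> //.
  move: h1 h2; rewrite !E -!rmorphXn -!rmorphM -!rmorphB /= !lecR.
  by split; lra.
have b0 : b1%:C != 0 by rewrite -(rmorph0 (real_complex R)) (inj_eq (@complexI R)) gt_eqF.
rewrite !(rmorphD, rmorphB, rmorphM, rmorphXn, fmorphV, rmorph_nat, rmorph1) /=.
by field.
Qed.

Lemma upper_bound (X : normedModType R[i]) (cX : geo_complete X) (Phi : C -> C)
    (g : X -> C) (z : X) (l : bounded_op X C) (b1 b2 : R) :
  biholomorphic_onto_image (@unit_ball R C) Phi -> Phi 0 = 1 ->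
  0 < b1 -> b1 <= b2 + b1 ^+ 2 -> b1 <= 3 * b1 ^+ 2 - b2 ->
  derive1 Phi 0 = b1%:C -> derive1 (derive1 Phi) 0 = 2 * b2%:C ->
  (forall y, rnorm y < 1 -> differentiable g y) -> g 0 = 1 ->
  inv_deriv_in_class_M Phi (fun z : X => g z *: z) ->
  z != 0 -> support_functionals z l ->
  forall a2 a3, a2 = coef (fun z : X => g z *: z) z l 2 ->
  a3 = coef (fun z : X => g z *: z) z l 3 ->
  `|2 * a2 ^+ 2 * a3 - a3 ^+ 2 - 2 * a2 ^+ 2 + 1| <=
  (1 + 2 * b1 ^+ 2 + (3 * b1 ^+ 2 - b2) * (b2 + b1 ^+ 2) / 4)%:C.
Proof.
move=> bP P0 b10 h1 h2 d1E d2E dg g0 Hg z0 sl a2 a3.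
move=> a2F a3F; have [df a2E a3E] := radial_coefs cX dg z0 sl.1.
rewrite -a2F in a2E; rewrite -a3F in a3E.
have ad := admissible_disc dg P0 g0 Hg z0 sl.
have [|c1 [c2 [n1 n2 e1 e2]]] := subordination_coefs bP P0 _ df ad.
  by rewrite scale0r g0.
have key (D1 D2 P1 P2 : C) : P1 = b1%:C -> P2 = 2 * b2%:C -> a2 = D1 -> a3 = D2 / 2 ->
    D1 = P1 * c1 -> 2 * D2 = 2 * D1 * (P1 * c1) + 2 * c2 * P1 + c1 ^+ 2 * P2 ->
    rnorm (2 * a2 ^+ 2 * a3 - a3 ^+ 2 - 2 * a2 ^+ 2 + 1 : C) <=
    1 + 2 * b1 ^+ 2 + (3 * b1 ^+ 2 - b2) * (b2 + b1 ^+ 2) / 4.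
  move=> -> -> <- a3D e1' e2'.
  apply: (coefficient_estimate b10 h1 h2 n1 n2 e1').
  transitivity (2 * D2); first by rewrite a3D; field.
  by rewrite e2' -e1'; ring.
rewrite -[leLHS](@rnormE R C) lecR; exact: (key _ _ _ _ d1E d2E a2E a3E e1 e2).
Qed.

End UpperBound.

(** * The Hahn-Banach theorem for a single vector *)

Section NormingFunctional.
Variables (R : realType) (X : normedModType R[i]).
Local Notation C := (R[i]^o).
Implicit Types (p q : X -> R) (x y : X).

(** Homogeneity is asked as one inequality for positive real scalars: applied to 1 / t it yields the
    other, and it passes directly to infima. *)
Definition sublinear q :=
  (forall x y, q (x + y) <= q x + q y) /\
  (forall (t : R) x, 0 < t -> q (t%:C *: x) <= t * q x).

Lemma sublinearZ q (t : R) x : sublinear q -> 0 <= t -> q (t%:C *: x) = t * q x.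
Proof.
move=> [_ qZ]; rewrite le_eqVlt => /orP[/eqP <-|t0].
  rewrite scale0r mul0r; have := qZ 2 0; have := qZ 2^-1 0; rewrite !scaler0.
  by move=> /(_ _)/wrap[|h1 /(_ _)/wrap[|h2]]; lra.
apply/le_anti; rewrite qZ//=; have := qZ t^-1 (t%:C *: x).
rewrite scalerA -rmorphM /= mulVf ?gt_eqF// scale1r invr_gt0 => /(_ t0) h.
by rewrite -ler_pdivlMl.
Qed.

Lemma sublinear_ge q x y : sublinear q -> - q (- x) <= q x.
Proof.
move=> sq; have := sq.1 x (- x); rewrite subrr.
by have := sublinearZ 0 sq (lexx 0); rewrite scale0r mul0r => ->; lra.
Qed.

(** Common to two uses: the translates in [sublinear_shrink] and the chains in [sublinear_minimal].
    In both, two members are dominated jointly by a single one. *)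
Lemma sublinear_inf (E : set (X -> R)) : E !=set0 ->
  (forall x, exists b, forall p, E p -> b <= p x) ->
  (forall p1 p2 x y, E p1 -> E p2 -> exists2 p, E p & p (x + y) <= p1 x + p2 y) ->
  (forall p t x, E p -> 0 < t -> exists2 p', E p' & p' (t%:C *: x) <= t * p x) ->
  let q x := inf [set p x | p in E] in
  sublinear q /\ forall p x, E p -> q x <= p x.
Proof.
move=> [p0 Ep0] Eb ED EZ q.
have qle p x : E p -> q x <= p x.
  move=> Ep; apply: ge_inf; last by exists p.
  by have [b Hb] := Eb x; exists b => _ [p' /Hb h <-].
have lbq x (m : R) : (forall p, E p -> m <= p x) -> m <= q x.
  move=> H; apply: lb_le_inf; first by exists (p0 x), p0.
  by move=> _ [p /H h <-].
split=> //; split=> [x y|t x t0].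
  rewrite -lerBlDr; apply: (lbq x) => p1 E1; rewrite lerBlDr -lerBlDl.
  apply: (lbq y) => p2 E2; rewrite lerBlDl.
  have [p Ep h] := ED _ _ x y E1 E2; exact: le_trans (qle _ _ Ep) h.
rewrite -ler_pdivrMl//; apply: (lbq x) => p Ep; rewrite ler_pdivrMl//.
by have [p' Ep' h] := EZ p t x Ep t0; exact: le_trans (qle _ _ Ep') h.
Qed.

(** q'(y) is the infimum over t >= 0 of q(y + t x) - t q(x); the values t = 0 and t = 1 give the two
    bounds. *)
Lemma sublinear_shrink q x : sublinear q -> exists q', [/\ sublinear q',
  (forall y, q' y <= q y) & forall y, q' y <= q (y + x) - q x].
Proof.
move=> sq.
pose E : set (X -> R) := [set p | exists2 t : R, 0 <= t &
  p = fun y => q (y + t%:C *: x) - t * q x].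
have [||||] := @sublinear_inf E.
- by exists (fun y => q (y + 0%:C *: x) - 0 * q x), 0.
- move=> y; exists (- q (- y)) => _ [t t0 ->].
  have := sq.1 (- y) (y + t%:C *: x); rewrite addKr (sublinearZ x sq t0); lra.
- move=> _ _ y1 y2 [s s0 ->] [t t0 ->].
  exists (fun y => q (y + (s + t)%:C *: x) - (s + t) * q x).
    by exists (s + t) => //; exact: addr_ge0.
  have := sq.1 (y1 + s%:C *: x) (y2 + t%:C *: x).
  rewrite addrACA -scalerDl -rmorphD mulrDl; lra.
- move=> _ r y [t t0 ->] r0.
  exists (fun y => q (y + (r * t)%:C *: x) - (r * t) * q x).
    by exists (r * t) => //; rewrite mulr_ge0// ltW.
  by rewrite rmorphM /= -scalerA -scalerDr (sublinearZ _ sq (ltW r0)) -mulrA -mulrBr.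
move=> sq' q'E; exists (fun y => inf [set p y | p in E]); split=> // y.
  apply: le_trans (q'E (fun y => q (y + 0%:C *: x) - 0 * q x) y _) _; first by exists 0.
  by rewrite scale0r addr0 mul0r subr0.
apply: le_trans (q'E (fun y => q (y + 1%:C *: x) - 1 * q x) y _) _; first by exists 1.
by rewrite scale1r mul1r.
Qed.

(** Zorn's lemma for the reversed pointwise order. The infimum of a chain is finite because each
    member at x is at least -q0(-x). *)
Lemma sublinear_minimal q0 : sublinear q0 -> exists q, [/\ sublinear q,
  (forall x, q x <= q0 x) &
  forall q', sublinear q' -> (forall x, q' x <= q x) -> forall x, q' x = q x].
Proof.
move=> s0; pose T := {q | sublinear q /\ forall x, q x <= q0 x}.
pose le (s t : T) := `[< forall x, sval t x <= sval s x >].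
have [||||[q [sq qq0]] Hq] := @Zorn T le.
- by move=> t; apply/asboolP.
- move=> r s t /asboolP h1 /asboolP h2; apply/asboolP => x.
  exact: le_trans (h2 x) (h1 x).
- move=> [s Hs] [t Ht] /asboolP h1 /asboolP h2; apply: eq_exist.
  by apply/funext => x; apply/le_anti; rewrite h1 h2.
- move=> A Atot; have [[a Aa]|A0] := pselect (A !=set0); last first.
    by exists (exist _ q0 (conj s0 (fun=> lexx _))) => s As; case: A0; exists s.
  pose E := [set sval s | s in A].
  have EP (p : X -> R) : E p -> sublinear p /\ forall x, p x <= q0 x.
    by move=> [[s Hs] As <-].
  have [||||sE Ele] := @sublinear_inf E.
  + by exists (sval a), a.
  + move=> x; exists (- q0 (- x)) => p /EP[sp pq0].
    by apply: le_trans (sublinear_ge x x sp); rewrite lerN2.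
  + move=> _ _ x y [s As <-] [t At <-].
    have [/asboolP h|/asboolP h] := Atot s t As At.
      exists (sval t); first by exists t.
      have [[h1 _] _] := svalP t; apply: le_trans (h1 x y) _.
      by rewrite lerD2r.
    exists (sval s); first by exists s.
    have [[h1 _] _] := svalP s; apply: le_trans (h1 x y) _.
    by rewrite lerD2l.
  + move=> p t x Ep t0; exists p => //; have [[_ h] _] := EP p Ep; exact: h.
  have Hm : sublinear (fun x => inf [set p x | p in E]) /\
      forall x, inf [set p x | p in E] <= q0 x.
    split=> // x; apply: le_trans (Ele (sval a) x _) _; first by exists a.
    by have [_] := svalP a.
  exists (exist _ (fun x => inf [set p x | p in E]) Hm) => s As; apply/asboolP => x /=; apply: Ele.
  by exists s.
exists q; split=> // q' sq' q'q x.
have H' : sublinear q' /\ forall x, q' x <= q0 x.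
  by split=> // y; exact: le_trans (q'q y) (qq0 y).
by have /(congr1 sval)/= -> := Hq (exist _ q' H') (introT (asboolP _) q'q).
Qed.

(* A minimal sublinear functional is additive: q y + q x <= q (x + y) because
   shrinking q in the direction x cannot decrease it. *)
Lemma real_norming_functional (z : X) : exists f : X -> R, [/\
  forall x y, f (x + y) = f x + f y, forall (t : R) x, f (t%:C *: x) = t * f x,
  forall x, f x <= rnorm x & f z = rnorm z].
Proof.
have sn : sublinear (@rnorm R X).
  split; first exact: rnormD.
  by move=> t x t0; rewrite rnormZ rnorm_real gtr0_norm.
(* Shrinking the norm in direction z gives q0(-z) <= -|z|, so a linear f below q0 satisfies f(z) >=
   |z|. *)
have [q0 [s0 q0n q0z]] := sublinear_shrink z sn.
have [f [sf fq0 fmin]] := sublinear_minimal s0.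
have fD x y : f (x + y) = f x + f y.
  apply/le_anti; rewrite sf.1 /=.
  have [q [sq qf qx]] := sublinear_shrink y sf.
  by have := qx x; rewrite (fmin q sq qf); lra.
have f0 : f 0 = 0 by have := fD 0 0; rewrite addr0; lra.
have fN x : f (- x) = - f x by have := fD x (- x); rewrite subrr f0; lra.
exists f; split=> //.
- move=> t x; have [t0|t0] := leP 0 t; first exact: sublinearZ.
  have -> : t%:C *: x = - ((- t)%:C *: x) by rewrite -scaleNr -rmorphN opprK.
  by rewrite fN sublinearZ ?mulNr ?opprK// oppr_ge0 ltW.
- by move=> x; exact: le_trans (fq0 x) (q0n x).
apply/le_anti; rewrite (le_trans (fq0 z) (q0n z)) /=.
have := le_trans (fq0 (- z)) (q0z (- z)); rewrite addNr rnorm0 fN; lra.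
Qed.

(** The complex functional is f(x) - i f(i x). Its modulus at x is f of a unimodular multiple of x,
    hence at most |x|; at z the real part already has modulus |z|, which forces the imaginary part
    to vanish. *)
Lemma norming_functional (z : X) : z != 0 ->
  exists l : bounded_op X C, support_functionals z l.
Proof.
move=> z0; have [f [fD fZ fn fz]] := real_norming_functional z.
pose L (x : X) : C := f x -i* f ('i%C *: x).
have LD x y : L (x + y) = L x + L y.
  by rewrite /L scalerDr !fD; apply/eqP; rewrite eq_complex /= opprD !eqxx.
have fN x : f (-1 *: x) = - f x.
  by rewrite -(rmorphN1 (real_complex R)) fZ mulN1r.
have Li x : L ('i%C *: x) = 'i%C * L x.
  rewrite /L scalerA -expr2 sqr_i fN; apply/eqP; rewrite eq_complex /=.
  by rewrite !mul0r !mul1r sub0r !opprK add0r !eqxx.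
have Lr (t : R) x : L (t%:C *: x) = t%:C * L x.
  by rewrite /L scalerA mulrC -scalerA !fZ; simpc.
have LZ (a : C) x : L (a *: x) = a * L x.
  rewrite [in LHS](complexE a) scalerDl LD -scalerA Li !Lr [in RHS](complexE a).
  by rewrite mulrDl mulrA.
have lL : linear L by move=> a x y; rewrite LD LZ.
have Ln x : rnorm (L x) <= 1 * rnorm x.
  rewrite mul1r; have [->|Lx0] := eqVneq (L x) 0; first by rewrite rnorm0 rnorm_ge0.
  pose u : C := `|L x| / L x.
  have uL : L (u *: x) = (rnorm (L x))%:C by rewrite LZ divfK// rnormE.
  have : f (u *: x) = rnorm (L x) by move/(congr1 (@complex.Re R)): uL.
  have <- : rnorm (u *: x) = rnorm x.
    by rewrite rnormZ /rnorm normrM normfV normr_id mulfV ?normr_eq0// mul1r.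
  by move=> <-.
have [l lE] := bounded_opP lL Ln.
have lz : l z = `|z|.
  rewrite lE -rnormE; have := Ln z; have := Re_le_rnorm (L z); have := rnorm_sq (L z).
  rewrite /L /= fz mul1r (ger0_norm (rnorm_ge0 z)) => h h1 h2.
  have e : rnorm (rnorm z -i* f ('i%C *: z) : C) = rnorm z by apply/le_anti; rewrite h1 h2.
  move/eqP: h; rewrite e -subr_eq0 opprD addrA subrr add0r oppr_eq0 sqrf_eq0 oppr_eq0.
  by move=> /eqP ->; rewrite oppr0.
exists l; split=> //; rewrite -rnormE; congr (_%:C); apply/le_anti/andP; split.
  by apply: rnorm_op_le => // x x1; rewrite lE (le_trans (Ln x))// mul1r.
have := rnorm_op l z; rewrite {1}/rnorm lz normr_id -/(rnorm z).
by rewrite -{1}[rnorm z]mul1r ler_pM2r// rnorm_gt0.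
Qed.

End NormingFunctional.

(** * Primitives, the complex exponential and the extremal function *)

Section Exponential.
Variable R : realType.
Local Notation C := (R[i]^o).
Implicit Types (z w t : C).

Lemma lipschitz_disc (H : C -> C) (r : R) : 0 <= r -> r < 1 ->
  (forall t, rnorm t < 1 -> differentiable H t) -> exists2 M : R, 0 <= M &
  forall a b : C, rnorm a <= r -> rnorm b <= r -> rnorm (H b - H a) <= M * rnorm (b - a).
Proof.
move=> r0 r1 dH; have [z zr|z0 zr0 Hm] := @disc_max R (fun z => rnorm (derive1 H z : C)) r r0.
  have dd : differentiable (derive1 H) z.
    by apply: differentiable_derive1_disc => //; exact: le_lt_trans zr r1.
  have c1 := differentiable_continuous dd.
  exact: (continuous_comp c1 (@rnorm_continuous R C _)).
exists (rnorm (derive1 H z0 : C)); first exact: rnorm_ge0.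
apply: (@mean_value_inequality R C (fun z => rnorm z <= r)).
- exact: midclosed_disc0.
- exact: seqclosed_disc0.
- move=> z zr; exists (derive1 H z); last exact: Hm.
  by apply: diff_cderiv; apply: dH; exact: le_lt_trans zr r1.
Qed.

(** Quadratic dependence on the length: halving the segment divides the bound by 4 on each of two
    pieces, so each level gains a factor 2. *)
Lemma msum_step (H : C -> C) (r M : R) :
  (forall a b : C, rnorm a <= r -> rnorm b <= r -> rnorm (H b - H a) <= M * rnorm (b - a)) ->
  forall n (a b : C), rnorm a <= r -> rnorm b <= r ->
  rnorm (msum n.+1 H a b - msum n H a b : C) <= M * rnorm (b - a) ^+ 2 / 2 ^+ n.
Proof.
move=> HM; elim=> [|n IH] a b ar br.
  have mr := midclosed_disc0 ar br.
  have h1 := HM _ _ mr (midclosed_disc0 ar mr).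
  have h2 := HM _ _ mr (midclosed_disc0 mr br).
  have -> : msum 1 H a b - msum 0 H a b =
      ((b - a) / 2) * ((H (mid a (mid a b)) - H (mid a b)) + (H (mid (mid a b) b) - H (mid a b))).
    by rewrite /= mid_subl mid_subr -![_ *: _]/(_ * _); field.
  move: h1 h2; have -> : mid a (mid a b) - mid a b = - ((b - a) / 2 / 2) by rewrite /mid; field.
  rewrite mid_subl mid_subr rnormN !rnorm_half => h1 h2.
  rewrite rnormM rnorm_half expr0 divr1.
  have n0 := rnorm_ge0 (b - a).
  apply: (le_trans (ler_wpM2l _ (rnormD _ _))); first lra.
  apply: (le_trans (ler_wpM2l _ (lerD h1 h2))); first lra.
  have M0 : 0 <= M * rnorm (b - a) ^+ 2.
    have -> : M * rnorm (b - a) ^+ 2 = M * (rnorm (b - a) / 2 / 2) * (4 * rnorm (b - a)) by field.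
    by rewrite mulr_ge0 ?(le_trans (rnorm_ge0 _) h1)// mulr_ge0.
  have -> : rnorm (b - a) / 2 * (M * (rnorm (b - a) / 2 / 2) + M * (rnorm (b - a) / 2 / 2)) =
    M * rnorm (b - a) ^+ 2 / 4 by field.
  lra.
have mr := midclosed_disc0 ar br.
rewrite -[msum n.+2 H a b]/(msum n.+1 H a (mid a b) + msum n.+1 H (mid a b) b).
rewrite -[X in _ - X]/(msum n H a (mid a b) + msum n H (mid a b) b) opprD addrACA.
apply: le_trans (rnormD _ _) _.
apply: (le_trans (lerD (IH _ _ ar mr) (IH _ _ mr br))).
rewrite mid_subl mid_subr rnorm_half [2 ^+ n.+1]exprSr le_eqVlt; apply/orP; left; apply/eqP.
by field; rewrite expf_neq0.
Qed.

(** L(z) is the limit of the midpoint sums from 0 to z. Goursat on the triangle 0, z, z + h replaces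
    L(z + h) - L(z) by the sum from z to z + h, which differs from h H(z) by at most M |h|^2. *)
Lemma primitive_disc (H : C -> C) : (forall t, rnorm t < 1 -> differentiable H t) ->
  exists2 L : C -> C, L 0 = 0 & forall t, rnorm t < 1 -> cderiv L t (H t).
Proof.
move=> dH.
have zr0 (r : R) : 0 <= r -> rnorm (0 : C) <= r by rewrite rnorm0.
have exL z : rnorm z < 1 -> exists l : C, seq_lim (fun n => msum n H 0 z) l.
  move=> z1; have [M M0 HM] := lipschitz_disc (rnorm_ge0 z) z1 dH.
  apply: (@geo_complete_C _ _ (M * rnorm (z - 0) ^+ 2)) => n.
  by apply: (msum_step HM); [exact: zr0 (rnorm_ge0 z)|].
(* The default value 0 is taken only where the sums have no limit, hence never in the unit disc. *)
pose L z : C := xget 0 [set l | seq_lim (fun n => msum n H 0 z) l].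
have LP z : rnorm z < 1 -> seq_lim (fun n => msum n H 0 z) (L z).
  by move=> /exL[l Hl]; exact: (@xgetI _ 0 [set l | seq_lim (fun n => msum n H 0 z) l] l Hl).
exists L.
  apply: (seq_lim_unique (LP 0 _)); first by rewrite rnorm0.
  move=> e e0; exists 0%N => n _; rewrite subr0.
  have -> : msum n H 0 0 = 0 by elim: n => [|n IH] /=; rewrite ?subrr ?scale0r// /mid addr0 mul0r IH addr0.
  by rewrite rnorm0 ltW.
move=> z z1; pose r := (1 + rnorm z) / 2.
have n0 := rnorm_ge0 z.
have r0 : 0 <= r by rewrite /r; lra.
have r1 : r < 1 by rewrite /r; lra.
have zr : rnorm z <= r by rewrite /r; lra.
have [M M0 HM] := lipschitz_disc r0 r1 dH.
move=> e e0; have M1 : 0 < M + 1 by lra.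
exists (Num.min ((1 - rnorm z) / 2) (e / (M + 1))).
  by rewrite lt_min (divr_gt0 e0 M1) andbT; lra.
move=> h; rewrite le_min => /andP[hr he].
have zhr : rnorm (z + h) <= r.
  by apply: le_trans (rnormD _ _) _; rewrite /r; lra.
suff : rnorm (L (z + h) - L z - h *: H z) <= M * rnorm h * rnorm h.
  move=> /le_trans; apply; rewrite ler_wpM2r ?rnorm_ge0//.
  have := rnorm_ge0 h; move: he; rewrite ler_pdivlMr// mulrDr mulr1 mulrC; lra.
apply/ler_addgt0Pr => d d0; have d3 : 0 < d / 3 by lra.
have [N1 H1] := goursat (@midclosed_disc0 R r) (@seqclosed_disc0 R r)
  (fun t tr => ex_intro _ _ (diff_cderiv (dH t (le_lt_trans tr r1)))) (zr0 _ r0) zr zhr d3.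
have [N2 H2] := LP _ z1 _ d3.
have [N3 H3] := LP _ (le_lt_trans zhr r1) _ d3.
pose n := maxn N1 (maxn N2 N3).
have {H1} := H1 n (leq_maxl _ _).
have {H2} := H2 n (leq_trans (leq_maxl _ _) (leq_maxr _ _)).
have {H3} := H3 n (leq_trans (leq_maxr _ _) (leq_maxr _ _)).
have : rnorm (msum n H z (z + h) - h *: H z) <= M * rnorm h * rnorm h.
  have <- : msum n (fun=> H z) z (z + h) = h *: H z by rewrite msum_cst addrAC subrr add0r.
  rewrite -msumB; have {3}<- : z + h - z = h by rewrite addrAC subrr add0r.
  apply: (@msum_bound _ _ (fun t => rnorm (t - z) <= rnorm h /\ rnorm t <= r)).
  - apply: midclosedI; [exact: midclosed_disc|exact: midclosed_disc0].
  - by rewrite subrr rnorm0 rnorm_ge0.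
  - by rewrite addrAC subrr add0r.
  - move=> t [th tr]; apply: (le_trans (HM _ _ zr tr)).
    by rewrite ler_wpM2l.
rewrite /tri [msum n H (z + h) 0]msum_sym.
move: (msum n H 0 z : C) (msum n H z (z + h) : C) (msum n H 0 (z + h) : C) (h *: H z : C)
  (L z) (L (z + h)) => a b c u p q h1 h2 h3 h4.
have -> : q - p - u = (b - u) - (c - q) + (a - p) - (a + b - c) by ring.
apply: le_trans (rnormB _ _) _.
have := rnormD ((b - u) - (c - q)) (a - p); have := rnormB (b - u) (c - q).
lra.
Qed.

Lemma is_derive_small (f : R -> R) (d : R) : is_derive (0 : R) (1 : R) f d ->
  forall e : R, 0 < e -> exists2 r : R, 0 < r &
    forall h, `|h| <= r -> `|f h - f 0 - d * h| <= e * `|h|.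
Proof.
move=> [df dE] e e0.
have : h^-1 *: (f (h *: (1 : R) + 0) - f 0) @[h --> (0 : R)^'] --> d.
  by rewrite -dE; exact: df.
move=> /cvgrPdist_le/(_ _ e0)/nbhs_ballP[r /= r0 Hr].
exists (r / 2); first by rewrite divr_gt0.
move=> h hr; have [->|h0] := eqVneq h 0.
  by rewrite mulr0 subrr subr0 !normr0 mulr0.
have := Hr h; rewrite /ball /= sub0r normrN => /(_ _ h0)/wrap[|].
  by apply: le_lt_trans hr _; lra.
rewrite addr0 -[_ *: (1 : R)]/(_ * 1) mulr1 -[_ *: _]/(_ * _) => H.
have -> : f h - f 0 - d * h = - (d - h^-1 * (f h - f 0)) * h by field.
by rewrite normrM normrN ler_wpM2r.
Qed.

Definition cexp z : C :=
  expR (complex.Re z) * cos (complex.Im z) +i* (expR (complex.Re z) * sin (complex.Im z)).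

Lemma cexpD z w : cexp (z + w) = cexp z * cexp w.
Proof.
case: z => [x y]; case: w => [u v]; apply/eqP; rewrite eq_complex /=.
by rewrite expRD cosD sinD; apply/andP; split; apply/eqP; ring.
Qed.

Lemma cexp0 : cexp 0 = 1.
Proof. by apply/eqP; rewrite eq_complex /= expR0 cos0 sin0 mulr1 mulr0 !eqxx. Qed.

Lemma cexp_neq0 z : cexp z != 0.
Proof.
apply/eqP => h; have := cexpD z (- z); rewrite h mul0r subrr cexp0 => /eqP.
by rewrite oner_eq0.
Qed.

Lemma cexp_small (e : R) : 0 < e -> exists2 r : R, 0 < r &
  forall h : C, rnorm h <= r -> rnorm (cexp h - 1 - h : C) <= e * rnorm h.
Proof.
(* Four error terms below add up to at most 9 m |h|; m <= 1 keeps |h| <= 1 and thereby expR bounded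
   by 3. *)
move=> e0; pose m := Num.min (e / 12) 1.
have m0 : 0 < m by rewrite lt_min ltr01 andbT; lra.
have m1 : m <= 1 by rewrite ge_min lexx orbT.
have me : m <= e / 12 by rewrite ge_min lexx.
clearbody m.
have [r1 r10 H1] := is_derive_small (is_derive_expR 0) m0.
have [r2 r20 H2] := is_derive_small (is_derive_cos 0) m0.
have [r3 r30 H3] := is_derive_small (is_derive_sin 0) m0.
exists (Num.min m (Num.min r1 (Num.min r2 r3))); first by rewrite !lt_min m0 r10 r20.
move=> [x y] hh; have := hh; rewrite !le_min => /and4P[hm h1 h2 h3].
have /= xr := Re_le_rnorm (x +i* y); have /= yr := Im_le_rnorm (x +i* y).
have := H1 x (le_trans xr h1); have := H2 y (le_trans yr h2); have := H3 y (le_trans yr h3).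
rewrite expR0 cos0 sin0 oppr0 mul0r !mul1r addr0 subr0.
set n := rnorm _ in xr yr hm *.
set E := expR x; set c := cos y; set s := sin y => sb cb Eb.
have n0 : 0 <= n by exact: rnorm_ge0.
have E1 : `|E - 1| <= 2 * n.
  have -> : E - 1 = (E - 1 - x) + x by ring.
  apply: le_trans (ler_normD _ _) _; have : m * `|x| <= 1 * `|x| by rewrite ler_wpM2r.
  lra.
have E3 : `|E| <= 3.
  have -> : E = (E - 1) + 1 by ring.
  by apply: le_trans (ler_normD _ _) _; rewrite normr1; lra.
have sb' : `|s - y| <= m * n by apply: le_trans sb _; rewrite ler_wpM2l// ltW.
have cb' : `|c - 1| <= m * n by apply: le_trans cb _; rewrite ler_wpM2l// ltW.
have Eb' : `|E - 1 - x| <= m * n by apply: le_trans Eb _; rewrite ler_wpM2l// ltW.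
have k1 : `|E| * `|c - 1| <= 3 * (m * n) by exact: ler_pM.
have k2 : `|E| * `|s - y| <= 3 * (m * n) by exact: ler_pM.
have k3 : `|E - 1| * `|y| <= 2 * n * m by apply: ler_pM => //; lra.
have k4 : m * n <= e / 12 * n by rewrite ler_wpM2r.
have k5 : 0 <= e * n by rewrite mulr_ge0// ltW.
apply: le_trans (rnorm_le_ReIm _) _.
have -> : complex.Re (cexp (x +i* y) - 1 - (x +i* y) : C) = (E - 1 - x) + E * (c - 1).
  by rewrite /= -/E -/c; ring.
have -> : complex.Im (cexp (x +i* y) - 1 - (x +i* y) : C) = E * (s - y) + (E - 1) * y.
  by rewrite /= -/E -/s; ring.
have := ler_normD (E - 1 - x) (E * (c - 1)); have := ler_normD (E * (s - y)) ((E - 1) * y).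
rewrite !normrM; lra.
Qed.

Lemma cderiv_cexp z : cderiv cexp z (cexp z).
Proof.
move=> e e0; have n0 := rnorm_ge0 (cexp z).
have n1 : 0 < rnorm (cexp z) + 1 by lra.
have [r r0 Hr] := cexp_small (divr_gt0 e0 n1); exists r => // h /Hr hh.
have -> : cexp (z + h) - cexp z - h *: cexp z = cexp z * (cexp h - 1 - h).
  by rewrite cexpD -[_ *: _]/(_ * _); ring.
rewrite rnormM; apply: le_trans (ler_wpM2l n0 hh) _.
rewrite mulrA ler_wpM2r ?rnorm_ge0// mulrCA ger_pMr// ler_pdivrMr//; lra.
Qed.

(* f = exp L with L the primitive of (Phi(i t) - 1) / t vanishing at 0. *)
Lemma extremal_function (Phi : C -> C) :
  (forall t, rnorm t < 1 -> differentiable Phi t) -> Phi 0 = 1 ->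
  exists f : C -> C, [/\ f 0 = 1, forall t, f t != 0 & forall t, rnorm t < 1 ->
    exists2 d, cderiv f t d & f t + t * d = f t * Phi ('i%C * t)].
Proof.
move=> dP P0; pose w (t : C) : C := Phi ('i%C * t) - 1.
have dw t : rnorm t < 1 -> differentiable w t.
  move=> t1; have it1 : rnorm ('i%C * t : C) < 1 by rewrite rnormM rnorm_i mul1r.
  have := cderivB (cderiv_scale (diff_cderiv (dP _ it1))) (cderiv_cst (1 : C) t).
  by move=> /cderiv_diff[].
have w0 : w 0 = 0 by rewrite /w mulr0 P0 subrr.
have dH t : rnorm t < 1 -> differentiable (slope w) t.
  move=> t1; have s0 : 0 < (1 + rnorm t) / 2 by have := rnorm_ge0 t; lra.
  have ts : rnorm t < (1 + rnorm t) / 2 by lra.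
  by apply: (differentiable_slope s0 w0 _ ts) => z zr; apply: dw; lra.
have [L L0 dL] := primitive_disc dH.
exists (fun t => cexp (L t)); split.
- by rewrite L0 cexp0.
- by move=> t; exact: cexp_neq0.
move=> t t1; exists (slope w t *: cexp (L t)).
  exact: cderiv_comp (dL t t1) (cderiv_cexp (L t)).
have := slopeE t w0; rewrite /w -[_ *: _]/(_ * _) => e.
rewrite mulrA -e; ring.
Qed.

End Exponential.

(** * The extremal mapping: admissibility and coefficients *)

Section Sharpness.
Variable R : realType.
Local Notation C := (R[i]^o).

Lemma differentiable_local (V W : normedModType R[i]) (f g : V -> W) (x : V) (s : R) :
  0 < s -> (forall y, rnorm (y - x) <= s -> f y = g y) -> differentiable f x ->
  differentiable g x /\ 'd g x = 'd f x :> (V -> W).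
Proof.
move=> s0 fg df; have dE := frechetE df.
apply: (@fdiff_diff _ _ _ _ _ _ (rnorm (frechet f x))).
- by rewrite -dE; exact: bounded_op_linear.
- by move=> h; rewrite -dE; exact: rnorm_op.
- exact: fdiff_local s0 fg (differentiable_fdiff df).
Qed.

Lemma differentiable_comp_functional (X : normedModType R[i]) (l : bounded_op X C)
    (f : C -> C) (z : X) (d : C) : cderiv f (l z) d ->
  differentiable (fun x => f (l x)) z /\ forall v, 'd (fun x => f (l x)) z v = d * l v.
Proof.
move=> df; have lf : fdiff l z l.
  move=> e e0; exists 1 => // h _.
  rewrite (linear_add (@bounded_op_linear _ _ _ l)) [X in X - l z]addrC addrK subrr rnorm0.
  by rewrite mulr_ge0 ?rnorm_ge0// ltW.
have dn (h : C) : rnorm (h *: d : C) <= rnorm d * rnorm h by rewrite rnormZ mulrC.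
have dl : linear (fun h : C => h *: d : C) by move=> a u v; rewrite scalerDl scalerA.
have H := fdiff_comp (rnorm_op l) dl dn lf df.
have [||D E] := fdiff_diff (K := rnorm d * rnorm l) _ _ H.
- by move=> a u v; rewrite (@bounded_op_linear _ _ _ l) scalerDl -scalerA.
- by move=> h; rewrite rnormZ [leLHS]mulrC -mulrA ler_wpM2l ?rnorm_ge0// rnorm_op.
by split=> // v; rewrite E mulrC.
Qed.

(** The derivative of z -> f(l z) z is a rank-one perturbation of c I, with eigenvalue h at z; [B]
    is the Sherman-Morrison inverse. *)
Lemma radial_inverse (X : normedModType R[i]) (l : bounded_op X C) (z : X) (c d h : C) :
  c != 0 -> h != 0 -> h = c + l z * d ->
  exists A : bounded_op X X, [/\
    forall v, A ((d * l v) *: z + c *: v) = v,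
    forall v, (d * l (A v)) *: z + c *: A v = v & A (c *: z) = (c / h) *: z].
Proof.
move=> c0 h0 hE.
have lD := linear_add (@bounded_op_linear _ _ _ l).
have lZ := linear_scale (@bounded_op_linear _ _ _ l).
pose B (w : X) : X := c^-1 *: (w - (d * l w / h) *: z).
have BL : linear B.
  move=> a u v.
  transitivity (c^-1 *: (a *: (u - (d * l u / h) *: z) + (v - (d * l v / h) *: z))).
    congr (_ *: _); rewrite lD lZ scalerBr scalerA addrACA -opprD -scalerDl.
    by congr (_ - _ *: _); rewrite -[a *: l u]/(a * l u); ring.
  by rewrite scalerDr !scalerA; congr (_ *: _ + _); rewrite mulrC.
have BN w : rnorm (B w) <=
    rnorm (c^-1 : C) * (1 + rnorm (d / h : C) * rnorm l * rnorm z) * rnorm w.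
  rewrite /B rnormZ -[leRHS]mulrA; apply: ler_wpM2l; first exact: rnorm_ge0.
  apply: le_trans (rnormB _ _) _; rewrite [leRHS]mulrDl mul1r lerD2l rnormZ.
  have -> : d * l w / h = d / h * l w by rewrite mulrAC.
  rewrite (rnormM (d / h)).
  have := ler_wpM2l (mulr_ge0 (rnorm_ge0 (d / h : C)) (rnorm_ge0 z)) (rnorm_op l w).
  by congr (_ <= _); ring.
have [A AE] := bounded_opP BL BN.
have lB w : l (B w) = l w / h.
  rewrite /B lZ -scaleNr lD lZ -![_ *: _]/(_ * _) hE; field.
  by rewrite -hE h0 c0.
exists A; split.
- move=> v; rewrite AE /B lD !lZ -![_ *: l _]/(_ * _).
  have -> : d * (d * l v * l z + c * l v) / h = d * l v.
    by rewrite hE; field; rewrite -hE.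
  by rewrite [_ + c *: v]addrC addrK scalerA mulVf// scale1r.
- move=> v; rewrite AE lB /B scalerA mulfV// scale1r mulrA addrC subrK//.
- rewrite AE /B lZ -[c *: l z]/(c * l z) -scalerBl scalerA; congr (_ *: _).
  by rewrite hE; field; rewrite -hE h0 c0.
Qed.

(** Here c1 = i and c2 = 0: a2^2 = -b1^2, a3 = -(b2 + b1^2) / 2 and 2 a2^2 - a3 = -(3 b1^2 - b2) /
    2, so all terms of the expression add up. *)
Lemma extremal_value (b1 b2 : R) (a2 a3 D1 D2 P1 P2 : C) :
  P1 = b1%:C -> P2 = 2 * b2%:C -> a2 = D1 -> a3 = D2 / 2 ->
  D1 = 'i%C * P1 -> 2 * D2 = - (2 * P1 ^+ 2 + P2) ->
  2 * a2 ^+ 2 * a3 - a3 ^+ 2 - 2 * a2 ^+ 2 + 1 =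
  (1 + 2 * b1 ^+ 2 + (3 * b1 ^+ 2 - b2) * (b2 + b1 ^+ 2) / 4)%:C.
Proof.
move=> -> -> -> -> -> e.
have -> : D2 / 2 = - (b1%:C ^+ 2 + b2%:C) / 2.
  by transitivity (2 * D2 / 4); [field|rewrite e; field].
rewrite exprMn sqr_i !(rmorphD, rmorphB, rmorphM, rmorphXn, fmorphV, rmorph_nat, rmorph1) /=.
by field.
Qed.

Variables (X : normedModType R[i]) (Phi f : C -> C) (l : bounded_op X C).
Hypothesis dPhi : forall t, rnorm t < 1 -> differentiable Phi t.
Hypothesis Phi0 : Phi 0 = 1.
Hypothesis RePhi : forall t, rnorm t < 1 -> 0 < complex.Re (Phi t).
Hypothesis f_neq0 : forall t, f t != 0.
Hypothesis df : forall t, rnorm t < 1 ->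
  exists2 d, cderiv f t d & f t + t * d = f t * Phi ('i%C * t).
Hypothesis l1 : rnorm l <= 1.

Let lb z : rnorm z < 1 -> rnorm (l z) < 1.
Proof.
by apply: le_lt_trans; rewrite (le_trans (rnorm_op l z))// ler_piMl// rnorm_ge0.
Qed.

Let ib (t : C) : rnorm t < 1 -> rnorm ('i%C * t : C) < 1.
Proof. by rewrite rnormM rnorm_i mul1r. Qed.

Let Phi_neq0 t : rnorm t < 1 -> Phi t != 0.
Proof. by move=> /RePhi h; apply/eqP => h0; move: h; rewrite h0 ltxx. Qed.

Lemma extremal_differentiable z : rnorm z < 1 -> differentiable (fun x => f (l x)) z.
Proof.
by move=> /lb/df[d Hd _]; have [] := differentiable_comp_functional Hd.
Qed.

(** As f + t f' = f Phi(i t), the mapping to be tested is p(z) = z / Phi(i l(z)). It is radial, so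
    every support functional at z, not only [l], gives the quotient Phi(i l(z)); Dp(0) = I follows
    from Phi(0) = 1. *)
Lemma extremal_admissible : inv_deriv_in_class_M Phi (fun z => f (l z) *: z).
Proof.
pose G z := f (l z) *: z.
have /choice[A HA] : forall z, exists A : bounded_op X X, rnorm z < 1 ->
    [/\ forall v, A ('d G z v) = v, forall v, 'd G z (A v) = v &
        A (G z) = (Phi ('i%C * l z))^-1 *: z].
  move=> z; have [z1|z1] := ltP (rnorm z) 1; last by exists 0.
  have [d Hd dE] := df (lb z1).
  have [dg dgE] := differentiable_comp_functional Hd.
  have [_ dGE] := diff_radial dg.
  have P0 := Phi_neq0 (ib (lb z1)).
  have [A [A1 A2 A3]] := radial_inverse (f_neq0 (l z)) (mulf_neq0 (f_neq0 (l z)) P0) (esym dE).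
  exists A => _; split.
  - by move=> v; rewrite dGE dgE A1.
  - by move=> v; rewrite dGE dgE A2.
  - by rewrite A3 invfM mulrA mulfV// mul1r.
exists A; split; first by move=> z /unit_ballE/HA[].
pose k z : C := (Phi ('i%C * l z))^-1.
have kp z : rnorm z < 1 -> differentiable (fun z => A z (G z)) z /\
    forall v, 'd (fun z => A z (G z)) z v = 'd k z v *: z + k z *: v.
  move=> z1; have P0 := Phi_neq0 (ib (lb z1)).
  have [d Hd] := cderivV (k := fun t : C => Phi ('i%C * t))
    (cderiv_scale (diff_cderiv (dPhi (ib (lb z1))))) P0.
  have [dk _] := differentiable_comp_functional Hd.
  have [dkz dkE] := diff_radial dk.
  have s0 : 0 < (1 - rnorm z) / 2 by lra.
  have [|dp pE] := differentiable_local (g := fun z => A z (G z)) s0 _ dkz.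
    move=> y yz; have y1 : rnorm y < 1.
      have := rnormD (y - z) z; rewrite subrK; lra.
    by have [_ _ ->] := HA y y1.
  split; first exact: dp.
  by move=> v; rewrite pE; exact: dkE.
have r0 : rnorm (0 : X) < 1 by rewrite rnorm0.
have l0 : l 0 = 0 by rewrite linear0.
split.
- by move=> z /unit_ballE/kp[].
- by rewrite /G scaler0 linear0.
- by move=> v; have [_ ->] := kp 0 r0; rewrite scaler0 add0r /k l0 mulr0 Phi0 invr1 scale1r.
move=> z m /unit_ballE z1 z0 [mz _].
have [_ _ ->] := HA z z1; have P0 := Phi_neq0 (ib (lb z1)).
rewrite (linear_scale (@bounded_op_linear _ _ _ m)) mz -[_ *: _]/(_ * _).
have n0 : `|z| != 0 by rewrite normr_eq0.
split; first by rewrite mulf_neq0// invr_eq0.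
exists ('i%C * l z); first by apply/unit_ballE; exact/ib/lb.
by rewrite invfM invrK mulrCA mulfV// mulr1.
Qed.

Hypothesis f0 : f 0 = 1.

Lemma extremal_coefs : derive1 f 0 = 'i%C * derive1 Phi 0 /\
  2 * derive1 (derive1 f) 0 = - (2 * derive1 Phi 0 ^+ 2 + derive1 (derive1 Phi) 0).
Proof.
have ddf t : rnorm t < 1 -> differentiable f t by move=> /df[d /cderiv_diff[]].
have d1f := differentiable_derive1_disc ddf.
have d2f := differentiable_derive1_disc d1f.
have d1P := differentiable_derive1_disc dPhi.
have [] := @second_order_chain R f (derive1 f) (derive1 (derive1 f))
  (derive1 (derive1 (derive1 f))) (fun t => 'i%C * t) (fun=> 'i%C) (fun=> 0)
  Phi (derive1 Phi) (derive1 (derive1 Phi)).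
- by move=> z z1; exact/diff_cderiv/ddf.
- by move=> z z1; exact/diff_cderiv/d1f.
- by move=> z z1; exact/diff_cderiv/d2f.
- move=> z _; have := cderiv_scale (u := 'i%C) (cderiv_id ('i%C * z)).
  by rewrite [_ *: _]mulr1.
- by move=> z _; exact: cderiv_cst.
- by move=> z z1; exact/diff_cderiv/dPhi.
- by move=> z z1; exact/diff_cderiv/d1P.
- by move=> z; exact: ib.
- exact: f0.
- exact: mulr0.
- exact: Phi0.
- by move=> z z1; have [d Hd <-] := df z1; have [_ ->] := cderiv_diff Hd.
have key (a b p q : C) : a = p * 'i%C ->
    2 * b = 2 * a * (p * 'i%C) + 0 * p + 'i%C ^+ 2 * q ->
    a = 'i%C * p /\ 2 * b = - (2 * p ^+ 2 + q).
  move=> -> ->; split; first by rewrite mulrC.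
  transitivity (2 * p ^+ 2 * 'i%C ^+ 2 + 'i%C ^+ 2 * q); first by ring.
  by rewrite sqr_i; ring.
by move=> h1 h2; exact: (key _ _ _ _ h1 h2).
Qed.

End Sharpness.

Theorem theorem2p5 (R : realType) (X : completeNormedModType R[i])
    (X_neq0 : exists x : X, x != 0)
    (Phi : R[i]^o -> R[i]^o)
    (Phi_bihol : biholomorphic_onto_image (@unit_ball R R[i]^o) Phi)
    (Phi_0 : Phi 0 = 1)
    (Phi_re : forall z : R[i]^o, unit_ball z -> 0 < complex.Re (Phi z)) :
  let d1 : R[i] := Phi^`() 0 in
  let d2 : R[i] := Phi^`(2) 0 in
  0 < d1 ->
  d2 \is Num.real ->
  2 * d1 - 2 * d1 ^+ 2 <= d2 ->
  d2 <= 6 * d1 ^+ 2 - 2 * d1 ->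
  let bound : R[i] :=
    1 + 2 * d1 ^+ 2
      + d1 ^+ 2 / 4 * (3 * d1 - d2 / (2 * d1)) * (d2 / (2 * d1) + d1) in
  let admissible (g : X -> R[i]^o) : Prop :=
    [/\ holomorphic (@unit_ball R X) g, g 0 = 1 &
        inv_deriv_in_class_M Phi (fun z : X => g z *: z)] in
  let expr (g : X -> R[i]^o) (z : X) (l : bounded_op X R[i]^o) : R[i] :=
    let b2 := coef (fun z : X => g z *: z) z l 2 in
    let b3 := coef (fun z : X => g z *: z) z l 3 in
    `| 2 * b2 ^+ 2 * b3 - b3 ^+ 2 - 2 * b2 ^+ 2 + 1 | in
  (forall g : X -> R[i]^o, admissible g ->
    forall (z : X) (l : bounded_op X R[i]^o),
      unit_ball z -> z != 0 -> support_functionals z l ->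
      expr g z l <= bound) /\
  (exists (g : X -> R[i]^o) (z : X) (l : bounded_op X R[i]^o),
    [/\ admissible g, unit_ball z, z != 0, support_functionals z l &
        expr g z l = bound]).
Proof.
move=> d1 d2 d10 d2r h1 h2 bound admissible expr.
have dP t : rnorm t < 1 -> differentiable Phi t.
  by move=> t1; case: Phi_bihol => H _ _; apply: H; exact/unit_ballE.
have [b1 [b2 [b10 d1E d2E [k1 k2] bE]]] := bound_real d10 d2r h1 h2.
have d2E' : derive1 (derive1 Phi) 0 = 2 * b2%:C by exact: d2E.
split.
  move=> g [hg g0 Hg] z l _ z0 sl; rewrite /bound bE.
  apply: (upper_bound (@geo_complete_banach R X) Phi_bihol Phi_0 b10 k1 k2 d1E d2E' _ g0 Hg z0 sl);
    [|by []|by []].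
  by move=> y /unit_ballE; exact: hg.
have [x x0] := X_neq0; have nx : 0 < rnorm x by rewrite rnorm_gt0.
pose z := (2^-1 / rnorm x)%:C *: x.
have nz : rnorm z = 2^-1.
  rewrite rnormZ rnorm_real ger0_norm; first by rewrite divfK// gt_eqF.
  by rewrite divr_ge0 ?rnorm_ge0.
have z0 : z != 0 by rewrite -rnorm_gt0 nz.
clearbody z.
have [l sl] := norming_functional z0.
have nl : rnorm l <= 1 by rewrite /rnorm sl.2.
have [f [f0 fn df]] := extremal_function dP Phi_0.
have ReP t : rnorm t < 1 -> 0 < complex.Re (Phi t).
  by move=> t1; apply: Phi_re; exact/unit_ballE.
have dg := extremal_differentiable df nl.
exists (fun y => f (l y)), z, l; split=> //.
- split.
  + by move=> y /unit_ballE; exact: dg.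
  + by rewrite linear0.
  + exact: extremal_admissible dP Phi_0 ReP fn df nl.
- by apply/unit_ballE; rewrite nz invf_lt1// ltr1n.
have [_ c2 c3] := radial_coefs (@geo_complete_banach R X) dg z0 sl.1.
(* The normalised vector has l-value 1, so g restricted to its disc is [f] itself. *)
have fE : (fun t : R[i]^o => f (l (t *: ((rnorm z)^-1%:C *: z)))) = f.
  apply/funext => t; congr f.
  rewrite !(linear_scale (@bounded_op_linear _ _ _ l)) sl.1 -rnormE nz.
  by rewrite -[_%:C *: _]/(_%:C * _) -rmorphM /= invrK mulfV// [_ *: _]mulr1.
have [e1 e2] := extremal_coefs dP Phi_0 df f0.
rewrite /expr /bound bE fE in c2 c3 *.
rewrite (extremal_value d1E d2E' c2 c3 e1 e2).
rewrite -[LHS](@rnormE R R[i]^o) rnorm_real ger0_norm//.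
(* By [k1], [k2] and b1 > 0 both factors are positive, so the bound equals its own modulus. *)
have : 0 <= (3 * b1 ^+ 2 - b2) * (b2 + b1 ^+ 2) by rewrite mulr_ge0//; lra.
have := sqr_ge0 b1; lra.
Qed.
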